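(* Let $n$ and $t$ be positive integers with $n\ge 4t$, and let $\xi_1,\dots,\xi_{n+1}$ be elements of $K_w$. Suppose that there exists a non-zero element $\gamma$ of $K$ such that either we have $\xi_{i+1}=\gamma+\xi_i$ for $i=1,\dots,n$ (additive case), or we have $\xi_{i+1}=\gamma\xi_i$ for $i=1,\dots,n$ and $\gamma^i\neq1$ for $i=1,\dots,2n$ (multiplicative case). Assume moreover that, for each sufficiently large real number $Y$, there exists a non-zero polynomial $Q\in K[T]$ of degree at most $n$ which satisfies $\|Q\|_v\le 1$ for each place $v$ of $K$ distinct from $w$ and also $$ \|Q\|_w\le Y\quad\text{and}\quad \max_{t+1\le i\le n+1}|Q(\xi_i)|_w\le Y^{-(4t)/(n+1-4t)}. $$ Then $\xi_1,\dots,\xi_{n+1}$ are algebraic over $K$ of degree strictly less than $n/t$.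
   Context: $K$ is a number field of degree $d=[K:\mathbb{Q}]$ and $w$ is a fixed non-trivial place of $K$ (Archimedean or not). Places are non-trivial. For each place $v$ of $K$, $K_v$ is the completion of $K$ at $v$, $\mathbb{Q}_v$ is the topological closure of $\mathbb{Q}$ in $K_v$, and $d_v=[K_v:\mathbb{Q}_v]$. The absolute value $|\ |_v$ of $K_v$ is normalized so that $|p|_v=p^{-d_v/d}$ if $v$ lies above a prime number $p$, and $|x|_v=|x|^{d_v/d}$ for $x\in\mathbb{Q}$ if $v$ is Archimedean. For a polynomial $Q=\sum_{i=0}^n a_iT^i\in K_v[T]$, put $\|Q\|_v=\max_{0\le i\le n}|a_i|_v$. *)

(* Defs.v *)
From HB Require Import structures.
From mathcomp Require Import all_boot all_order all_algebra all_field.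
From mathcomp Require Import ring_quotient generic_quotient.
From mathcomp Require Import all_classical all_reals all_analysis.
From mathcomp Require Import ring lra.

Set Implicit Arguments.
Unset Strict Implicit.
Unset Printing Implicit Defensive.

Import Order.TTheory GRing.Theory Num.Theory.
Import numFieldNormedType.Exports.

Local Open Scope classical_set_scope.
Local Open Scope ring_scope.
Local Open Scope quotient_scope.

Record absval (R : realType) (F : fieldType) := AbsVal {
  av_fun :> F -> R;
  av_ge0 : forall x, 0 <= av_fun x;
  av_eq0 : forall x, av_fun x = 0 <-> x = 0;
  av_mul : forall x y, av_fun (x * y) = av_fun x * av_fun y;
  av_add : forall x y, av_fun (x + y) <= av_fun x + av_fun y }.

Section AbsVal.
Context {R : realType} {F : fieldType}.
Implicit Types v w : absval R F.

Definition av_nontrivial v := exists x, x != 0 /\ v x != 1.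

Definition av_archimedean v :=
  ~ (forall x y, v (x + y) <= Num.max (v x) (v y)).

Definition av_equiv v w := exists s : R, 0 < s /\ forall x, v x = w x `^ s.

Definition pnorm v (Q : {poly F}) : R := \big[Num.max/0]_(i < size Q) v Q`_i.

Lemma av0 v : v 0 = 0. Proof. by apply/av_eq0. Qed.

Lemma av1 v : v 1 = 1.
Proof.
have nz : v 1 != 0 by apply/eqP => /av_eq0 /eqP; rewrite oner_eq0.
by apply: (mulfI nz); rewrite mulr1 -av_mul mulr1.
Qed.

Lemma avN v x : v (- x) = v x.
Proof.
suff vN1 : v (- 1) = 1 by rewrite -mulN1r av_mul vN1 mul1r.
have : v (- 1) ^+ 2 = 1 by rewrite expr2 -av_mul mulrNN mulr1 av1.
by move=> /eqP; rewrite sqrf_eq1 => /orP[/eqP//|/eqP h]; have := av_ge0 v (- 1); lra.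
Qed.

Lemma avB v x y : v (x - y) <= v x + v y.
Proof. by rewrite -(avN v y) av_add. Qed.

Lemma av_distC v x y : v (x - y) = v (y - x).
Proof. by rewrite -avN opprB. Qed.

Lemma av_dist v x y : `|v x - v y| <= v (x - y).
Proof.
have h a b : v a <= v (a - b) + v b by have := av_add v (a - b) b; rewrite subrK.
have h1 := h x y; have := h y x; rewrite av_distC ler_norml => h2.
by apply/andP; split; lra.
Qed.

Lemma avV v x : v x^-1 = (v x)^-1.
Proof.
have [->|x0] := eqVneq x 0; first by rewrite invr0 av0 invr0.
have nz : v x != 0 by apply/eqP => /av_eq0 /eqP; exact/negP.
by apply: (mulfI nz); rewrite -av_mul !mulfV// av1.
Qed.

End AbsVal.

(* The completion of F at v: Cauchy sequences modulo null sequences. *)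
Section Completion.
Context {R : realType} {F : fieldType} (v : absval R F).

Definition is_cauchy (u : nat -> F) := forall e : R, 0 < e ->
  exists N, forall m n, (N <= m)%N -> (N <= n)%N -> v (u m - u n) < e.

Definition is_null (u : nat -> F) := forall e : R, 0 < e ->
  exists N, forall n, (N <= n)%N -> v (u n) < e.

Lemma cauchy_bounded u : is_cauchy u -> exists2 B : R, 0 < B & forall n, v (u n) <= B.
Proof.
move=> /(_ 1 ltr01)[N hN].
pose B := \sum_(i < N.+1) v (u i) + 1.
have hB k : (k <= N)%N -> v (u k) <= B - 1.
  move=> kN; rewrite /B addrK (bigD1 (inord k))//= inordK// lerDl.
  by apply: sumr_ge0 => i _; exact: av_ge0.
exists B; first by rewrite ltr_wpDl// sumr_ge0// => i _; exact: av_ge0.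
move=> n; have [nN|/ltnW nN] := leqP n N; first by have := hB _ nN; lra.
have := hN n N nN (leqnn _); have := hB _ (leqnn N).
by have := av_add v (u n - u N) (u N); rewrite subrK; lra.
Qed.

Definition cauchy_pred : {pred nat -> F} := [pred u | `[< is_cauchy u >]].

Lemma cauchy_subring : subring_closed cauchy_pred.
Proof.
split.
- apply/asboolP => e e0; exists 0%N => m n _ _.
  by rewrite (_ : _ - _ = 0) ?av0//; exact: subrr.
- move=> u w /asboolP cu /asboolP cw; apply/asboolP => e e0.
  have [N hN] := cu (e / 2) ltac:(lra); have [M hM] := cw (e / 2) ltac:(lra).
  exists (maxn N M) => m n; rewrite !geq_max => /andP[Nm Mm] /andP[Nn Mn].
  have := hN m n Nm Nn; have := hM m n Mm Mn.
  rewrite (_ : (u - w) m - (u - w) n = (u m - u n) - (w m - w n)).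
    by have := avB v (u m - u n) (w m - w n); lra.
  by rewrite !fctE; ring.
- move=> u w /asboolP cu /asboolP cw; apply/asboolP => e e0.
  have [B B0 hB] := cauchy_bounded cu; have [C C0 hC] := cauchy_bounded cw.
  have [N hN] := cu (e / 2 / C) ltac:(apply: divr_gt0 => //; lra).
  have [M hM] := cw (e / 2 / B) ltac:(apply: divr_gt0 => //; lra).
  exists (maxn N M) => m n; rewrite !geq_max => /andP[Nm Mm] /andP[Nn Mn].
  have h1 := hN m n Nm Nn; have h2 := hM m n Mm Mn.
  rewrite (_ : (u * w) m - (u * w) n = (u m - u n) * w m + u n * (w m - w n)).
    apply: (le_lt_trans (av_add _ _ _)); rewrite !av_mul.
    have h3 : v (u m - u n) * v (w m) < e / 2.
      apply: (@le_lt_trans _ _ (v (u m - u n) * C)).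
        by rewrite ler_wpM2l ?av_ge0.
      by rewrite -ltr_pdivlMr.
    have h4 : v (u n) * v (w m - w n) < e / 2.
      apply: (@le_lt_trans _ _ (B * v (w m - w n))).
        by rewrite ler_wpM2r ?av_ge0.
      by rewrite mulrC -ltr_pdivlMr.
    by lra.
  by rewrite !fctE; ring.
Qed.

HB.instance Definition _ :=
  GRing.isSubringClosed.Build (nat -> F) cauchy_pred cauchy_subring.

Record cauchy_seq := CauchySeq {
  cs_fun :> nat -> F; cs_funP : cs_fun \in cauchy_pred }.

HB.instance Definition _ := [isSub for cs_fun].
HB.instance Definition _ := [Choice of cauchy_seq by <:].
HB.instance Definition _ := [SubChoice_isSubComNzRing of cauchy_seq by <:].

Lemma cs_cauchy (u : cauchy_seq) : is_cauchy u.
Proof. by have /asboolP := cs_funP u. Qed.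

Definition null_pred : {pred cauchy_seq} := [pred u : cauchy_seq | `[< is_null u >]].

Lemma null_ideal : idealr_closed null_pred.
Proof.
split.
- by apply/asboolP => e e0; exists 0%N => n _; rewrite [cs_fun _ _](_ : _ = 0) ?av0.
- apply/negP => /asboolP /(_ 1 ltr01)[N /(_ N (leqnn N))].
  by rewrite [cs_fun _ _](_ : _ = 1)// av1 ltxx.
- move=> a u w /asboolP nu /asboolP nw; apply/asboolP => e e0.
  have [B B0 hB] := cauchy_bounded (cs_cauchy a).
  have [N hN] := nu (e / 2 / B) ltac:(apply: divr_gt0 => //; lra).
  have [M hM] := nw (e / 2) ltac:(lra).
  exists (maxn N M) => n; rewrite !geq_max => /andP[Nn Mn].
  rewrite [cs_fun _ _](_ : _ = a n * u n + w n)//.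
  apply: (le_lt_trans (av_add _ _ _)); rewrite av_mul.
  have h1 : v (a n) * v (u n) < e / 2.
    apply: (@le_lt_trans _ _ (B * v (u n))); first by rewrite ler_wpM2r ?av_ge0.
    by rewrite mulrC -ltr_pdivlMr//; exact: hN.
  by have := hM n Mn; lra.
Qed.

HB.instance Definition _ := isIdealr.Build cauchy_seq null_pred null_ideal.

Definition completion : Type := {ideal_quot (null_pred : idealr cauchy_seq)}.
HB.instance Definition _ := GRing.ComNzRing.on completion.

Definition cls : cauchy_seq -> completion := \pi_{ideal_quot (null_pred : idealr cauchy_seq)}.

Lemma cls_zmod : zmod_morphism cls.
Proof. by move=> u w; rewrite /cls !piE. Qed.

Lemma cls_monoid : monoid_morphism cls.
Proof. by split=> [|u w]; rewrite /cls !piE. Qed.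

HB.instance Definition _ := GRing.isZmodMorphism.Build cauchy_seq completion cls cls_zmod.
HB.instance Definition _ := GRing.isMonoidMorphism.Build cauchy_seq completion cls cls_monoid.

Definition cauchy_repr (x : completion) : cauchy_seq := repr x.

Lemma cauchy_reprK x : cls (cauchy_repr x) = x.
Proof. exact: reprK. Qed.

Lemma cls_eq (u w : cauchy_seq) : cls u = cls w <-> is_null (fun n => u n - w n).
Proof.
have -> : is_null (fun n => u n - w n) <-> u - w \in null_pred by split => /asboolP.
rewrite Quotient.idealrBE; split; [by move=> h; apply/eqP|by move=> /eqP].
Qed.

Lemma cls_eq0 (u : cauchy_seq) : cls u = 0 <-> is_null u.
Proof.
rewrite -[0](rmorph0 cls) cls_eq.
by rewrite (_ : (fun n => _) = u)//; apply/funext => n; rewrite subr0.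
Qed.

Lemma nonnull_bound (u : cauchy_seq) : ~ is_null u ->
  exists2 c : R, 0 < c & exists N, forall n, (N <= n)%N -> c <= v (u n).
Proof.
move=> /existsNP[e /not_implyP[e0 /forallNP nu]].
have [N hN] := cs_cauchy u (e := e / 2) ltac:(lra).
exists (e / 2); first by lra.
exists N => n Nn; have /existsNP[m /not_implyP[Nm /negP]] := nu N.
rewrite -leNgt => em; have := hN m n Nm Nn.
by have := av_add v (u m - u n) (u n); rewrite subrK; lra.
Qed.

Lemma cauchy_inv (u : cauchy_seq) : ~ is_null u -> is_cauchy (fun n => (u n)^-1).
Proof.
move=> /nonnull_bound[c c0 [N hN]] e e0.
have [M hM] := cs_cauchy u (e := e * (c * c)) ltac:(by rewrite !mulr_gt0).
exists (maxn N M) => m n; rewrite !geq_max => /andP[Nm Mm] /andP[Nn Mn].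
have nz k : (N <= k)%N -> u k != 0.
  move=> Nk; apply/eqP => uk0; have := hN k Nk; rewrite uk0 av0; lra.
rewrite (_ : _ - _ = (u n - u m) * ((u m)^-1 * (u n)^-1)); last first.
  by field; rewrite !nz.
rewrite !av_mul !avV -invfM -ltr_pdivlMr ?invr_gt0 ?mulr_gt0 ?(lt_le_trans c0) ?hN//.
rewrite invrK; apply: (lt_le_trans (hM n m Mn Mm)).
by rewrite ler_pM2l// ler_pM ?hN// ltW.
Qed.

Definition completion_inv (x : completion) : completion :=
  if x == 0 then 0 else cls (insubd (0 : cauchy_seq) (fun n => (cauchy_repr x n)^-1)).

Lemma completion_mulVf (x : completion) : x != 0 -> completion_inv x * x = 1.
Proof.
move=> x0; rewrite /completion_inv (negbTE x0) -{2}(cauchy_reprK x).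
set u := cauchy_repr x.
have nu : ~ is_null u by move/cls_eq0; rewrite cauchy_reprK; exact/eqP.
have [c c0 [N hN]] := nonnull_bound nu.
rewrite -rmorphM -[1](rmorph1 cls); apply/cls_eq => e e0; exists N => n Nn.
set w := insubd _ _.
have -> : (w * u) n = w n * u n by [].
have -> : w n = (u n)^-1.
  by rewrite /w -[LHS]/(val _ n) insubdK//; apply/asboolP; exact: cauchy_inv.
rewrite -[(1 : cauchy_seq) n]/(1 : F) mulVf ?subrr ?av0//.
by apply/eqP => un0; have := hN n Nn; rewrite un0 av0; lra.
Qed.

Lemma completion_inv0 : completion_inv 0 = 0.
Proof. by rewrite /completion_inv eqxx. Qed.

HB.instance Definition _ :=
  GRing.ComNzRing_isField.Build completion completion_mulVf completion_inv0.

Lemma cst_cauchy (x : F) : (fun=> x) \in cauchy_pred.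
Proof. by apply/asboolP => e e0; exists 0%N => m n _ _; rewrite subrr av0. Qed.

Definition emb (x : F) : completion := cls (CauchySeq (cst_cauchy x)).

Lemma emb_zmod : zmod_morphism emb.
Proof. by move=> x y; rewrite /emb -rmorphB; congr cls; exact: val_inj. Qed.

Lemma emb_monoid : monoid_morphism emb.
Proof.
split=> [|x y]; first by rewrite -[RHS](rmorph1 cls); congr cls; exact: val_inj.
by rewrite /emb -rmorphM; congr cls; exact: val_inj.
Qed.

HB.instance Definition _ := GRing.isZmodMorphism.Build F completion emb emb_zmod.
HB.instance Definition _ := GRing.isMonoidMorphism.Build F completion emb emb_monoid.

Definition completion_abs (x : completion) : R :=
  limn (fun n => v (cauchy_repr x n)).

Lemma is_cauchy_cvg (u : nat -> F) : is_cauchy u -> cvgn (fun n => v (u n)).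
Proof.
move=> cu; apply/cauchy_cvgP/cauchy_ballP => e e0.
have [N hN] := cu e e0.
have NN : \forall n \near \oo, (N <= n)%N by exists N.
near_simpl; exists ([set n | (N <= n)%N], [set n | (N <= n)%N]) => /=.
  by split.
move=> [m n] /= [Nm Nn]; rewrite /ball/=.
exact: le_lt_trans (av_dist _ _ _) (hN m n Nm Nn).
Qed.

Lemma is_null_cvg (u : nat -> F) : is_null u <-> v (u n) @[n --> \oo] --> (0 : R).
Proof.
split=> [nu|/cvgrPdist_lt h e e0].
  apply/cvgrPdist_lt => e e0; have [N hN] := nu e e0.
  by exists N => // n Nn; rewrite sub0r normrN ger0_norm ?av_ge0// hN.
have [N _ hN] := h e e0; exists N => n Nn.
by have := hN n Nn; rewrite sub0r normrN ger0_norm ?av_ge0.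
Qed.

Lemma completion_abs_cls (u : cauchy_seq) :
  v (u n) @[n --> \oo] --> completion_abs (cls u).
Proof.
set w := cauchy_repr (cls u).
have /cls_eq/is_null_cvg nuw : cls u = cls w by rewrite cauchy_reprK.
have cw : v (w n) @[n --> \oo] --> completion_abs (cls u).
  by apply: is_cauchy_cvg; exact: cs_cauchy.
have d0 : v (u n) - v (w n) @[n --> \oo] --> (0 : R).
  apply/norm_cvg0P; apply: (squeeze_cvgr _ (cvg_cst 0) nuw).
  by apply: nearW => n; rewrite normr_ge0 av_dist.
rewrite -[X in _ --> X]add0r.
rewrite (_ : (fun n => v (u n)) = (fun n => v (u n) - v (w n)) \+ (fun n => v (w n))).
  exact: cvgD.
by apply/funext => n /=; rewrite subrK.
Qed.

Lemma completion_absE (u : cauchy_seq) (l : R) :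
  v (u n) @[n --> \oo] --> l -> completion_abs (cls u) = l.
Proof. move=> h; rewrite -(cvg_lim (@norm_hausdorff _ R^o) h).
by rewrite -(cvg_lim (@norm_hausdorff _ R^o) (@completion_abs_cls u)). Qed.

Lemma completion_abs_ge0 x : 0 <= completion_abs x.
Proof.
rewrite -(cauchy_reprK x); apply: (limr_ge (x := 0)).
  by apply: is_cauchy_cvg; exact: cs_cauchy.
by apply: nearW => n; exact: av_ge0.
Qed.

Lemma completion_abs_eq0 x : completion_abs x = 0 <-> x = 0.
Proof.
rewrite -(cauchy_reprK x) cls_eq0 is_null_cvg; split=> [<-|/completion_absE//].
exact: completion_abs_cls.
Qed.

Lemma completion_abs_mul x y :
  completion_abs (x * y) = completion_abs x * completion_abs y.
Proof.
rewrite -(cauchy_reprK x) -(cauchy_reprK y) -rmorphM.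
apply: completion_absE; under eq_fun do rewrite [v _](av_mul v).
by apply: cvgM; exact: completion_abs_cls.
Qed.

Lemma completion_abs_add x y :
  completion_abs (x + y) <= completion_abs x + completion_abs y.
Proof.
rewrite -(cauchy_reprK x) -(cauchy_reprK y) -rmorphD.
have h1 := @completion_abs_cls (cauchy_repr x).
have h2 := @completion_abs_cls (cauchy_repr y).
apply: (ler_cvg_to (@completion_abs_cls _) (cvgD h1 h2)).
by apply: nearW => n; exact: av_add.
Qed.

Definition cabs : absval R completion :=
  AbsVal completion_abs_ge0 completion_abs_eq0 completion_abs_mul completion_abs_add.

Lemma cabs_emb x : cabs (emb x) = v x.
Proof. by apply: completion_absE => /=; exact: (@cvg_cst R^o). Qed.

Lemma cabs_le (u : cauchy_seq) (e : R) N :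
  (forall n, (N <= n)%N -> v (u n) <= e) -> cabs (cls u) <= e.
Proof.
move=> h; apply: (ler_cvg_to (@completion_abs_cls u) (cvg_cst e)).
by exists N.
Qed.

Lemma emb_dense (x : completion) (e : R) : 0 < e -> exists y, cabs (x - emb y) < e.
Proof.
move=> e0; rewrite -(cauchy_reprK x); set u := cauchy_repr x.
have [N hN] := cs_cauchy u (e := e / 2) ltac:(lra).
exists (u N); rewrite /emb -rmorphB.
apply: (@le_lt_trans _ _ (e / 2)); last by lra.
by apply: (@cabs_le _ _ N) => n Nn; apply/ltW/hN.
Qed.

End Completion.

Lemma completion_complete (R : realType) (F : fieldType) (v : absval R F)
    (u : nat -> completion v) :
  is_cauchy (cabs v) u -> exists x, is_null (cabs v) (fun n => u n - x).
Proof.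
move=> cu.
have /choice[a ha] n : exists a, cabs v (u n - emb v a) < n.+1%:R^-1.
  by apply: emb_dense; rewrite invr_gt0.
have small (e : R) : 0 < e -> exists N, forall n, (N <= n)%N -> n.+1%:R^-1 < e.
  move=> e0; have [N _ hN] := near_infty_natSinv_lt (PosNum e0).
  by exists N => n Nn; exact: hN.
have ca : is_cauchy v a.
  move=> e e0; have [N hN] := cu (e / 3) ltac:(lra).
  have [M hM] := small (e / 3) ltac:(lra).
  exists (maxn N M) => m n; rewrite !geq_max => /andP[Nm Mm] /andP[Nn Mn].
  rewrite -cabs_emb rmorphB.
  have := hN m n Nm Nn; have := lt_trans (ha m) (hM m Mm);
    have := lt_trans (ha n) (hM n Mn).
  have -> : emb v (a m) - emb v (a n) =
      (u m - u n) - (u m - emb v (a m)) + (u n - emb v (a n)) by ring.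
  have := av_add (cabs v) (u m - u n - (u m - emb v (a m))) (u n - emb v (a n)).
  have := avB (cabs v) (u m - u n) (u m - emb v (a m)).
  by lra.
have ca' : a \in cauchy_pred v by apply/asboolP.
exists (cls (CauchySeq ca')) => e e0.
have [N hN] := ca (e / 3) ltac:(lra); have [M hM] := small (e / 3) ltac:(lra).
exists (maxn N M) => n; rewrite geq_max => /andP[Nn Mn].
have h : cabs v (emb v (a n) - cls (CauchySeq ca')) <= e / 3.
  by rewrite /emb -rmorphB; apply: (@cabs_le _ _ _ _ _ N) => m Nm; apply/ltW/hN.
have := av_add (cabs v) (u n - emb v (a n)) (emb v (a n) - cls (CauchySeq ca')).
by rewrite addrA subrK; have := lt_trans (ha n) (hM n Mn); lra.
Qed.

(* E is a subfield of L; the degree is 0 when L is infinite-dimensional over E. *)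
Definition is_basis_over (L : fieldType) (E : set L) n (b : 'I_n -> L) :=
  forall x, exists! c : {ffun 'I_n -> L},
    (forall i, E (c i)) /\ x = \sum_(i < n) c i * b i.

Definition degree_over (L : fieldType) (E : set L) : nat :=
  xget 0%N [set n | exists b : 'I_n -> L, is_basis_over E b].

Section Places.
Context {R : realType} {K : fieldExtType rat}.

Definition closure_rat (v : absval R K) : set (completion v) :=
  [set x | forall e : R, 0 < e -> exists q : rat, cabs v (x - ratr q) < e].

Definition local_degree (v : absval R K) : nat := degree_over (@closure_rat v).

Definition local_ratio (v : absval R K) : R :=
  (local_degree v)%:R / (\dim {:K})%:R.

(* A prime p lies below v when v p < 1. *)
Definition av_normalized (v : absval R K) :=
  (forall p : nat, prime p -> v p%:R < 1 -> v p%:R = p%:R `^ (- local_ratio v))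
  /\ (av_archimedean v -> forall q : rat, v (ratr q) = `|ratr q| `^ local_ratio v).

(* Every equivalence class of non-trivial absolute values contains exactly one
   normalized absolute value, which serves as the representative of the place. *)
Record place := Place {
  place_abs :> absval R K;
  place_nontrivial : av_nontrivial place_abs;
  place_normalized : av_normalized place_abs }.

Definition same_place (v w : place) := av_equiv v w.

End Places.

Arguments place : clear implicits.
Arguments closure_rat {R K} v : rename.

Definition algebraic_of_degree (F L : fieldType) (iota : {rmorphism F -> L})
    (x : L) (m : nat) :=
  exists p : {poly F}, [/\ p \is monic, irreducible_poly p,
    root (map_poly iota p) x & size p = m.+1].

(* Main.v *)
Require Import Defs.
From HB Require Import structures.
From mathcomp Require Import all_boot all_order all_fingroup all_algebra all_field.
From mathcomp Require Import all_classical all_reals all_analysis.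
From mathcomp Require Import ring lra zify.
From mathcomp Require complex.

Set Implicit Arguments.
Unset Strict Implicit.
Unset Printing Implicit Defensive.

Import Order.TTheory GRing.Theory Num.Theory.
Import numFieldNormedType.Exports.

Local Open Scope classical_set_scope.
Local Open Scope ring_scope.

(* The xi_i form an orbit x_0, x_1, ... of an affine map sigma over K. The space
   of polynomials of degree at most n carries a sigma-invariant bilinear pairing
   over K which, on the orbit, is given by an upper triangular matrix; so a
   polynomial Q that is small at all x_l with l >= t pairs almost trivially with
   everything. Let L be the polynomial of least degree all of whose translates by
   sigma^k, k <= t, are orthogonal to Q against multipliers of bounded degree.
   Elimination theory makes L a gcd of all solutions, Cramer's rule with a
   Toeplitz minor bounds its height, and L is small at one of x_0, ..., x_(t-1).
   Comparing two parameters Y <= Y' by the product formula shows that the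
   irreducible factors of L_Y recur, up to a bounded translation, in L_Y'. Taking
   a maximal set of factors that are far apart, one finds a sequence of Y tending
   to infinity along which all factors of L_Y lie in a fixed finite set up to
   scalars; since L_Y gets small at x_0, ..., x_(t-1), one of them vanishes there.
   At least t + 1 non-associate translates of that factor divide L_Y, whose degree
   is at most (n + 1) / 2, and this bounds its degree. *)

(** * Absolute values and norms of polynomials *)

(** Places are given only as normalized absolute values, so neither a product formula nor heights
    are at hand. Only one inequality is used, [star]: a nonzero [x] with harmless bounds at all
    places other than [w] cannot be too small at [w]. It requires that enough places exist; they are
    built from valuation rings and complex embeddings, then raised to the power d_v/d, which is
    legitimate because 0 < d_v <= d. A height is carried by one element [mu] of [K] that stands in
    for the places other than [w]. The exponent kap = 4t/(n+1-4t) comes from counting. At [w] the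
    linear system is a matrix of rank 2t and size Y plus one of size Y^-kap, so a minor that takes r
    = m+1-e of its columns is at most about Y^(2t(1+kap) - kap r) = Y^(kap e - theta), where theta =
    kap(m+1-2t) - 2t. As m is half of n+1, theta is positive. This saving makes the iteration
    possible: the test at Y tolerates height Y^kap, while L_Y' has height at most Y'^(kap - theta')
    up to a constant, so Y' may be a power Y^(1+eta). *)

Section AbsvalTheory.
Context {R : realType} {F : fieldType}.
Implicit Types (v : absval R F) (P Q : {poly F}).

Definition av_ultra v := forall x y, v (x + y) <= Num.max (v x) (v y).

(* Ultrametric inequalities hold without the constants of archimedean ones. *)
Definition avc v (B : R) : R := if `[< av_archimedean v >] then B else 1.

Lemma avc_arch v B : av_archimedean v -> avc v B = B.
Proof. by move=> h; rewrite /avc asboolT. Qed.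

Lemma avc_ultra v B : av_ultra v -> avc v B = 1.
Proof. by move=> h; rewrite /avc asboolF// => /(_ h). Qed.

Lemma av_archP v : av_archimedean v \/ av_ultra v.
Proof. by have [|/contrapT] := pselect (av_archimedean v); [left|right]. Qed.

Lemma avcM v B C : avc v (B * C) = avc v B * avc v C.
Proof. by rewrite /avc; case: asboolP; rewrite // mulr1. Qed.

Lemma avc_ge1 v B : 1 <= B -> 1 <= avc v B.
Proof. by rewrite /avc; case: asboolP. Qed.

Lemma avc_le v B : 1 <= B -> avc v B <= B.
Proof. by rewrite /avc; case: asboolP. Qed.

Lemma le_avc v B C : B <= C -> avc v B <= avc v C.
Proof. by rewrite /avc; case: asboolP. Qed.

Lemma avX v x k : v (x ^+ k) = v x ^+ k.
Proof. by elim: k => [|k IH]; rewrite ?expr0 ?av1// !exprS av_mul IH. Qed.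

Lemma av_gt0 v x : x != 0 -> 0 < v x.
Proof.
move=> x0; rewrite lt_neqAle av_ge0 andbT eq_sym.
by apply/eqP => /av_eq0 /eqP; exact/negP.
Qed.

Lemma av_prod v (I : Type) (r : seq I) (A : pred I) (f : I -> F) :
  v (\prod_(i <- r | A i) f i) = \prod_(i <- r | A i) v (f i).
Proof. by apply: (big_morph v (av_mul v) (av1 v)). Qed.

Lemma av_sum v (I : finType) (A : pred I) (f : I -> F) (b : R) :
  0 <= b -> (forall i, A i -> v (f i) <= b) ->
  v (\sum_(i | A i) f i) <= avc v (#|I|%:R) * b.
Proof.
move=> b0 h; have [ar|ul] := av_archP v.
  rewrite avc_arch// -sum1_card natr_sum mulr_suml.
  apply: (@le_trans _ _ (\sum_(i | A i) b)).
    apply: (big_rec2 (fun x y => v x <= y)); first by rewrite av0.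
    move=> i y1 y2 Ai h2; apply: le_trans (av_add _ _ _) _.
    by rewrite lerD// h.
  rewrite [leRHS](bigID A)/= [X in _ <= _ + X](_ : _ = \sum_(i | ~~ A i) b); last first.
    by apply: eq_big => i; rewrite ?inE ?mul1r.
  rewrite [X in _ <= X + _](_ : _ = \sum_(i | A i) b); last first.
    by apply: eq_big => i; rewrite ?inE ?mul1r.
  by rewrite lerDl sumr_ge0.
rewrite avc_ultra// mul1r; apply: (big_rec (fun x => v x <= b)); first by rewrite av0.
by move=> i x Ai hx; apply: le_trans (ul _ _) _; rewrite ge_max h.
Qed.

Lemma av_sum_ultra_lt v (I : finType) (A : pred I) (f : I -> F) (b : R) :
  av_ultra v -> 0 < b -> (forall i, A i -> v (f i) < b) ->
  v (\sum_(i | A i) f i) < b.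
Proof.
move=> ul b0 h; apply: (big_rec (fun x => v x < b)); first by rewrite av0.
by move=> i x Ai hx; apply: le_lt_trans (ul _ _) _; rewrite gt_max h.
Qed.

Lemma av_ultra_dom v x y : av_ultra v -> v y < v x -> v (x + y) = v x.
Proof.
move=> ul yx; apply/eqP; rewrite eq_le; apply/andP; split.
  by apply: le_trans (ul _ _) _; rewrite ge_max lexx ltW.
have := ul (x + y) (- y); rewrite addrK avN le_max => /orP[//|].
by rewrite leNgt yx.
Qed.

(** Each term of the expansion meets every row and every column once, so the weights factor out.
    Unequal weights matter in [det_low_rank_le]. *)
Lemma det_le v n (A : 'M[F]_n) (r s : 'I_n -> R) :
  (forall i j, v (A i j) <= r i * s j) ->
  v (\det A) <= avc v n`!%:R * ((\prod_i r i) * \prod_j s j).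
Proof.
move=> h; rewrite /determinant.
have e (g : 'S_n) : v ((-1) ^+ g * \prod_i A i (g i)) <= (\prod_i r i) * \prod_j s j.
  rewrite av_mul avX avN av1 expr1n mul1r av_prod.
  rewrite [\prod_j s j](reindex_perm g) -big_split/=.
  by apply: ler_prod => i _; rewrite av_ge0 h.
rewrite -card_Sn; apply: av_sum => [|g _]; last exact: e.
by apply: le_trans (e 1%g); rewrite av_ge0.
Qed.

Lemma det_le_unif v n (A : 'M[F]_n) (b : R) :
  (forall i j, v (A i j) <= b) -> v (\det A) <= avc v n`!%:R * b ^+ n.
Proof.
move=> h; have H : forall i j, v (A i j) <= b * 1 by move=> i j; rewrite mulr1.
have := det_le (r := fun=> b) (s := fun=> 1) H.
by rewrite !prodr_const !card_ord expr1n mulr1.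
Qed.

Lemma pnorm_coef v Q i : v Q`_i <= pnorm v Q.
Proof.
have [iQ|/(nth_default 0)->] := ltnP i (size Q); last first.
  by rewrite av0 /pnorm; elim/big_rec: _ => [|j x _ hx]; rewrite ?lexx// le_max hx orbT.
rewrite /pnorm (bigmaxD1 (Ordinal iQ))//= le_max lexx//.
Qed.

Lemma pnorm_ge0 v Q : 0 <= pnorm v Q.
Proof. by apply: le_trans (pnorm_coef v Q 0); rewrite av_ge0. Qed.

Lemma pnorm_le v Q b : 0 <= b -> (forall i, v Q`_i <= b) -> pnorm v Q <= b.
Proof. by move=> b0 h; apply: bigmax_le => // i _. Qed.

Lemma pnorm_ex v Q : Q != 0 -> exists2 i, (i < size Q)%N & pnorm v Q = v Q`_i.
Proof.
move=> Q0; have s0 : (0 < size Q)%N by rewrite size_poly_gt0.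
have [i _ hi] := @arg_maxP _ _ _ (Ordinal s0) predT (fun i : 'I_(size Q) => v Q`_i) isT.
exists i => //; apply/eqP; rewrite eq_le pnorm_coef andbT.
apply: pnorm_le; rewrite ?av_ge0// => j.
have [jQ|/(nth_default 0)->] := ltnP j (size Q); last by rewrite av0 av_ge0.
exact: (hi (Ordinal jQ)).
Qed.

Lemma pnorm_gt0 v Q : Q != 0 -> 0 < pnorm v Q.
Proof.
move=> Q0; apply: lt_le_trans (pnorm_coef v Q (size Q).-1).
by rewrite av_gt0// -lead_coefE lead_coef_eq0.
Qed.

Lemma pnormZ v a Q : pnorm v (a *: Q) = v a * pnorm v Q.
Proof.
have [->|Q0] := eqVneq Q 0.
  by rewrite scaler0 /pnorm size_poly0 big_ord0 mulr0.
apply/eqP; rewrite eq_le; apply/andP; split.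
  apply: pnorm_le => [|i]; first by rewrite mulr_ge0 ?av_ge0 ?pnorm_ge0.
  by rewrite coefZ av_mul ler_wpM2l ?av_ge0 ?pnorm_coef.
have [i _ ->] := pnorm_ex v Q0.
by rewrite -av_mul -coefZ pnorm_coef.
Qed.

Lemma pnormM v P Q n : (size Q <= n)%N ->
  pnorm v (P * Q) <= avc v n%:R * (pnorm v P * pnorm v Q).
Proof.
move=> sQ; have [->|Q0] := eqVneq Q 0.
  by rewrite mulr0 /pnorm size_poly0 !big_ord0 !mulr0.
have n1 : 1 <= (n%:R : R) by rewrite ler1n (leq_trans _ sQ)// size_poly_gt0.
apply: pnorm_le => [|i].
  by rewrite !mulr_ge0 ?pnorm_ge0// (le_trans ler01)// avc_ge1.
rewrite coefMr.
(* The convolution is reindexed by the coefficients of [Q], so that its length is [n] whatever the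
   index [i]. *)
have -> : \sum_(j < i.+1) P`_(i - j) * Q`_j =
    \sum_(j < n) (if (j <= i)%N then P`_(i - j) * Q`_j else 0).
  pose N := maxn n i.+1; pose f j := P`_(i - j) * Q`_j.
  rewrite (@big_ord_widen_cond _ _ _ i.+1 N predT f) ?leq_maxr//.
  rewrite -big_mkcond (@big_ord_widen_cond _ _ _ n N (fun j => j <= i)%N f) ?leq_maxl//.
  rewrite (bigID (fun j : 'I_N => (j < n)%N))/= [X in _ + X]big1 ?addr0//.
  move=> j /andP[_]; rewrite -leqNgt => nj.
  by rewrite /f [Q`_j]nth_default ?mulr0// (leq_trans sQ).
rewrite -[n in leRHS]card_ord; apply: av_sum => [|j _].
  by rewrite mulr_ge0 ?pnorm_ge0.
case: ifP => _; last by rewrite av0 mulr_ge0 ?pnorm_ge0.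
by rewrite av_mul ler_pM ?av_ge0 ?pnorm_coef.
Qed.

Lemma horner_le v Q x n b : (size Q <= n)%N -> 1 <= b -> v x <= b ->
  v Q.[x] <= avc v n%:R * (pnorm v Q * b ^+ n).
Proof.
move=> sQ b1 xb; rewrite (horner_coef_wide _ sQ) -[n in avc _ n%:R]card_ord.
apply: av_sum => [|i _]; first by rewrite mulr_ge0 ?pnorm_ge0 ?exprn_ge0// (le_trans ler01).
rewrite av_mul ler_pM ?av_ge0 ?pnorm_coef// avX.
apply: (@le_trans _ _ (b ^+ i)); first by rewrite lerXn2r ?nnegrE ?av_ge0 ?(le_trans ler01).
by rewrite ler_weXn2l// ltnW.
Qed.

End AbsvalTheory.

(** * Toeplitz minors and Gelfond's inequality *)

Lemma perm_not1_gt e (g : 'S_e) : g != 1%g -> exists s : 'I_e, (s < g s)%N.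
Proof.
move=> g1; apply/existsP; apply: contraR g1 => /existsPn h.
apply/eqP/permP => s; rewrite perm1; apply: val_inj => /=.
have hle (i : 'I_e) : (g i <= i)%N by rewrite leqNgt h.
have : (\sum_(i < e) (i - g i) = 0)%N.
  rewrite sumnB => [|i _]; last exact: hle.
  by rewrite [X in (X - _)%N](reindex_perm g)/= subnn.
move/eqP; rewrite sum_nat_eq0 => /forallP/(_ s)/=.
by rewrite subn_eq0 => sg; apply/eqP; rewrite eqn_leq hle sg.
Qed.

(** The displacements [g s - s] sum to zero, so the squares of the [a s] exceed their value at the
    identity by the sum of the squared displacements. Quadratic weights therefore single out the
    diagonal of a Toeplitz determinant. *)
Lemma perm_shift_sqr e (g : 'S_e) (r : nat) (a : 'I_e -> nat) :
  g != 1%g -> (forall s, a s + s = r + g s)%N ->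
  (e * r ^ 2 < \sum_(s < e) a s ^ 2)%N.
Proof.
move=> g1 ha; have [s0 hs0] := perm_not1_gt g1.
rewrite -(ltr_nat int) natr_sum natrM.
have E s : ((a s ^ 2)%N%:R : int) =
    (r ^ 2)%N%:R + (2 * r)%N%:R * ((g s)%:R - s%:R) + ((g s)%:R - s%:R) ^+ 2.
  have : ((a s)%:R : int) = r%:R + (g s)%:R - s%:R.
    by apply/eqP; rewrite eq_sym subr_eq -!natrD ha.
  by rewrite natrX => ->; rewrite natrM natrX; ring.
rewrite (eq_bigr _ (fun s _ => E s)) !big_split/= -mulr_sumr sumrB.
rewrite [X in _ * (_ - X)](reindex_perm g)/= subrr mulr0 addr0.
rewrite [X in _ < X + _](_ : _ = e%:R * (r ^ 2)%:R); last first.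
  by rewrite big_const_ord iter_addr_0 mulr_natl.
rewrite ltrDl.
rewrite (bigD1 s0)//= ltr_pwDl//; last by apply: sumr_ge0 => i _; rewrite sqr_ge0.
by rewrite exprn_gt0// subr_gt0 ltr_nat.
Qed.

Section Toeplitz.
Context {R : realType} {F : fieldType}.
Implicit Types (v : absval R F) (L P Q E : {poly F}).

Definition toep (e r : nat) L : 'M[F]_e := \matrix_(i, s) (L * 'X^i)`_(r + s).

Lemma toep_term (e r d : nat) L (g : 'S_e) : (size L <= d)%N ->
  \prod_i toep e r L i (g i) = 0 \/
  exists2 a : 'I_e -> nat, (forall s, a s + s = r + g s)%N &
    (forall s, (a s < d)%N) /\ \prod_i toep e r L i (g i) = \prod_i L`_(a i).
Proof.
move=> sL; pose a (s : 'I_e) := (r + g s - s)%N.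
have E i : toep e r L i (g i) = if (r + g i < i)%N then 0 else L`_(a i).
  by rewrite mxE coefMXn.
have [/existsP[i hi]|/existsPn h] := boolP [exists i : 'I_e, (r + g i < i)%N || (d <= a i)%N].
  left; rewrite (bigD1 i)//= E; case/orP: hi => [->|da]; first by rewrite mul0r.
  by rewrite nth_default ?if_same ?mul0r// (leq_trans sL).
right; exists a => [s|]; last split.
- by rewrite /a subnK// leqNgt; have := h s; rewrite negb_or => /andP[].
- by move=> s; have := h s; rewrite negb_or => /andP[_]; rewrite -ltnNge.
- by apply: eq_bigr => i _; rewrite E; have := h i; rewrite negb_or => /andP[/negbTE->].
Qed.

Lemma toep_diag (e r : nat) L : \prod_i toep e r L i ((1 : 'S_e)%g i) = L`_r ^+ e.
Proof.
rewrite -[in RHS](card_ord e) -prodr_const; apply: eq_bigr => i _.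
by rewrite perm1 mxE coefMXn ltnNge leq_addl/= addnK.
Qed.

(** The outer 2 is lost between the diagonal term and the determinant. Twice the factorial of [e] is
    the base of the quadratic weights in [toep_bound], and [d ^ 2 * e] bounds their total
    exponent. *)
Definition toepB (e d : nat) : R := 2 * (2 * e`!%:R) ^+ (d ^ 2 * e).

Lemma toepB_ge1 e d : 1 <= toepB e d.
Proof.
rewrite /toepB; have : 1 <= (2 * e`!%:R : R) ^+ (d ^ 2 * e).
  by rewrite exprn_ege1// -natrM ler1n muln_gt0 fact_gt0.
lra.
Qed.

(** At an archimedean place take [r] maximizing |L_r| W^(r^2), with W twice the factorial of [e]. By
    [perm_shift_sqr] every other term of the determinant is smaller than the diagonal one by a
    factor W, so together they are at most half of it. At an ultrametric place take the last [r]
    where the norm is attained: any other permutation uses a coefficient beyond [r], and the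
    diagonal term dominates strictly. *)
Lemma toep_bound v (e d : nat) L : L != 0 -> (size L <= d)%N ->
  exists2 r : nat, (r < d)%N &
    pnorm v L ^+ e <= avc v (toepB e d) * v (\det (toep e r L)).
Proof.
move=> L0 sL; have d0 : (0 < d)%N by rewrite (leq_trans _ sL)// size_poly_gt0.
have detE r : \det (toep e r L) = L`_r ^+ e +
    \sum_(g : 'S_e | g != 1%g) (-1) ^+ g * \prod_i toep e r L i (g i).
  by rewrite /determinant (bigD1 (1 : 'S_e)%g)//= odd_perm1 mul1r toep_diag.
have vterm r (g : 'S_e) : v ((-1) ^+ g * \prod_i toep e r L i (g i)) =
    v (\prod_i toep e r L i (g i)).
  by rewrite av_mul avX avN av1 expr1n mul1r.
have [ar|ul] := av_archP v.
  rewrite avc_arch//; set W : R := 2 * e`!%:R.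
  have W1 : 1 <= W by rewrite /W -natrM ler1n muln_gt0 fact_gt0.
  have W0 : 0 < W := lt_le_trans ltr01 W1.
  have [r _ hr] := @arg_maxP _ _ _ (Ordinal d0) predT
    (fun i : 'I_d => v L`_i * W ^+ (i ^ 2)) isT.
  have {}hr i : v L`_i * W ^+ (i ^ 2) <= v L`_r * W ^+ (r ^ 2).
    have [id|di] := ltnP i d; first exact: (hr (Ordinal id)).
    rewrite nth_default ?(leq_trans sL)// av0 mul0r mulr_ge0 ?av_ge0//.
    by rewrite exprn_ge0// ltW.
  exists r => //.
  have b (g : 'S_e) : g != 1%g ->
      v ((-1) ^+ g * \prod_i toep e r L i (g i)) <= v L`_r ^+ e / W.
    move=> g1; rewrite vterm; have [->|[a ha [ad ->]]] := toep_term r g sL.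
      by rewrite av0 divr_ge0 ?exprn_ge0 ?av_ge0// ltW.
    rewrite ler_pdivlMr//.
    have := perm_shift_sqr g1 ha => /(ler_weXn2l W1).
    rewrite exprS mulnC exprM => h.
    have {}h : v (\prod_i L`_(a i)) * (W * (W ^+ (r ^ 2)) ^+ e) <=
        v (\prod_i L`_(a i)) * W ^+ (\sum_s a s ^ 2).
      by rewrite ler_wpM2l ?av_ge0// ltW.
    rewrite -(ler_pM2r (_ : 0 < (W ^+ (r ^ 2)) ^+ e)) ?exprn_gt0//.
    rewrite -mulrA; apply: le_trans h _.
    rewrite av_prod expr_sum -big_split/= -exprMn.
    rewrite -[in leRHS](card_ord e) -prodr_const; apply: ler_prod => i _.
    by rewrite mulr_ge0 ?av_ge0 ?exprn_ge0 ?(ltW W0)// hr.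
  pose S := \sum_(g : 'S_e | g != 1%g) (-1) ^+ g * \prod_i toep e r L i (g i).
  have SE : \det (toep e r L) = L`_r ^+ e + S := detE r.
  have hS : v S <= v L`_r ^+ e / 2.
    have := av_sum (A := fun g : 'S_e => g != 1%g) (b := v L`_r ^+ e / W) _ b.
    rewrite avc_arch// => /(_ _)/le_trans; apply.
      by rewrite divr_ge0 ?exprn_ge0 ?av_ge0// ltW.
    rewrite card_Sn /W le_eqVlt; apply/orP; left; apply/eqP.
    by field; rewrite pnatr_eq0 -lt0n fact_gt0.
  have lr : v L`_r ^+ e <= 2 * v (\det (toep e r L)).
    have := av_add v (\det (toep e r L)) (- S); rewrite SE addrK avN avX.
    by rewrite -SE; lra.
  have pn : pnorm v L <= v L`_r * W ^+ (d ^ 2).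
    apply: pnorm_le => [|i]; first by rewrite mulr_ge0 ?av_ge0 ?exprn_ge0 ?(ltW W0).
    apply: (@le_trans _ _ (v L`_i * W ^+ (i ^ 2))).
      by rewrite ler_peMr ?av_ge0// exprn_ege1.
    apply: le_trans (hr i) _; rewrite ler_wpM2l ?av_ge0// ler_weXn2l//.
    by rewrite leq_exp2r// ltnW.
  apply: le_trans (_ : _ <= (v L`_r * W ^+ (d ^ 2)) ^+ e) _.
    by rewrite lerXn2r ?nnegrE ?pnorm_ge0// mulr_ge0 ?av_ge0 ?exprn_ge0 ?(ltW W0).
  by rewrite exprMn -exprM /toepB -/W [leRHS]mulrAC ler_wpM2r ?exprn_ge0 ?(ltW W0).
have [i0 i0s i0E] := pnorm_ex v L0.
pose p r := (r < d)%N && (v L`_r == pnorm v L).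
have pex : exists r, p r by exists i0; rewrite /p (leq_trans i0s)//= i0E.
have pub r : p r -> (r <= d)%N by move=> /andP[/ltnW].
have [r /andP[rd /eqP rE] rmax] := ex_maxnP pex pub.
exists r => //.
have hlt i : (r < i)%N -> v L`_i < v L`_r.
  move=> ri; rewrite lt_neqAle rE pnorm_coef andbT; apply/eqP => h.
  have [id|di] := ltnP i d.
    by have := rmax i; rewrite /p id h eqxx => /(_ isT); rewrite leqNgt ri.
  by have := pnorm_gt0 v L0; rewrite -h nth_default ?(leq_trans sL)// av0 ltxx.
have vr0 : 0 < v L`_r by rewrite rE pnorm_gt0.
rewrite avc_ultra// mul1r detE av_ultra_dom// ?avX ?rE// -rE.
apply: av_sum_ultra_lt => //; first by rewrite exprn_gt0.
move=> g g1; rewrite vterm; have [->|[a ha [ad ->]]] := toep_term r g sL.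
  by rewrite av0 exprn_gt0.
have [s hs] := perm_not1_gt g1.
have as_r : (r < a s)%N by rewrite -(ltn_add2r s) ha ltn_add2l.
rewrite av_prod -[X in _ < X](_ : \prod_(i < e) v L`_r = _); last first.
  by rewrite prodr_const card_ord.
rewrite (bigD1 s)//= [ltRHS](bigD1 s)//=.
apply: (@le_lt_trans _ _ (v L`_(a s) * \prod_(i < e | i != s) v L`_r)).
  rewrite ler_wpM2l ?av_ge0//; apply: ler_prod => i _.
  by rewrite av_ge0 rE pnorm_coef.
by rewrite ltr_pM2r ?hlt// prodr_gt0.
Qed.

(* If P = E F then the vector F is the solution of a linear system whose matrix
   is a Toeplitz block of E, so Cramer's rule bounds it from toep_bound. *)
Lemma gelfond v P Q (d d' : nat) : P != 0 -> (size P <= d)%N -> (size Q <= d')%N ->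
  pnorm v P * pnorm v Q <= avc v (toepB d' d * (d' * d'.-1`!)%:R) * pnorm v (P * Q).
Proof.
move=> P0 sP sQ; have [r rd hr] := toep_bound v d' P0 sP.
set T := toep d' r P in hr.
have [->|Q0] := eqVneq Q 0.
  by rewrite mulr0 /pnorm size_poly0 !big_ord0 !mulr0.
have d'0 : (0 < d')%N by rewrite (leq_trans _ sQ)// size_poly_gt0.
have np : 0 < pnorm v P := pnorm_gt0 v P0.
have TE : poly_rV Q *m T = \row_(s < d') (P * Q)`_(r + s).
  apply/rowP => s; rewrite !mxE.
  have -> : P * Q = \sum_(i < d') Q`_i *: (P * 'X^i).
    rewrite -[Q in LHS](poly_rV_K sQ) /rVpoly poly_def mulr_sumr.
    by apply: eq_bigr => i _; rewrite -scalerAr valK mxE.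
  by rewrite coef_sum; apply: eq_bigr => i _; rewrite !mxE coefZ.
have adjE : poly_rV Q *m (\det T)%:M = (\row_(s < d') (P * Q)`_(r + s)) *m \adj T.
  by rewrite -TE -mulmxA mul_mx_adj.
have Tle (i j : 'I_d') : v (T i j) <= pnorm v P.
  by rewrite mxE coefMXn; case: ifP; rewrite ?av0 ?pnorm_ge0 ?pnorm_coef.
have adj_le (i j : 'I_d') : v ((\adj T) i j) <= avc v d'.-1`!%:R * pnorm v P ^+ d'.-1.
  rewrite mxE /cofactor av_mul avX avN av1 expr1n mul1r.
  by apply: det_le_unif => k l; have := Tle (lift j k) (lift i l); rewrite !mxE.
have Qle : pnorm v Q * v (\det T) <=
    avc v d'%:R * (pnorm v (P * Q) * (avc v d'.-1`!%:R * pnorm v P ^+ d'.-1)).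
  have [i iQ ->] := pnorm_ex v Q0; pose j := Ordinal (leq_trans iQ sQ).
  have := congr1 (fun M : 'rV_d' => v (M 0 j)) adjE.
  rewrite mul_mx_scalar !mxE /= av_mul mulrC => ->.
  rewrite -[d' in avc v d'%:R]card_ord; apply: av_sum => [|k _].
    by rewrite !mulr_ge0 ?pnorm_ge0 ?exprn_ge0 ?pnorm_ge0// (le_trans ler01)// avc_ge1// ler1n fact_gt0.
  by rewrite av_mul ler_pM ?av_ge0// mxE pnorm_coef.
rewrite -(ler_pM2r (exprn_gt0 d'.-1 np)) mulrAC -exprS prednK//.
apply: le_trans (ler_wpM2r (pnorm_ge0 v Q) hr) _.
rewrite -mulrA [v _ * _]mulrC.
apply: le_trans (ler_wpM2l (le_trans ler01 (avc_ge1 v (toepB_ge1 _ _))) Qle) _.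
by rewrite natrM !avcM le_eqVlt; apply/orP; left; apply/eqP; ring.
Qed.

End Toeplitz.

(** * Local degrees *)

Lemma subACB (V : zmodType) (x y p q : V) : (x - y) - (p - q) = (x - p) - (y - q).
Proof. by rewrite !opprB [LHS]addrACA [RHS]addrACA [- y - p]addrC. Qed.

Lemma mulBB (V : comNzRingType) (x y p q : V) : x * y - p * q = x * (y - q) + (x - p) * q.
Proof. by ring. Qed.

Lemma invB (V : fieldType) (x q : V) : x != 0 -> q != 0 ->
  x^-1 - q^-1 = (q - x) * (x^-1 * q^-1).
Proof. by move=> x0 q0; field; rewrite x0 q0. Qed.

Section ClosedSpan.
Context {R : realType} {F : fieldType} (v : absval R F) (E : set F).
Hypothesis E1 : E 1.
Hypothesis EB : forall x y, E x -> E y -> E (x - y).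
Hypothesis EM : forall x y, E x -> E y -> E (x * y).
Hypothesis EV : forall x, E x -> E x^-1.
Hypothesis Elim : forall x,
  (forall e : R, 0 < e -> exists2 y, E y & v (x - y) < e) -> E x.
Hypothesis Fcomplete : forall u : nat -> F,
  is_cauchy v u -> exists x, is_null v (fun n => u n - x).

(** A finite-dimensional subspace over a closed subfield of a complete field is closed. Induction on
    the number of generators: a dependent last generator is dropped, an independent one has its
    coefficients controlled. *)
Lemma closed_span r (e : nat -> F) x :
  (forall eps : R, 0 < eps -> exists c : nat -> F,
    (forall i, E (c i)) /\ v (x - \sum_(i < r) c i * e i) < eps) ->
  exists c : nat -> F, (forall i, E (c i)) /\ x = \sum_(i < r) c i * e i.
Proof.
have E0 : E 0 by rewrite -(subrr 1); exact: EB.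
have EN y : E y -> E (- y) by move=> Ey; rewrite -sub0r; exact: EB.
have ED y z : E y -> E z -> E (y + z).
  by move=> Ey Ez; rewrite -[z]opprK; apply: EB => //; exact: EN.
elim: r x => [|r IH] x h.
  exists (fun=> 0); split=> //; rewrite big_ord0.
  apply: contrapT => /eqP x0; have [c [_]] := h _ (av_gt0 (v) x0).
  by rewrite big_ord0 subr0 ltxx.
have [[d [dE de]]|nspan] := pselect (exists c : nat -> F,
    (forall i, E (c i)) /\ e r = \sum_(i < r) c i * e i).
  have [eps e0|c [cE cx]] := IH x.
    have [c [cE cx]] := h eps e0; exists (fun i => c i + c r * d i); split=> [i|].
      by apply: ED => //; exact: EM.
    rewrite (_ : \sum_(i < r) _ = \sum_(i < r.+1) c i * e i)//.
    rewrite big_ord_recr/= de mulr_sumr -big_split/=.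
    by apply: eq_bigr => i _; rewrite mulrDl mulrA.
  exists (fun i => if (i < r)%N then c i else 0); split=> [i|]; first by case: ifP.
  rewrite big_ord_recr/= ltnn mul0r addr0 cx.
  by apply: eq_bigr => i _; rewrite ltn_ord.
(* The span of the earlier generators is closed by induction, so [e r] lies at positive distance
   from it. Hence the last coefficients of good approximations form a Cauchy sequence. *)
have [eps e0 heps] : exists2 eps : R, 0 < eps & forall c : nat -> F, (forall i, E (c i)) ->
    eps <= v (e r - \sum_(i < r) c i * e i).
  apply: contrapT => hn; apply: nspan; apply: IH => eps e0.
  apply: contrapT => hc; apply: hn; exists eps => // c cE.
  by rewrite leNgt; apply/negP => hlt; apply: hc; exists c.
have /choice[c hc] (k : nat) : exists c : nat -> F, (forall i, E (c i)) /\
   v (x - \sum_(i < r.+1) c i * e i) < k.+1%:R^-1.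
  by apply: h; rewrite invr_gt0.
have small (a : R) : 0 < a -> exists N, forall n, (N <= n)%N -> n.+1%:R^-1 < a.
  move=> a0; have [N _ hN] := near_infty_natSinv_lt (PosNum a0).
  by exists N => n Nn; exact: hN.
have key (d : nat -> F) : (forall i, E (d i)) ->
    v (d r) * eps <= v (\sum_(i < r.+1) d i * e i).
  move=> dE; have [->|d0] := eqVneq (d r) 0; first by rewrite av0 mul0r av_ge0.
  have := heps (fun i => - (d i / d r)) (fun i => EN _ (EM (dE i) (EV (dE r)))).
  move=> /(ler_wpM2l (av_ge0 (v) (d r)))/le_trans; apply.
  rewrite -av_mul mulrBr mulr_sumr big_ord_recr/= addrC -sumrN.
  rewrite le_eqVlt; apply/orP; left; apply/eqP; congr (v (_ + _)).
  by apply: eq_bigr => i _; field.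
have [d dlim] : exists d, is_null (v) (fun n => c n r - d).
  apply: Fcomplete => a a0.
  have [N hN] := small (a * eps / 2) ltac:(by rewrite divr_gt0// mulr_gt0).
  exists N => m n Nm Nn.
  have := key (fun i => c m i - c n i) (fun i => EB ((hc m).1 i) ((hc n).1 i)).
  rewrite (_ : \sum_(i < _) _ = (x - \sum_(i < r.+1) c n i * e i) -
    (x - \sum_(i < r.+1) c m i * e i)); last first.
    rewrite opprB [RHS]addrC [RHS]addrA subrK -sumrB.
    by apply: eq_bigr => i _; rewrite mulrBl.
  move=> /le_trans/(_ (avB _ _ _)).
  have := lt_trans (hc m).2 (hN m Nm); have := lt_trans (hc n).2 (hN n Nn).
  move=> h1 h2 h3; rewrite -(ltr_pM2r e0); lra.
have dE : E d.
  apply: Elim => a a0; have [N hN] := dlim a a0.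
  by exists (c N r); [exact: (hc N).1|rewrite av_distC; exact: hN].
have [a a0|c' [cE' cx']] := IH (x - d * e r).
  have [M hM] := small (a / 2) ltac:(lra).
  have er0 : 0 < v (e r) + 1 by rewrite ltr_wpDl ?av_ge0.
  have [N hN] := dlim (a / 2 / (v (e r) + 1)) ltac:(by rewrite !divr_gt0).
  pose n := maxn M N; exists (c n); split; first exact: (hc n).1.
  have h1 := lt_trans (hc n).2 (hM n (leq_maxl _ _)).
  have h2 := hN n (leq_maxr _ _).
  rewrite (_ : _ - _ = (x - \sum_(i < r.+1) c n i * e i) + (c n r - d) * e r); last first.
    by rewrite big_ord_recr/=; ring.
  apply: le_lt_trans (av_add _ _ _) _; rewrite av_mul.
  have : v (c n r - d) * v (e r) <= a / 2.
    apply: (@le_trans _ _ (v (c n r - d) * (v (e r) + 1))).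
      by rewrite ler_wpM2l ?av_ge0// lerDl.
    by rewrite -ler_pdivlMr// ltW.
  lra.
exists (fun i => if (i < r)%N then c' i else d); split=> [i|]; first by case: ifP.
rewrite big_ord_recr/= ltnn.
rewrite (eq_bigr (fun i : 'I_r => c' i * e i)); last by move=> i _; rewrite ltn_ord.
by rewrite -cx' subrK.
Qed.

End ClosedSpan.

Section DegreeOver.
Context {F : fieldType} (E : set F).
Hypothesis E1 : E 1.
Hypothesis EB : forall x y, E x -> E y -> E (x - y).
Hypothesis EM : forall x y, E x -> E y -> E (x * y).
Hypothesis EV : forall x, E x -> E x^-1.

Let S : {pred F} := [pred x | `[< E x >]].

Lemma set_divring_closed : divring_closed S.
Proof.
split.
- exact/asboolP.
- by move=> x y /asboolP hx /asboolP hy; apply/asboolP/EB.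
- by move=> x y /asboolP hx /asboolP hy; apply/asboolP/EM/EV.
Qed.

HB.instance Definition _ := GRing.isDivringClosed.Build F S set_divring_closed.

(** Packaging [E] as a field type gives access to matrices over it, whose kernels bound the degree
    below. *)
Record subf := SubF { subf_val :> F; subfP : subf_val \in S }.

HB.instance Definition _ := [isSub for subf_val].
HB.instance Definition _ := [Choice of subf by <:].
HB.instance Definition _ := [SubChoice_isSubIntegralDomain of subf by <:].
HB.instance Definition _ := [SubIntegralDomain_isSubField of subf by <:].

Lemma subf_E (x : subf) : E x.
Proof. by have /asboolP := subfP x. Qed.

Context (d : nat) (f : nat -> F).
Hypothesis hf : forall x,
  exists c : nat -> F, (forall i, E (c i)) /\ x = \sum_(i < d) c i * f i.

(** The default 0 of [degree_over] is excluded by producing a basis, namely a generating family of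
    least length. A basis of more than [d] elements, written through the [d] generators [f], has a
    matrix with nonzero left kernel, against the uniqueness of the expansion of 0. *)
Lemma degree_overP : (0 < degree_over E <= d)%N.
Proof.

pose gen r := `[< exists e : nat -> F, forall x,
  exists c : nat -> F, (forall i, E (c i)) /\ x = \sum_(i < r) c i * e i >].
have gex : exists r, gen r by exists d; apply/asboolP; exists f.
have [r /asboolP[e he] rmin] := ex_minnP gex.
have E0 : E 0 by rewrite -(subrr 1); exact: EB.
have indep (c : nat -> F) : (forall i, E (c i)) -> \sum_(i < r) c i * e i = 0 ->
    forall i, (i < r)%N -> c i = 0.
  move=> cE c0 k kr; apply: contrapT => /eqP ck0.
  have r0 : (0 < r)%N by rewrite (leq_trans _ kr).
  have : gen r.-1; last by move/rmin; rewrite -ltnS prednK// ltnn.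
  apply/asboolP; pose k' := Ordinal kr.
  have [r' rE] : exists r', r = r'.+1 by exists r.-1; rewrite prednK.
  exists (fun i => e (bump k i)) => x; have [a [aE ->]] := he x.
  exists (fun i => a (bump k i) - a k * (c (bump k i) / c k)); split.
    by move=> i; apply: EB => //; apply: EM => //; apply: EM => //; exact: EV.
  move: (kr) c0; rewrite rE /= => kr' c0.
  have sp (h : nat -> F) : \sum_(i < r'.+1) h i = h k + \sum_(i < r') h (bump k i).
    by rewrite (bigD1_ord (Ordinal kr')).
  rewrite (sp (fun i => c i * e i)) in c0; rewrite (sp (fun i => a i * e i)).
  have -> : e k = - \sum_(i < r') c (bump k i) / c k * e (bump k i).
    apply: (mulfI ck0); rewrite mulrN mulr_sumr; apply/eqP; rewrite -addr_eq0 -[X in _ == X]c0.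
    by apply/eqP; congr (_ + _); apply: eq_bigr => i _; field.
  rewrite mulrN mulr_sumr addrC -sumrB; apply: eq_bigr => i _; ring.
have hset : [set n | exists b : 'I_n -> F, is_basis_over E b] r.
  exists (fun i => e i) => x; have [c [cE cx]] := he x.
  exists [ffun i : 'I_r => c i]; split.
    split=> [i|]; first by rewrite ffunE.
    by rewrite cx; apply: eq_bigr => i _; rewrite ffunE.
  move=> c' [c'E c'x]; apply/ffunP => i; rewrite ffunE; apply/eqP; rewrite -subr_eq0; apply/eqP.
  pose cc j := c j - (if insub j is Some k then c' k else 0).
  have := indep cc _ _ i (ltn_ord i); rewrite /cc valK; apply=> [j|].
    by apply: EB => //; case: insub.
  transitivity (x - x); last exact: subrr.
  rewrite [X in _ = X - _]cx c'x -sumrB.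
  by apply: eq_bigr => j _; rewrite valK mulrBl.
have [b hb] : exists b : 'I_(degree_over E) -> F, is_basis_over E b.
  exact: (xgetPex 0%N (ex_intro _ r hset)).
set n := degree_over E in b hb *; apply/andP; split.
  rewrite lt0n; apply/eqP => n0; have [c [[_ c1] _]] := hb 1.
  move/eqP: c1; rewrite big1 ?oner_eq0// => i _; exfalso.
  by have := ltn_ord i; rewrite [X in (_ < X)%N]n0.
rewrite leqNgt; apply/negP => dn.
have /choice[a ha] (i : 'I_n) : exists c : nat -> F, (forall j, E (c j)) /\
  b i = \sum_(j < d) c j * f j by exact: hf.
pose A : 'M[subf]_(n, d) :=
  \matrix_(i, j) SubF (introT (asboolP _) ((ha i).1 j) : a i j \in S).
have kn0 : kermx A != 0.
  rewrite kermx_eq0 /row_free; apply/eqP => rk.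
  by have := rank_leq_col A; rewrite rk leqNgt dn.
have [i ri0] : exists i, row i (kermx A) != 0.
  apply/existsP; apply: contraR kn0 => /existsPn h.
  by apply/eqP/row_matrixP => i; rewrite row0; apply/eqP; have := h i; rewrite negbK.
set u := row i (kermx A) in ri0.
have uA : u *m A = 0 by rewrite /u -row_mul mulmx_ker row0.
have [c [_ cu]] := hb 0.
have h0 : [ffun=> 0] = [ffun j => subf_val (u 0 j)] :> {ffun 'I_n -> F}.
  rewrite -(cu [ffun=> 0]); last first.
    by split=> [j|]; rewrite ?ffunE// big1// => j _; rewrite ffunE mul0r.
  apply: cu; split=> [j|]; first by rewrite ffunE; exact: subf_E.
  under eq_bigr => j _ do rewrite ffunE (ha j).2 mulr_sumr.
  rewrite exchange_big/= big1// => k _.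
  have := congr1 (fun M : 'rV[subf]_(d) => subf_val (M 0 k)) uA.
  rewrite !mxE -[subf_val (\sum_(_ | _) _)]/(val _) rmorph_sum/= => h.
  rewrite -[RHS](mul0r (f k)) -[X in _ = X * _]h mulr_suml.
  by apply: eq_bigr => j _; rewrite !mxE /= mulrA.
case/eqP: ri0; apply/rowP => j; rewrite [in RHS]mxE; apply: val_inj => /=.
by have := congr1 (fun g : {ffun _} => g j) h0; rewrite !ffunE => <-.
Qed.

End DegreeOver.

Section LocalDegree.
Context {R : realType} {K : fieldExtType rat} (v : absval R K).
Local Notation L := (completion v).
Local Notation E := (closure_rat v).

(** The completion carries no numeric structure, so the rules for [ratr] in it are drawn from this
    identification with the scalars of [K]. *)
Lemma emb_rat (q : rat) : emb v q%:A = ratr q.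
Proof. exact: (fmorph_eq_rat (emb v \o in_alg K : {rmorphism rat -> L})). Qed.

Lemma closure_rat_lim (x : L) :
  (forall e : R, 0 < e -> exists2 y, E y & cabs v (x - y) < e) -> E x.
Proof.
move=> h e e0; have [y yE xy] := h (e / 2) ltac:(lra).
have [q yq] := yE (e / 2) ltac:(lra); exists q.
by have := av_add (cabs v) (x - y) (y - ratr q); rewrite addrA subrK; lra.
Qed.

Lemma ratr_closure q : E (ratr q).
Proof. by move=> e e0; exists q; rewrite subrr av0. Qed.

Lemma ratrB_L (p q : rat) : ratr (p - q) = ratr p - ratr q :> L.
Proof. by rewrite -!emb_rat scalerBl rmorphB. Qed.

Lemma ratrM_L (p q : rat) : ratr (p * q) = ratr p * ratr q :> L.
Proof. by rewrite -!emb_rat -rmorphM -scalerAl mul1r scalerA. Qed.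

Lemma ratrV_L (q : rat) : ratr q^-1 = (ratr q)^-1 :> L.
Proof. by rewrite -!emb_rat -fmorphV -[in RHS](fmorphV (in_alg K)). Qed.

Lemma closure_ratB x y : E x -> E y -> E (x - y).
Proof.
move=> hx hy e e0; have [p xp] := hx (e / 2) ltac:(lra).
have [q yq] := hy (e / 2) ltac:(lra); exists (p - q).
rewrite ratrB_L subACB.
by apply: le_lt_trans (avB _ _ _) _; lra.
Qed.

Lemma closure_ratM x y : E x -> E y -> E (x * y).
Proof.
move=> hx hy e e0; pose A := cabs v x + 1; pose B := cabs v y + 1.
have A0 : 0 < A by rewrite ltr_wpDl ?av_ge0.
have B0 : 0 < B by rewrite ltr_wpDl ?av_ge0.
have [q yq] := hy (Num.min 1 (e / 2 / A)) ltac:(by rewrite lt_min ltr01 !divr_gt0).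
have [p xp] := hx (e / 2 / (B + 1)) ltac:(rewrite !divr_gt0//; lra).
exists (p * q); rewrite ratrM_L.
rewrite mulBB.
apply: le_lt_trans (av_add _ _ _) _.
rewrite (av_mul _ x) (av_mul _ (x - _)).
move: yq; rewrite lt_min => /andP[yq1 yq2].
have h1 : cabs v x * cabs v (y - ratr q) <= e / 2.
  apply: (@le_trans _ _ (A * (e / 2 / A))); last by rewrite mulrC divfK// gt_eqF.
  by rewrite ler_pM ?av_ge0 ?(ltW yq2)// /A; lra.
have qB : cabs v (ratr q) <= B + 1.
  by have := av_dist (cabs v) (ratr q) y; rewrite av_distC ler_norml => /andP[_]; rewrite /B; lra.
have h2 : cabs v (x - ratr p) * cabs v (ratr q) < e / 2.
  apply: (@le_lt_trans _ _ (cabs v (x - ratr p) * (B + 1))); first by rewrite ler_wpM2l ?av_ge0.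
  by rewrite -ltr_pdivlMr//; lra.
by rewrite [ltRHS]splitr ler_ltD.
Qed.

Lemma closure_ratV x : E x -> E x^-1.
Proof.
have [->|x0] := eqVneq x 0; first by rewrite invr0.
have vx := av_gt0 (cabs v) x0.
move=> hx e e0.
have [q] := hx (Num.min (cabs v x / 2) (e * (cabs v x * cabs v x / 2)))
  ltac:(by rewrite lt_min !(divr_gt0, mulr_gt0)).
rewrite lt_min => /andP[h1 h2]; exists q^-1; rewrite ratrV_L.
have hq : cabs v x / 2 <= cabs v (ratr q).
  by have := av_dist (cabs v) x (ratr q); rewrite ler_norml => /andP[_]; lra.
have q0 : ratr q != 0 :> L.
  by apply/eqP => q0; move: hq; rewrite q0 av0; lra.
rewrite invB// (av_mul _ (_ - _)) (av_mul _ x^-1) (avV _ x) (avV _ (ratr q)) av_distC -invfM.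
have vq := av_gt0 (cabs v) q0.
rewrite -ltr_pdivlMr ?invr_gt0 ?mulr_gt0// invrK; apply: lt_le_trans h2 _.
by rewrite ler_wpM2l ?(ltW e0)// -mulrA ler_wpM2l// ltW.
Qed.

Lemma closure_rat1 : E 1.
Proof. by have := ratr_closure 1; rewrite -emb_rat scale1r rmorph1. Qed.

Lemma span_closed r (e : nat -> L) x :
  (forall eps : R, 0 < eps -> exists c : nat -> L,
    (forall i, E (c i)) /\ cabs v (x - \sum_(i < r) c i * e i) < eps) ->
  exists c : nat -> L, (forall i, E (c i)) /\ x = \sum_(i < r) c i * e i.
Proof.
apply: (closed_span (v := cabs v) closure_rat1 closure_ratB closure_ratM closure_ratV).
- exact: closure_rat_lim.
- by move=> u /completion_complete.
Qed.

(** [K] is dense and lies in the span of its own basis, which is closed by [span_closed]; so that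
    span is everything. *)
Lemma completion_span : exists e : nat -> L, forall x,
  exists c : nat -> L, (forall i, E (c i)) /\ x = \sum_(i < \dim {:K}) c i * e i.
Proof.
pose b := vbasis {:K}; exists (fun i => emb v b`_i) => x.
apply: (@span_closed _ (fun i => emb v b`_i) x) => eps e0; have [y xy] := emb_dense x e0.
exists (fun i => if (insub i : option 'I_(\dim {:K})) is Some j then ratr (coord b j y) else 0); split.
  move=> i; case: insub => [j|]; first exact: ratr_closure.
  by rewrite -(subrr 1); apply: closure_ratB; exact: closure_rat1.
rewrite (_ : \sum_(i < _) _ = emb v y)// [in RHS](coord_vbasis (memvf y)) rmorph_sum/=.
apply: eq_bigr => i _; rewrite valK -emb_rat -rmorphM; congr (emb v _).
by rewrite -scalerAl mul1r.
Qed.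

(** The upper bound puts the normalizing exponent d_v/d into (0,1], where raising to a power
    preserves the triangle inequality. *)
Lemma local_degreeP : (0 < local_degree v <= \dim {:K})%N.
Proof.
have [e he] := completion_span.
exact: (degree_overP closure_rat1 closure_ratB closure_ratM closure_ratV he).
Qed.

End LocalDegree.

(** * Normalization of absolute values *)

Section Power.
Context {R : realType}.

Lemma powRD_le (s x y : R) : 0 < s <= 1 -> 0 <= x -> 0 <= y ->
  (x + y) `^ s <= x `^ s + y `^ s.
Proof.
move=> /andP[s0 s1] x0 y0.
have [xy0|xy0] := leP (x + y) 0.
  have -> : x + y = 0 by apply/eqP; rewrite eq_le xy0 addr_ge0.
  by rewrite powR0 ?gt_eqF// addr_ge0 ?powR_ge0.
have key z : 0 <= z <= x + y -> z / (x + y) <= (z / (x + y)) `^ s.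
  move=> /andP[z0 zxy]; move: z0; rewrite le_eqVlt => /orP[/eqP<-|z0].
    by rewrite mul0r powR_ge0.
  have h : 0 < z / (x + y) <= 1 by rewrite divr_gt0//= ler_pdivrMr// mul1r.
  by have := ger_powR h s1; rewrite powRr1// ltW// divr_gt0.
have kx := key x; have ky := key y.
have E z : 0 <= z -> z `^ s = (z / (x + y)) `^ s * (x + y) `^ s.
  by move=> z0; rewrite -powRM ?divfK ?gt_eqF// ?divr_ge0 ?(ltW xy0).
rewrite (E x x0) (E y y0) -mulrDl -[leLHS]mul1r ler_wpM2r ?powR_ge0//.
rewrite (_ : 1 = x / (x + y) + y / (x + y)); last by rewrite -mulrDl divff// gt_eqF.
by rewrite lerD// ?kx ?ky//; apply/andP; split; rewrite // ?lerDl ?lerDr.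
Qed.

Lemma av_pow_ex (F : fieldType) (v : absval R F) (s : R) : 0 < s <= 1 ->
  exists v' : absval R F, forall x, v' x = v x `^ s.
Proof.
move=> hs; have /andP[s0 s1] := hs.
have h0 x : 0 <= v x `^ s by exact: powR_ge0.
have h1 x : v x `^ s = 0 <-> x = 0.
  by split=> [/powR_eq0_eq0/av_eq0//|->]; rewrite av0 powR0// gt_eqF.
have h2 x y : v (x * y) `^ s = v x `^ s * v y `^ s by rewrite av_mul powRM ?av_ge0.
have h3 x y : v (x + y) `^ s <= v x `^ s + v y `^ s.
  apply: le_trans (powRD_le hs (av_ge0 _ _) (av_ge0 _ _)).
  by rewrite ge0_ler_powR ?nnegrE ?av_ge0 ?addr_ge0 ?av_ge0 ?av_add// ltW.
by exists (AbsVal h0 h1 h2 h3).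
Qed.

Lemma powR_gt1 (a r : R) : 1 < a -> 0 < r -> 1 < a `^ r.
Proof.
move=> a1 r0; have -> : 1 = (1 : R) `^ r by rewrite powR1.
by rewrite gt0_ltr_powR ?nnegrE ?(le_trans _ (ltW a1)). Qed.

End Power.

(** * Completions of an absolute value and of its powers *)

Section Transport.
Context {R : realType} {K : fieldExtType rat} (v v' : absval R K) (s : R).
Hypothesis s0 : 0 < s.
Hypothesis vE : forall x, v' x = v x `^ s.

Lemma pow_lt (x : K) (e : R) : 0 < e -> (v' x < e `^ s) = (v x < e).
Proof.
move=> e0; rewrite vE; apply/idP/idP => [|h]; last first.
  by rewrite gt0_ltr_powR ?nnegrE ?av_ge0 ?(ltW e0).
by apply: contraLR; rewrite -!leNgt => h; rewrite ge0_ler_powR ?nnegrE ?av_ge0 ?(ltW e0)// ltW.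
Qed.

Lemma pow_surj (e : R) : 0 < e -> exists2 d : R, 0 < d & e = d `^ s.
Proof.
move=> e0; exists (e `^ s^-1); first by rewrite powR_gt0.
by rewrite -powRrM mulVf ?gt_eqF// powRr1// ltW.
Qed.

Lemma cauchy_pow u : is_cauchy v u <-> is_cauchy v' u.
Proof.
split=> h e e0.
  have [d d0 ->] := pow_surj e0; have [N hN] := h d d0.
  by exists N => m n Nm Nn; rewrite pow_lt// hN.
have es : 0 < e `^ s by rewrite powR_gt0.
by have [N hN] := h _ es; exists N => m n Nm Nn; rewrite -pow_lt// hN.
Qed.

Lemma null_pow u : is_null v u <-> is_null v' u.
Proof.
split=> h e e0.
  have [d d0 ->] := pow_surj e0; have [N hN] := h d d0.
  by exists N => n Nn; rewrite pow_lt// hN.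
have es : 0 < e `^ s by rewrite powR_gt0.
by have [N hN] := h _ es; exists N => n Nn; rewrite -pow_lt// hN.
Qed.

Definition cs_pow (u : cauchy_seq v) : cauchy_seq v' :=
  CauchySeq (introT (asboolP _) ((cauchy_pow u).1 (cs_cauchy u)) : (u : nat -> K) \in cauchy_pred v').

Definition cs_pow' (u : cauchy_seq v') : cauchy_seq v :=
  CauchySeq (introT (asboolP _) ((cauchy_pow u).2 (cs_cauchy u)) : (u : nat -> K) \in cauchy_pred v).

Definition compl_pow (x : completion v) : completion v' := cls (cs_pow (cauchy_repr x)).

Lemma compl_pow_cls (u : cauchy_seq v) : compl_pow (cls u) = cls (cs_pow u).
Proof.
apply/cls_eq/null_pow; have /cls_eq : cls (cauchy_repr (cls u)) = cls u by exact: cauchy_reprK.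
by [].
Qed.

Lemma compl_powB x y : compl_pow (x - y) = compl_pow x - compl_pow y.
Proof.
rewrite -(cauchy_reprK x) -(cauchy_reprK y) -rmorphB !compl_pow_cls -rmorphB.
by congr cls; exact: val_inj.
Qed.

Lemma compl_powM x y : compl_pow (x * y) = compl_pow x * compl_pow y.
Proof.
rewrite -(cauchy_reprK x) -(cauchy_reprK y) -rmorphM !compl_pow_cls -rmorphM.
by congr cls; exact: val_inj.
Qed.

Lemma compl_pow_emb x : compl_pow (emb v x) = emb v' x.
Proof. by rewrite /emb compl_pow_cls; congr cls; exact: val_inj. Qed.

Lemma compl_pow_surj y : exists x, compl_pow x = y.
Proof.
exists (cls (cs_pow' (cauchy_repr y))); rewrite compl_pow_cls -[RHS]cauchy_reprK.
by congr cls; exact: val_inj.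
Qed.

Lemma compl_pow1 : compl_pow 1 = 1.
Proof. by rewrite -(rmorph1 (emb v)) compl_pow_emb rmorph1. Qed.

HB.instance Definition _ := GRing.isZmodMorphism.Build _ _ compl_pow compl_powB.
HB.instance Definition _ := GRing.isMonoidMorphism.Build _ _ compl_pow (conj compl_pow1 compl_powM).

Lemma cabs_lt_near (w : absval R K) (u : cauchy_seq w) (e : R) : cabs w (cls u) < e ->
  exists N, forall n, (N <= n)%N -> w (u n) < e.
Proof.
move=> h; have [N _ hN] := cvgr_lt _ (completion_abs_cls (u := u)) _ h.
by exists N.
Qed.

Lemma cabs_powl x e : 0 < e -> cabs v x < e -> cabs v' (compl_pow x) <= e `^ s.
Proof.
move=> e0; rewrite -(cauchy_reprK x) compl_pow_cls => /cabs_lt_near[N hN].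
by apply: (@cabs_le _ _ _ _ _ N) => n Nn; rewrite ltW// pow_lt// hN.
Qed.

Lemma cabs_powr x e : 0 < e -> cabs v' (compl_pow x) < e `^ s -> cabs v x <= e.
Proof.
move=> e0; rewrite -(cauchy_reprK x) compl_pow_cls => /cabs_lt_near[N hN].
by apply: (@cabs_le _ _ _ _ _ N) => n Nn; rewrite ltW// -pow_lt// hN.
Qed.

Lemma compl_pow_ratr q : compl_pow (ratr q) = ratr q.
Proof. by rewrite -!emb_rat compl_pow_emb. Qed.

Lemma closure_pow x : closure_rat v x <-> closure_rat v' (compl_pow x).
Proof.
have half (d : R) : 0 < d -> d / 2 < d by move=> d0; lra.
split=> h e e0.
  have [d d0 ->] := pow_surj e0; have d2 : 0 < d / 2 by rewrite divr_gt0.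
  have [q xq] := h _ d2; exists q.
  rewrite -compl_pow_ratr -rmorphB; apply: le_lt_trans (cabs_powl d2 xq) _.
  by rewrite gt0_ltr_powR ?nnegrE ?(ltW d0) ?(ltW d2)// half.
have d2 : 0 < e / 2 by rewrite divr_gt0.
have es : 0 < (e / 2) `^ s by rewrite powR_gt0.
have [q xq] := h _ es; exists q; apply: le_lt_trans (half _ e0).
by apply: cabs_powr => //; move: xq; rewrite -compl_pow_ratr -rmorphB.
Qed.

Lemma basis_pow n : (exists b : 'I_n -> completion v, is_basis_over (closure_rat v) b) <->
  (exists b : 'I_n -> completion v', is_basis_over (closure_rat v') b).
Proof.
have inj : injective compl_pow by exact: fmorph_inj.
split=> -[b hb].
  exists (compl_pow \o b) => y; have [x <-] := compl_pow_surj y.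
  have [c [[cE cx] cu]] := hb x; exists [ffun i => compl_pow (c i)]; split.
    split=> [i|]; first by rewrite ffunE; exact/closure_pow.
    by rewrite cx rmorph_sum/=; apply: eq_bigr => i _; rewrite ffunE -rmorphM.
  move=> c' [c'E c'x].
  have /choice[a ha] i : exists z, compl_pow z = c' i := compl_pow_surj (c' i).
  rewrite (cu [ffun i => a i]); first by apply/ffunP => i; rewrite !ffunE ha.
  split=> [i|]; first by rewrite ffunE; apply/closure_pow; rewrite ha.
  apply: inj; rewrite c'x rmorph_sum/=; apply: eq_bigr => i _.
  by rewrite ffunE compl_powM ha.
have /choice[g hg] i : exists z, compl_pow z = b i := compl_pow_surj (b i).
exists g => x; have [c [[cE cx] cu]] := hb (compl_pow x).
have /choice[a ha] i : exists z, compl_pow z = c i := compl_pow_surj (c i).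
exists [ffun i => a i]; split.
  split=> [i|]; first by rewrite ffunE; apply/closure_pow; rewrite ha.
  apply: inj; rewrite cx rmorph_sum/=; apply: eq_bigr => i _.
  by rewrite ffunE compl_powM ha hg.
move=> c' [c'E c'x]; have E := cu [ffun i => compl_pow (c' i)] _.
apply/ffunP => i; rewrite ffunE; apply: inj; rewrite ha E; first by rewrite ffunE.
split=> [j|]; first by rewrite ffunE; exact/closure_pow.
by rewrite c'x rmorph_sum/=; apply: eq_bigr => j _; rewrite ffunE compl_powM hg.
Qed.

(** The normalization of a power of [v] refers to the local degree of that power. Its invariance
    breaks the circle: the exponent can be computed from [v] itself. *)
Lemma local_degree_pow : local_degree v = local_degree v'.
Proof.
rewrite /local_degree /degree_over; congr (xget _ _).
by apply/seteqP; split=> n; exact: (basis_pow n).1 || exact: (basis_pow n).2.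
Qed.

End Transport.

Section MakePlace.
Context {R : realType} {K : fieldExtType rat}.
Implicit Types v : absval R K.

Lemma local_ratioP v : 0 < local_ratio v <= 1.
Proof.
have /andP[n0 nd] := local_degreeP v; rewrite /local_ratio.
have d0 : (0 < \dim {:K})%N := leq_trans n0 nd.
by rewrite divr_gt0 ?ltr0n//= ler_pdivrMr ?ltr0n// mul1r ler_nat.
Qed.

Lemma ultra_nat v (k : nat) : av_ultra v -> v k%:R <= 1.
Proof.
move=> ul; elim: k => [|k IH]; first by rewrite av0.
by rewrite -natr1; apply: le_trans (ul _ _) _; rewrite av1 ge_max IH lexx.
Qed.

(** Bezout. Normalization is a condition at every prime of value less than 1, and this leaves only
    one such prime to check in [ultra_place]. *)
Lemma ultra_coprime v (p q : nat) : av_ultra v -> (0 < p)%N -> coprime p q ->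
  v p%:R < 1 -> v q%:R < 1 -> False.
Proof.
move=> ul p0 cpq vp vq; have [a b e _] := egcdnP q p0.
have : v 1 < 1; last by rewrite av1 ltxx.
rewrite (_ : 1 = a%:R * p%:R - b%:R * q%:R); last first.
  by rewrite -!natrM e (eqP cpq) natrD addrAC subrr add0r.
apply: le_lt_trans (ul _ _) _; rewrite avN gt_max !av_mul.
have hm k x : v x < 1 -> v k%:R * v x < 1.
  by move=> vx; apply: le_lt_trans vx; rewrite ler_piMl ?av_ge0 ?ultra_nat.
by rewrite !hm.
Qed.

Lemma ultra_place v (p : nat) : av_ultra v -> prime p -> v p%:R = p%:R^-1 ->
  exists2 u : place R K, av_ultra u & forall x, u x = v x `^ local_ratio v.
Proof.
move=> ul pp vp; have hr := local_ratioP v; have /andP[r0 r1] := hr.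
have [u uE] := av_pow_ex v hr.
have p1 : 1 < (p%:R : R) by rewrite ltr1n prime_gt1.
have p0 : 0 < (p%:R : R) by rewrite ltr0n prime_gt0.
have ratio_u : local_ratio u = local_ratio v.
  by rewrite /local_ratio (local_degree_pow r0 uE).
have uul : av_ultra u.
  move=> x y; rewrite !uE; apply: le_trans (_ : _ <= (Num.max (v x) (v y)) `^ local_ratio v) _.
    by apply: ge0_ler_powR; rewrite ?nnegrE ?av_ge0 ?le_max ?av_ge0 -?le_max ?ul ?(ltW r0).
  by case: (leP (v x) (v y)) => _; rewrite le_max lexx ?orbT.
have up : u p%:R = p%:R `^ (- local_ratio v).
  by rewrite uE vp -powR_inv1 ?(ltW p0)// -powRrM mulN1r.
have up1 : u p%:R < 1.
  by rewrite up powRN invf_lt1 ?powR_gt0// powR_gt1//.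
have nt : av_nontrivial u.
  exists p%:R; split; last by rewrite lt_eqF.
  by apply/eqP => h; move: vp; rewrite h av0 => /eqP; rewrite eq_sym invr_eq0 gt_eqF.
have nm : av_normalized u.
  split=> [q pq uq|/(_ uul)//]; rewrite ratio_u.
  have [->//|pq'] := eqVneq q p.
  exfalso; apply: (ultra_coprime uul (prime_gt0 pp) _ up1 uq).
  by rewrite prime_coprime// dvdn_prime2// eq_sym.
by exists (Place nt nm).
Qed.

Lemma arch_place v : (forall q : rat, v (ratr q) = `|ratr q|) ->
  exists u : place R K, forall x, u x = v x `^ local_ratio v.
Proof.
move=> vQ; have hr := local_ratioP v; have /andP[r0 r1] := hr.
have [u uE] := av_pow_ex v hr.
have ratio_u : local_ratio u = local_ratio v.
  by rewrite /local_ratio (local_degree_pow r0 uE).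
have vn (k : nat) : v k%:R = k%:R.
  by have := vQ k%:R; rewrite !ratr_nat normr_nat.
have un (k : nat) : (1 < k)%N -> 1 < u k%:R.
  by move=> k1; rewrite uE vn powR_gt1// ltr1n.
have nt : av_nontrivial u.
  exists 2%:R; split; last by rewrite gt_eqF ?un.
  by apply/eqP => h; have := un 2%N isT; rewrite h av0; lra.
have nm : av_normalized u.
  split=> [q pq uq|_ q]; last by rewrite uE vQ ratio_u.
  by have := un q (prime_gt1 pq); rewrite ltNge (ltW uq).
by exists (Place nt nm).
Qed.

End MakePlace.

(** * Absolute values detecting non-integrality *)

Section MaximalRing.
Context {K : fieldType}.

Definition is_subring (O : set K) :=
  [/\ O 1, forall a b, O a -> O b -> O (a - b) & forall a b, O a -> O b -> O (a * b)].

Lemma subring_ops (O : set K) : is_subring O ->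
  [/\ O 0, forall a, O a -> O (- a), forall a b, O a -> O b -> O (a + b),
      forall a n, O a -> O (a ^+ n) & forall m : int, O m%:~R].
Proof.
move=> [c1 OB OM]; have O0 : O 0 by rewrite -(subrr 1); exact: OB.
have ON a : O a -> O (- a) by rewrite -sub0r; exact: OB.
have OD a b : O a -> O b -> O (a + b).
  by move=> Oa Ob; rewrite -[b]opprK; apply: (OB _ _) => //; exact: ON.
have Onat n : O n%:R by elim: n => // n IH; rewrite -natr1; exact: OD.
split=> //.
- by move=> a n Oa; elim: n => [|n IH]; rewrite ?expr0// exprS; exact: OM.
- by move=> [n|n]; [exact: Onat|rewrite NegzE mulrNz; apply/ON/Onat].
Qed.

Lemma subring_sum (O : set K) (I : Type) (r : seq I) (P : pred I) (f : I -> K) :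
  is_subring O -> (forall i, P i -> O (f i)) -> O (\sum_(i <- r | P i) f i).
Proof.
move=> sO h; have [c0 _ OD _ _] := subring_ops sO.
by apply: (big_ind O).
Qed.

Definition adj_ring (O : set K) (z : K) : set K :=
  [set w | exists2 p : {poly K}, (forall i, O p`_i) & w = p.[z]].

Lemma adj_ring_subring O z : is_subring O -> is_subring (adj_ring O z).
Proof.
move=> sO; have [c0 ON OD OX Oint] := subring_ops sO; have [c1 OB OM] := sO; split.
- exists 1; last by rewrite hornerC.
  by move=> i; rewrite coefC; case: eqP.
- move=> _ _ [p hp ->] [q hq ->]; exists (p - q); last by rewrite hornerD hornerN.
  by move=> i; rewrite coefB; exact: OB.
- move=> _ _ [p hp ->] [q hq ->]; exists (p * q); last by rewrite hornerM.
  by move=> i; rewrite coefM; apply: subring_sum => // j _; exact: OM.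
Qed.

Lemma adj_ring_sub O z : is_subring O -> O `<=` adj_ring O z.
Proof.
move=> sO a Oa; have [c0 _ _ _ _] := subring_ops sO.
exists a%:P; last by rewrite hornerC.
by move=> i; rewrite coefC; case: eqP.
Qed.

Lemma adj_ring_gen O z : is_subring O -> adj_ring O z z.
Proof.
move=> sO; have [c0 _ _ _ _] := subring_ops sO; have [c1 _ _] := sO.
exists 'X; last by rewrite hornerX.
by move=> i; rewrite coefX; case: eqP.
Qed.

Definition integral_int (x : K) :=
  exists2 p : {poly int}, p \is monic & root (map_poly intr p) x.

(* Zorn: a maximal subring that contains x^-1 but not x. It turns out to be a
   valuation ring. *)
Lemma max_ring_ex (x : K) : x != 0 -> ~ integral_int x -> exists O : set K,
  [/\ is_subring O, O x^-1, ~ O x & forall B, is_subring B -> O `<=` B -> ~ B x -> B = O].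
Proof.
move=> x0 nint; pose y := x^-1.
(* The alternative [set0] is there for the empty chain, whose union is empty. *)
pose P (A : set K) := A = set0 \/ [/\ is_subring A, A y & ~ A x].
pose base : set K := [set w | exists p : {poly int}, w = (map_poly intr p).[y]].
have Pbase : P base.
  right; split.
  - split.
    + by exists 1; rewrite rmorph1 hornerC.
    + by move=> _ _ [p ->] [q ->]; exists (p - q); rewrite rmorphB hornerD hornerN.
    + by move=> _ _ [p ->] [q ->]; exists (p * q); rewrite rmorphM hornerM.
  - by exists 'X; rewrite map_polyX hornerX.
  (* A relation x = p(1/x) multiplied by x^N is a monic integer equation for [x]. *)
  - move=> [p xE]; apply: nint; pose N := size p.
    pose q : {poly int} := \sum_(i < N) p`_i *: 'X^(N - i).
    have sq : (size q <= N.+1)%N.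
      apply: (leq_trans (size_sum _ _ _)); apply/bigmax_leqP => i _.
      by apply: leq_trans (size_scale_leq _ _) _; rewrite size_polyXn ltnS leq_subr.
    exists ('X^(N.+1) - q).
      by rewrite monicE lead_coefDl ?lead_coefXn// size_polyN size_polyXn ltnS.
    rewrite rmorphB/= map_polyXn rootE hornerD hornerN hornerXn subr_eq0; apply/eqP.
    rewrite exprSr [X in _ * X = _]xE rmorph_sum/= horner_sum.
    rewrite (@horner_coef_wide _ N) ?size_map_poly_le//; last exact: (leq_trans (size_poly _ _)).
    rewrite mulr_sumr; apply: eq_bigr => i _.
    rewrite coef_map/= mulrCA map_polyZ/= hornerZ map_polyXn hornerXn; congr (_ * _).
    by rewrite exprVn -expfB.
have [|A [PA Amax]] := @Zorn_bigcup K P.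
  move=> F FP Ftot.
  have [ex|nex] := pselect (exists2 X, F X & X !=set0); last first.
    left; apply/seteqP; split=> // z [X FX Xz]; apply: nex.
    by exists X => //; exists z.
  have [X0 FX0 X0n] := ex.
  have FPn X : F X -> X !=set0 -> [/\ is_subring X, X y & ~ X x].
    by move=> FX Xn; have [X0E|//] := FP _ FX; move/set0P: Xn; rewrite X0E eqxx.
  have [sX0 X0y _] := FPn _ FX0 X0n.
  have dir a b : (\bigcup_(X in F) X) a -> (\bigcup_(X in F) X) b ->
      exists X, [/\ F X, is_subring X, X a & X b].
    move=> [X FX Xa] [Y FY Yb]; have [XY|YX] := Ftot _ _ FX FY.
      by exists Y; split=> //; [have [] := FPn _ FY (ex_intro _ _ Yb)|exact: XY].
    by exists X; split=> //; [have [] := FPn _ FX (ex_intro _ _ Xa)|exact: YX].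
  right; split.
  - split.
    + by exists X0 => //; case: sX0.
    + move=> a b ua ub; have [X [FX [_ XB _] Xa Xb]] := dir _ _ ua ub.
      by exists X => //; exact: XB.
    + move=> a b ua ub; have [X [FX [_ _ XM] Xa Xb]] := dir _ _ ua ub.
      by exists X => //; exact: XM.
  - by exists X0.
  - by move=> [X FX Xx]; have [_ _] := FPn _ FX (ex_intro _ _ Xx); exact.
have Amax' B : P B -> A `<=` B -> B = A.
  move=> PB AB; apply: contrapT => BA; apply: (Amax B) => //.
  by rewrite properEneq; split => //; apply/eqP => e; apply: BA.
have [A0|[sA Ay Ax]] := PA.
  have := Amax' _ Pbase; rewrite A0 => /(_ (@sub0set _ _)) e.
  have : base 1 by exists 1; rewrite rmorph1 hornerC.
  by rewrite e.
exists A; split=> // B sB AB nBx; apply: Amax' => //; right; split=> //.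
exact: AB.
Qed.

End MaximalRing.

Section Valuation.
Context {K : fieldType} (O : set K) (x : K).
Hypothesis x0 : x != 0.
Hypothesis sO : is_subring O.
Hypothesis Oy : O x^-1.
Hypothesis Ox : ~ O x.
Hypothesis Omax : forall B, is_subring B -> O `<=` B -> ~ B x -> B = O.

Lemma max_ring_gen z : ~ O z -> exists2 p : {poly K}, (forall i, O p`_i) & x^-1 * p.[z] = 1.
Proof.
move=> nOz; have : adj_ring O z x.
  apply: contrapT => h; have := Omax (adj_ring_subring z sO) (@adj_ring_sub _ _ z sO) h.
  by move=> e; apply: nOz; rewrite -e; exact: adj_ring_gen.
by move=> [p Op xE]; exists p => //; rewrite -xE mulVf.
Qed.

(** Put u = 1 - b/x. If 1/u were outside [O], then x = p(1/u) with coefficients in [O], so x u^N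
    lies in [O] for N the size of p. But u^N = 1 - c/x with c in [O], so x - c, and hence [x], would
    lie in [O]. *)
Lemma max_ring_unit b : O b -> 1 - x^-1 * b != 0 /\ O (1 - x^-1 * b)^-1.
Proof.
have [c0 ON OD OX Oint] := subring_ops sO; have [c1 OB OM] := sO.
move=> Ob; set u := 1 - _.
have u0 : u != 0.
  rewrite subr_eq0; apply/eqP => e; apply: Ox.
  by rewrite -(mulr1 x) e mulVKf.
split=> //; apply: contrapT => /max_ring_gen[p Op pE]; apply: Ox.
have [c Oc uc] : exists2 c, O c & u ^+ size p = 1 - x^-1 * c.
  elim: (size p) => [|k [c Oc IH]]; first by exists 0; rewrite // mulr0 subr0 expr0.
  exists (b + c - x^-1 * b * c); last by rewrite exprS IH /u; ring.
  by apply: (OB _ _); [exact: OD|apply: (OM _ _) => //; exact: OM].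
have : O (x * u ^+ size p).
  have -> : x = p.[u^-1] by rewrite -[LHS]mulr1 -pE mulVKf.
  rewrite horner_coef mulr_suml; apply: subring_sum => // i _.
  rewrite -mulrA; apply: (OM _ _) => //.
  by rewrite exprVn mulrC -expfB//; apply: (OX _ _); apply: (OB _ _) => //; exact: OM.
rewrite uc mulrBr mulr1 mulVKf// => h.
by rewrite -[x](subrK c); apply: (OD _ _).
Qed.

(** Chevalley's reduction: by [max_ring_unit] the relation for [z^-1] can be solved for 1 as a
    combination of negative powers of [z]. Multiplying the top term of the relation for [z] by this
    expression lowers its degree. *)
Lemma max_ring_val_aux z n m (p q : {poly K}) : z != 0 -> (m <= n)%N ->
  (size p <= n)%N -> (size q <= m)%N -> (forall i, O p`_i) -> (forall i, O q`_i) ->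
  x^-1 * p.[z] = 1 -> x^-1 * q.[z^-1] = 1 ->
  exists2 p' : {poly K}, (size p' < n)%N & (forall i, O p'`_i) /\ x^-1 * p'.[z] = 1.
Proof.
have [c0 ON OD OX Oint] := subring_ops sO; have [c1 OB OM] := sO.
move=> z0 mn sp sq Op Oq pE qE.
have [u0 Ou] := max_ring_unit (Oq 0%N); set e := (1 - _)^-1 in Ou; set u := 1 - _ in u0 e Ou.
case: n mn sp => [|n] mn sp.
  move: pE sp; rewrite leqn0 size_poly_eq0 => + /eqP p0.
  by rewrite p0 horner0 mulr0 => /eqP; rewrite eq_sym oner_eq0.
have {}qE : \sum_(j < n) (e * x^-1 * q`_j.+1) * z^-1 ^+ j.+1 = 1.
  have : x^-1 * (\sum_(j < n) q`_j.+1 * z^-1 ^+ j.+1) = u.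
    have := qE; rewrite (horner_coef_wide _ (leq_trans sq mn)) big_ord_recl/= expr0 mulr1 mulrDr => qE'.
    by apply: (addrI (x^-1 * q`_0)); rewrite qE' /u addrC subrK.
  rewrite mulr_sumr => h; transitivity (e * u); last exact: mulVf.
  rewrite -h mulr_sumr.
  by apply: eq_bigr => j _; rewrite !mulrA.
exists (\sum_(i < n) p`_i *: 'X^i + \sum_(j < n) (p`_n * (e * x^-1 * q`_j.+1)) *: 'X^(n - j.+1)).
  rewrite ltnS (leq_trans (size_polyD _ _))// geq_max; apply/andP; split.
    apply: (leq_trans (size_sum _ _ _)); apply/bigmax_leqP => i _.
    by apply: leq_trans (size_scale_leq _ _) _; rewrite size_polyXn.
  apply: (leq_trans (size_sum _ _ _)); apply/bigmax_leqP => i _.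
  apply: leq_trans (size_scale_leq _ _) _; rewrite size_polyXn subnS.
  by rewrite prednK ?leq_subr// subn_gt0.
split.
  move=> i; rewrite coefD !coef_sum; apply: (OD _ _); apply: subring_sum => // j _; rewrite coefZ coefXn; apply: (OM _ _) => //; try by case: eqP.
  by apply: (OM _ _) => //; apply: (OM _ _) => //; exact: OM.
rewrite hornerD !horner_sum -[RHS]pE (horner_coef_wide _ sp) big_ord_recr/=; congr (_ * (_ + _)).
  by apply: eq_bigr => i _; rewrite hornerZ hornerXn.
rewrite -[RHS]mulr1 -[in RHS]qE mulr_sumr; apply: eq_bigr => j _.
rewrite hornerZ hornerXn -!mulrA; congr (_ * _).
have jn : ((z == 0%R) + j.+1 <= n)%N by rewrite (negbTE z0) add0n.
by rewrite exprVn (expfB_cond jn); ring.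
Qed.

(** If neither [z] nor [z^-1] lies in [O], take shortest relations for both; the longer one can be
    shortened by means of the other. *)
Lemma max_ring_val z : z != 0 -> O z \/ O z^-1.
Proof.
move=> z0; apply: contrapT => /not_orP[nz nzV].
have zV0 : z^-1 != 0 by rewrite invr_eq0.
pose S w k := `[< exists2 p : {poly K}, (size p <= k)%N & (forall i, O p`_i) /\ x^-1 * p.[w] = 1 >].
have ex w : ~ O w -> exists k, S w k.
  by move=> /max_ring_gen[p Op pE]; exists (size p); apply/asboolP; exists p.
have [n /asboolP[p sp [Op pE]] nmin] := ex_minnP (ex _ nz).
have [m /asboolP[q sq [Oq qE]] mmin] := ex_minnP (ex _ nzV).
have [mn|nm] := leqP m n.
  have [p' sp' h] := max_ring_val_aux z0 mn sp sq Op Oq pE qE.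
  have := nmin (size p'); rewrite leqNgt sp' => /(_ _)/negP; apply=> //.
  by apply/asboolP; exists p'.
have qE' : x^-1 * p.[z^-1^-1] = 1 by rewrite invrK.
have [p' sp' h] := max_ring_val_aux zV0 (ltnW nm) sq sp Oq Op qE qE'.
have := mmin (size p'); rewrite leqNgt sp' => /(_ _)/negP; apply=> //.
by apply/asboolP; exists p'.
Qed.

End Valuation.

(** * From a valuation ring of a number field to an absolute value *)

Section RankOne.
Context {R : realType} {K : fieldExtType rat} (O : set K) (x : K).
Hypothesis x0 : x != 0.
Hypothesis sO : is_subring O.
Hypothesis Oy : O x^-1.
Hypothesis Ox : ~ O x.
Hypothesis Oval : forall z, z != 0 -> O z \/ O z^-1.

Let unit z := [/\ z != 0, O z & O z^-1].

Local Lemma unitM a b : unit a -> unit b -> unit (a * b).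
Proof.
have [_ _ OM] := sO; move=> [a0 a1 a2] [b0 b1 b2]; rewrite /unit invfM mulf_neq0//.
by split=> //; apply: (OM _ _).
Qed.

Local Lemma unitV a : unit a -> unit a^-1.
Proof. by move=> [a0 a1 a2]; rewrite /unit invrK invr_eq0. Qed.

Local Lemma unitN a : unit a -> unit (- a).
Proof.
have [_ ON _ _ _] := subring_ops sO.
by move=> [a0 a1 a2]; rewrite /unit invrN oppr_eq0; split=> //; exact: ON.
Qed.

Local Lemma unitX a n : unit a -> unit (a ^+ n).
Proof.
have [_ _ _ OX _] := subring_ops sO.
by move=> [a0 a1 a2]; rewrite /unit -exprVn expf_neq0//; split=> //; exact: OX.
Qed.

Local Lemma unit1 : unit 1.
Proof. by have [c1 _ _] := sO; rewrite /unit invr1 oner_eq0. Qed.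

Local Lemma unitMl a b : O a -> O b -> unit (a * b) -> unit a.
Proof.
have [_ _ OM] := sO; move=> Oa Ob [ab0 _ h]; have /norP[a0 b0] : ~~ ((a == 0) || (b == 0)).
  by rewrite -mulf_eq0.
split=> //; rewrite (_ : a^-1 = b * (a * b)^-1); first exact: OM.
by rewrite invfM mulrCA mulfV// mulr1.
Qed.

(** One of [a], [b] is a multiple of the other, and the divisor among them divides the unit [a + b].
    In other words, a valuation ring is local. *)
Local Lemma nonunitD a b : O a -> O b -> unit (a + b) -> unit a \/ unit b.
Proof.
have [c0 ON OD OX Oint] := subring_ops sO; have [c1 OB OM] := sO.
have aux u w : w != 0 -> O w -> O (u / w) -> unit (u + w) -> unit w.
  move=> w0 Ow uw [e0 _ h]; split=> //.
  rewrite (_ : w^-1 = (u / w + 1) * (u + w)^-1); first by apply: (OM _ _) => //; exact: OD.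
  by field; rewrite w0 e0.
move=> Oa Ob uab; have [a0|a0] := eqVneq a 0; first by right; rewrite a0 add0r in uab.
have [b0|b0] := eqVneq b 0; first by left; rewrite b0 addr0 in uab.
have ab0 : a / b != 0 by rewrite mulf_neq0// invr_eq0.
have [h|h] := Oval ab0; first by right; exact: (aux a).
by left; apply: (aux b) => //; [move: h; rewrite invfM invrK mulrC|rewrite addrC].
Qed.

Local Lemma unit_dom z w : z != 0 -> w != 0 -> ~ unit (z / w) ->
  unit ((z + w) / z) \/ unit ((z + w) / w).
Proof.
have [c0 ON OD OX Oint] := subring_ops sO.
have aux u : O u -> ~ unit u -> unit (1 + u).
  move=> Ou nu; have u1 : unit (1 + u - u) by rewrite addrK; exact: unit1.
  have [||//|/unitN] := nonunitD _ _ u1; [by apply: OD => //; case: sO|exact: ON|].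
  by rewrite opprK => /nu.
move=> z0 w0 nu; have zw0 : z / w != 0 by rewrite mulf_neq0// invr_eq0.
have [h|h] := Oval zw0.
  by right; rewrite mulrDl divff// addrC; exact: aux.
left; rewrite mulrDl divff//; apply: aux; first by move: h; rewrite invfM invrK mulrC.
by move=> /unitV; rewrite invfM invrK mulrC.
Qed.

(** Terms with pairwise different values cannot cancel: the sum has the value of one of its
    terms. *)
Local Lemma unit_pair (c : nat -> K) z : z != 0 -> forall n,
  (exists2 i, (i < n)%N & c i != 0) ->
  (forall i j, (i < j < n)%N -> c i != 0 -> c j != 0 -> ~ unit (c i * z ^+ i / (c j * z ^+ j))) ->
  exists i, [/\ (i < n)%N, c i != 0 & unit ((\sum_(i < n) c i * z ^+ i) / (c i * z ^+ i))].
Proof.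
move=> z0; have nz i : c i != 0 -> c i * z ^+ i != 0 by move=> h; rewrite mulf_neq0// expf_neq0.
elim=> [[i]//|n IH] [i0 i0n ci0] h; rewrite big_ord_recr/=.
have h' : forall i j, (i < j < n)%N -> c i != 0 -> c j != 0 -> ~ unit (c i * z ^+ i / (c j * z ^+ j)).
  by move=> i j /andP[ij jn]; apply: h; rewrite ij ltnS ltnW.
have [cn0|cn0] := eqVneq (c n) 0.
  rewrite cn0 mul0r addr0.
  have [|//|i [iN ci ui]] := IH; last by exists i; split; rewrite // ltnW.
  exists i0 => //; move: i0n; rewrite ltnS leq_eqVlt => /orP[/eqP e|//].
  by move: ci0; rewrite e cn0 eqxx.
have [ex|nex] := pselect (exists2 i, (i < n)%N & c i != 0); last first.
  exists n; split=> //; rewrite big1 ?add0r ?divff ?nz//; first exact: unit1.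
  move=> i _; have [->|ci] := eqVneq (c i) 0; first by rewrite mul0r.
  by case: nex; exists i.
have [i [iN ci ui]] := IH ex h'; set S := \sum_(i < n) _ in ui *.
have S0 : S != 0 by have [] := ui; rewrite mulf_eq0 negb_or => /andP[].
have nS : ~ unit (S / (c n * z ^+ n)).
  move=> uS; apply: (h i n _ ci cn0); first by rewrite iN ltnSn.
  have := unitM (unitV ui) uS; rewrite (_ : _ * _ = c i * z ^+ i / (c n * z ^+ n))//.
  by field; rewrite S0 ci cn0 !expf_neq0.
have [u1|u2] := unit_dom S0 (nz _ cn0) nS; last by exists n.
exists i; split; rewrite // 1?ltnW//.
by have := unitM u1 ui; rewrite mulrA divfK.
Qed.

(** A vanishing sum must have two terms of equal value, so a power of [z] agrees with a rational
    number up to a unit. Thus the value group is commensurable with that of the rationals, which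
    gives rank one. *)
Local Lemma unit_alg (f : {poly int}) z : z != 0 -> f != 0 -> root (map_poly intr f) z ->
  exists i j, [/\ (i < j)%N, f`_i != 0, f`_j != 0 &
     unit ((f`_j)%:~R * z ^+ (j - i) / (f`_i)%:~R)].
Proof.
move=> z0 f0 rf; apply: contrapT => h.
have intr0 (m : int) : (m%:~R == 0 :> K) = (m == 0).
  by rewrite -(rmorph_int (in_alg K)) fmorph_eq0 intr_eq0.
have [||i [iN ci []]] := @unit_pair (fun i => (f`_i)%:~R) z z0 (size f).
- exists (size f).-1; first by rewrite prednK ?size_poly_gt0.
  by rewrite intr0 -lead_coefE lead_coef_eq0.
- move=> i j /andP[ij _]; rewrite !intr0 => fi fj u; apply: h; exists i, j; split=> //.
  have := unitV u; rewrite (_ : _^-1 = (f`_j)%:~R * z ^+ (j - i) / (f`_i)%:~R)//.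
  rewrite -{2}(subnK (ltnW ij)) exprD.
  by field; rewrite !intr0 fi fj !expf_neq0.
- rewrite (_ : \sum_(i0 < _) _ = 0) ?mul0r ?eqxx//.
  move/rootP: rf; rewrite (@horner_coef_wide _ (size f)) ?size_poly// => {2}<-.
  by apply: eq_bigr => j _; rewrite coef_map.
Qed.

Local Lemma int_alg (z : K) : exists2 f : {poly int}, f != 0 & root (map_poly intr f) z.
Proof.
have /polyOver1P[g gE] := minPolyOver 1%AS z.
have [q [a a0 qE]] := rat_poly_scale g.
have E : map_poly intr q = a%:~R *: minPoly 1%AS z.
  rewrite gE qE map_polyZ/= scalerA -[a%:~R in RHS](rmorph_int (in_alg K)) -rmorphM/=.
  rewrite mulfV ?intr_eq0// scale1r scale1r -map_poly_comp.
  by apply: eq_map_poly => m; exact/esym/(rmorph_int (in_alg K)).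
exists q; last by rewrite E rootZ ?root_minPoly// -(rmorph_int (in_alg K)) fmorph_eq0 intr_eq0.
apply/eqP => q0; have := E; rewrite q0 map_poly0 => /esym/eqP.
by rewrite scaler_eq0 -(rmorph_int (in_alg K)) fmorph_eq0 intr_eq0 (negbTE a0)/= (negbTE (monic_neq0 (monic_minPoly _ _))).
Qed.

Local Lemma intrK0 (m : int) : (m%:~R == 0 :> K) = (m == 0).
Proof. by rewrite -(rmorph_int (in_alg K)) fmorph_eq0 intr_eq0. Qed.

Local Lemma natrK0 (m : nat) : (m%:R == 0 :> K) = (m == 0)%N.
Proof. by rewrite (intrK0 m%:Z). Qed.

Local Lemma Onat (m : nat) : O m%:R.
Proof. by have [_ _ _ _ Oint] := subring_ops sO; exact: (Oint m%:Z). Qed.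

Local Lemma unit_nat : (forall p : nat, prime p -> unit p%:R) ->
  forall n : nat, (0 < n)%N -> unit n%:R.
Proof.
move=> h; elim/ltn_ind=> n IH n0.
have [n1|n1] := leqP n 1.
  by have -> : n = 1%N; [lia|exact: unit1].
have pp := pdiv_prime n1; have pn := pdiv_dvd n.
rewrite -(divnK pn) natrM; apply: unitM; last exact: h.
apply: IH; last by rewrite divn_gt0 ?pdiv_gt0// dvdn_leq.
by rewrite ltn_Pdiv ?prime_gt1.
Qed.

Local Lemma unit_int : (forall n : nat, (0 < n)%N -> unit n%:R) ->
  forall m : int, m != 0 -> unit m%:~R.
Proof.
move=> h [m|m] m0; first by apply: (h m); rewrite lt0n.
by rewrite NegzE mulrNz; apply/unitN/h.
Qed.

(** If all primes were units, so would be all nonzero integers; then [unit_alg] would make a power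
    of [x^-1] a unit, although [x] is not in [O]. *)
Local Lemma prime_nonunit : exists2 p : nat, prime p & ~ unit p%:R.
Proof.
apply: contrapT => np; have upr p : prime p -> unit p%:R.
  by move=> pp; apply: contrapT => nu; apply: np; exists p.
have ui := unit_int (unit_nat upr).
have y0 : x^-1 != 0 by rewrite invr_eq0.
have [f f0 rf] := int_alg x^-1.
have [i [j [ij fi fj u]]] := unit_alg y0 f0 rf.
have := unitM (unitV (ui _ fj)) (unitM u (ui _ fi)).
rewrite divfK ?intrK0// mulKf ?intrK0// => uy.
have : unit x^-1.
  have [_ _ _ OX _] := subring_ops sO.
  apply: (@unitMl _ (x^-1 ^+ (j - i).-1) Oy); first exact: OX.
  by rewrite -exprS prednK// subn_gt0.
by case=> _ _; rewrite invrK.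
Qed.

Section AtPrime.
Variable p : nat.
Hypothesis pp : prime p.
Hypothesis np : ~ unit p%:R.
Let P : K := p%:R.

Local Lemma P0 : P != 0. Proof. by rewrite natrK0 -lt0n prime_gt0. Qed.

Local Lemma unit_coprime (m : nat) : coprime p m -> unit m%:R.
Proof.
move=> cpm; have [a b e _] := egcdnP m (prime_gt0 pp).
have [_ ON _ _ _] := subring_ops sO; have [_ _ OM] := sO.
have : unit (a%:R * p%:R + - (b%:R * m%:R)).
  rewrite (_ : _ + _ = 1); first exact: unit1.
  by rewrite -!natrM e (eqP cpm) natrD addrAC subrr add0r.
move=> /nonunitD[||h|/unitN].
- by apply: (OM _ _); exact: Onat.
- by apply: ON; apply: (OM _ _); exact: Onat.
- by case: np; apply: (@unitMl _ a%:R); [exact: Onat|exact: Onat|rewrite mulrC].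
- rewrite opprK => h; apply: (@unitMl _ b%:R); [exact: Onat|exact: Onat|].
  by rewrite mulrC.
Qed.

Local Lemma unit_int_part (m : int) : m != 0 -> exists a : nat, unit (m%:~R / P ^+ a).
Proof.
have nat_case (n : nat) : (0 < n)%N -> exists a : nat, unit (n%:R / P ^+ a).
  move=> n0; exists (logn p n); have [q cpq nE] := pfactor_coprime pp n0.
  rewrite {1}nE natrM natrX mulfK ?expf_neq0 ?P0//.
  exact: unit_coprime.
case: m => m m0; first by apply: (nat_case m); rewrite lt0n.
have [a ua] := nat_case m.+1 isT; exists a.
by rewrite NegzE mulrNz mulNr; exact: unitN.
Qed.

Local Lemma unit_powP (m n : nat) : unit (P ^+ m / P ^+ n) -> m = n.
Proof.
have aux a b : (a < b)%N -> ~ unit (P ^+ b / P ^+ a).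
  move=> ab; rewrite -expfB// => u; apply: np.
  have [_ _ _ OX _] := subring_ops sO.
  apply: (@unitMl _ (P ^+ (b - a).-1)); [exact: Onat|by apply: OX; exact: Onat|].
  by rewrite -exprS prednK ?subn_gt0.
move=> u; have [mn|nm|//] := ltngtP m n; last by case: (aux _ _ nm).
by case: (aux _ _ mn); have := unitV u; rewrite invfM invrK mulrC.
Qed.

(* r is the order of z at P: z^b is P^(a2 - a1) up to a unit. *)
Definition val_ord (z : K) (r : R) := exists b a1 a2 : nat,
  [/\ (0 < b)%N, unit (z ^+ b * P ^+ a1 / P ^+ a2) & r = (a2%:R - a1%:R) / b%:R].

Local Lemma val_ord_ex z : z != 0 -> exists r, val_ord z r.
Proof.
move=> z0; have [f f0 rf] := int_alg z.
have [i [j [ij fi fj u]]] := unit_alg z0 f0 rf.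
have [a1 u1] := unit_int_part fj; have [a2 u2] := unit_int_part fi.
exists ((a2%:R - a1%:R) / (j - i)%:R), (j - i)%N, a1, a2; split; rewrite ?subn_gt0//.
have := unitM (unitM u u2) (unitV u1).
rewrite (_ : _ * _ = z ^+ (j - i) * P ^+ a1 / P ^+ a2)//.
by field; rewrite !expf_neq0 ?P0 ?intrK0 ?fi ?fj.
Qed.

Local Lemma val_ord_uniq z r s : z != 0 -> val_ord z r -> val_ord z s -> r = s.
Proof.
move=> z0 [b [a1 [a2 [b0 u ->]]]] [c [d1 [d2 [c0 w ->]]]].
have := unitM (unitX c u) (unitV (unitX b w)).
rewrite (_ : _ * _ = P ^+ (a1 * c + d2 * b) / P ^+ (a2 * c + d1 * b)); last first.
  rewrite !exprD !exprM !exprMn !exprVn -!exprM [(c * b)%N]mulnC.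
  by field; rewrite !expf_neq0 ?P0.
move=> /unit_powP e; apply/eqP; rewrite eqr_div ?pnatr_eq0 -?lt0n//.
rewrite !mulrBl -!natrM subr_eq addrAC eq_sym subr_eq -!natrD eqr_nat.
by apply/eqP; lia.
Qed.

Local Lemma val_ordM z w r s : val_ord z r -> val_ord w s -> val_ord (z * w) (r + s).
Proof.
move=> [b [a1 [a2 [b0 u ->]]]] [c [d1 [d2 [c0 h ->]]]].
exists (b * c)%N, (a1 * c + d1 * b)%N, (a2 * c + d2 * b)%N; split.
- by rewrite muln_gt0 b0.
- have := unitM (unitX c u) (unitX b h).
  rewrite (_ : _ * _ = (z * w) ^+ (b * c) * P ^+ (a1 * c + d1 * b) / P ^+ (a2 * c + d2 * b))//.
  rewrite !exprD !exprM !exprMn !exprVn -!exprM [(c * b)%N]mulnC.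
  by field; rewrite !expf_neq0 ?P0.
- rewrite !natrD !natrM; field.
  by rewrite !pnatr_eq0 -!lt0n b0 c0.
Qed.

Local Lemma val_ord_ge0 z r : O z -> val_ord z r -> 0 <= r.
Proof.
move=> Oz [b [a1 [a2 [b0 u ->]]]]; rewrite divr_ge0// subr_ge0 ler_nat leqNgt.
apply/negP => lt; apply: np.
have [_ _ _ OX _] := subring_ops sO; have [_ _ OM] := sO.
apply: (@unitMl _ (z ^+ b * P ^+ (a1 - a2).-1)); first exact: Onat.
  by apply: (OM _ _); apply: OX => //; exact: Onat.
by move: u; rewrite mulrCA -exprS prednK ?subn_gt0// expfB// mulrA.
Qed.

Local Lemma val_ord_gt0 z r : O z -> ~ unit z -> val_ord z r -> 0 < r.
Proof.
move=> Oz nz hr; rewrite lt_neqAle (val_ord_ge0 Oz hr) andbT.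
apply/eqP => r0; apply: nz; case: hr => b [a1 [a2 [b0 u rE]]].
have e : a2 = a1.
  apply/eqP; rewrite -(eqr_nat R) -subr_eq0; move/eqP: rE.
  by rewrite -r0 eq_sym mulf_eq0 invr_eq0 pnatr_eq0 (gtn_eqF b0) orbF.
have [_ _ _ OX _] := subring_ops sO.
apply: (@unitMl _ (z ^+ b.-1) Oz); first exact: OX.
by rewrite -exprS prednK//; move: u; rewrite e mulfK// expf_neq0 ?P0.
Qed.

(** The order at [p] exists for every nonzero element, is unique and additive, and is nonnegative on
    [O]; so p^(-ord) is multiplicative and at most 1 on [O]. The ultrametric inequality follows on
    dividing by the larger summand. *)
Lemma valuation_absval : exists v : absval R K,
  [/\ av_ultra v, v p%:R = p%:R^-1 & 1 < v x].
Proof.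
have p1 : 1 < (p%:R : R) by rewrite ltr1n prime_gt1.
have p0 : 0 < (p%:R : R) := lt_trans ltr01 p1.
have /choice[d hd] z : exists r, z != 0 -> val_ord z r.
  have [->|z0] := eqVneq z 0; first by exists 0.
  by have [r hr] := val_ord_ex z0; exists r.
pose v z : R := if z == 0 then 0 else p%:R `^ (- d z).
have v_ge0 z : 0 <= v z by rewrite /v; case: ifP => // _; exact: powR_ge0.
have v_eq0 z : v z = 0 <-> z = 0.
  rewrite /v; case: eqVneq => // z0; split=> [/eqP|e].
    by rewrite gt_eqF// powR_gt0.
  by rewrite e eqxx in z0.
have oM z w : z != 0 -> w != 0 -> d (z * w) = d z + d w.
  move=> z0 w0; have zw0 := mulf_neq0 z0 w0.
  exact: (val_ord_uniq zw0 (hd _ zw0) (val_ordM (hd _ z0) (hd _ w0))).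
have v_mul z w : v (z * w) = v z * v w.
  rewrite /v mulf_eq0; case: (eqVneq z 0) => [_|z0]; first by rewrite mul0r.
  case: (eqVneq w 0) => [_|w0]; first by rewrite mulr0.
  by rewrite /= oM// opprD powRD// (gt_eqF p0) implybT.
have v_le1 z : O z -> v z <= 1.
  move=> Oz; rewrite /v; case: eqVneq => // z0.
  rewrite powRN invf_le1 ?powR_gt0// -[leLHS](powRr0 p%:R).
  by rewrite ler_powR ?(ltW p1)// (val_ord_ge0 Oz (hd _ z0)).
have v_max z w : v (z + w) <= Num.max (v z) (v w).
  have [c1 OB OM] := sO; have [_ _ OD _ _] := subring_ops sO.
  have aux a b : b != 0 -> O (a / b) -> v (a + b) <= v b.
    move=> b0 ab; rewrite -[a + b](divfK b0) v_mul ler_piMl// v_le1//.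
    by rewrite mulrDl divff//; exact: OD.
  have [z0|z0] := eqVneq z 0; first by rewrite z0 add0r le_max lexx orbT.
  have [w0|w0] := eqVneq w 0; first by rewrite w0 addr0 le_max lexx.
  have zw0 : z / w != 0 by rewrite mulf_neq0// invr_eq0.
  rewrite le_max; have [h|h] := Oval zw0; first by rewrite [X in _ || X]aux ?orbT.
  by apply/orP; left; rewrite addrC; apply: aux => //; move: h; rewrite invfM invrK mulrC.
have v_add z w : v (z + w) <= v z + v w.
  by apply: le_trans (v_max z w) _; rewrite ge_max lerDl lerDr !v_ge0.
exists (AbsVal v_ge0 v_eq0 v_mul v_add); split=> //=.
- rewrite /v natrK0 (gtn_eqF (prime_gt0 pp)).
  have -> : d p%:R = 1; last by rewrite powR_inv1 ?ltW.
  have P0' := P0; apply: (val_ord_uniq P0' (hd _ P0')).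
  exists 1%N, 0%N, 1%N; split=> //; last by rewrite subr0 divr1.
  by rewrite expr0 mulr1 expr1 divff//; exact: unit1.
- have y0 : x^-1 != 0 by rewrite invr_eq0.
  have ny : ~ unit x^-1 by case=> _ _; rewrite invrK.
  have := val_ord_gt0 Oy ny (hd _ y0) => oy.
  have vy : v x^-1 < 1 by rewrite /v (negbTE y0) powRN invf_lt1 ?powR_gt0// powR_gt1.
  have v1 : v x^-1 * v x = 1.
    rewrite -v_mul mulVf// /v oner_eq0.
    have := oM 1 1 (oner_neq0 _) (oner_neq0 _); rewrite mulr1 => /eqP.
    by rewrite -subr_eq0 opprD addNKr oppr_eq0 => /eqP ->; rewrite oppr0 powRr0.
  have vx0 : 0 < v x^-1.
    by rewrite lt_neqAle v_ge0 andbT eq_sym; apply/eqP => /v_eq0/eqP; exact/negP.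
  by rewrite -(ltr_pM2l vx0) v1 mulr1.
Qed.

End AtPrime.

Lemma ring_absval : exists (v : absval R K) (p : nat),
  [/\ prime p, av_ultra v, v p%:R = p%:R^-1 & 1 < v x].
Proof.
have [p pp np] := prime_nonunit.
by have [v [h1 h2 h3]] := valuation_absval pp np; exists v, p.
Qed.

End RankOne.

Lemma not_integral_absval (R : realType) (K : fieldExtType rat) (x : K) :
  ~ integral_int x -> exists (v : absval R K) (p : nat),
  [/\ prime p, av_ultra v, v p%:R = p%:R^-1 & 1 < v x].
Proof.
move=> nx; have x0 : x != 0.
  apply/eqP => x0; apply: nx; exists 'X; first exact: monicX.
  by rewrite map_polyX x0 rootX.
have [B [sO Oy Ox Omax]] := max_ring_ex x0 nx.
have Bval z : z != 0 -> B z \/ B z^-1 by exact: (@max_ring_val _ B x).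
exact: (@ring_absval R K B x).
Qed.

(** * Complex embeddings *)

Section ComplexAbs.
Import complex.
Context (R : realType).
Local Notation C := (complex R).

Lemma complex_absval : exists (L : numClosedFieldType) (v : absval R L),
  forall q : rat, v (ratr q) = `|ratr q|.
Proof.
have h1 (z : C) : 0 <= Normc.normc z by case: z => a b; exact: sqrtr_ge0.
have h2 (z : C) : Normc.normc z = 0 <-> z = 0.
  by split=> [/Normc.eq0_normc//|->]; exact: Normc.normc0.
have h3 (z w : C) : Normc.normc (z * w) = Normc.normc z * Normc.normc w by exact: Normc.normcM.
have h4 (z w : C) : Normc.normc (z + w) <= Normc.normc z + Normc.normc w by exact: le_normcD.
exists C, (AbsVal h1 h2 h3 h4) => q /=.
have -> : ratr q = real_complex R (ratr q) :> C.
  exact: (esym (fmorph_rat (real_complex R : {rmorphism R -> C}) q)).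
by rewrite /= expr0n/= addr0 sqrtr_sqr.
Qed.

End ComplexAbs.

Section Embeddings.
Context {K : fieldExtType rat}.

Definition ratpoly (x : K) (g : {poly rat}) := map_poly (in_alg K) g = minPoly 1%AS x.

Lemma ratpoly_ex x : exists g, ratpoly x g.
Proof. by have /polyOver1P[g gE] := minPolyOver 1%AS x; exists g. Qed.

Lemma ratpoly_dvd x g p : ratpoly x g -> root (map_poly (in_alg K) p) x -> g %| p.
Proof.
move=> gE rp; rewrite -(dvdp_map (in_alg K)) gE minPoly_dvdp//.
by apply/polyOver1P; exists p.
Qed.

Lemma ratpoly_size x g : ratpoly x g -> (1 < size g)%N.
Proof.
move=> gE; rewrite -(size_map_poly (in_alg K)) gE size_minPoly ltnS.
by rewrite adjoin_degreeE divn_gt0 ?dimvS ?subv_adjoin// ?adim_gt0.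
Qed.

Lemma ratpoly_monic x g : ratpoly x g -> g \is monic.
Proof. by move=> gE; rewrite -(map_monic (in_alg K)) gE monic_minPoly. Qed.

Lemma primitive_ex : exists th : K, forall x : K, exists p : {poly rat},
  (map_poly (in_alg K) p).[th] = x.
Proof.
have sep : separable 1%AS {:K}%AS.
  apply/separableP => y _; apply: pcharf0_separable.
  by move=> p; rewrite (pchar_lalg K) pchar_num.
exists (separable_generator 1%AS {:K}%AS) => x.
have : x \in <<1; separable_generator 1%AS {:K}%AS>>%VS.
  by rewrite -eq_adjoin_separable_generator ?sub1v// memvf.
move/Fadjoin_polyP => [q /polyOver1P[p ->] ->]; by exists p.
Qed.

(** Let [th] be a primitive element with minimal polynomial f, and x = p(th). The resultant in T of
    f(T) and p(T) - X vanishes at X = x, so [g] divides it and it vanishes at [zeta]. A common root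
    z of f and p - zeta then defines the embedding that sends [th] to z. *)
Lemma embedding_root (C : numClosedFieldType) (x : K) (g : {poly rat}) (zeta : C) :
  ratpoly x g -> root (map_poly ratr g) zeta ->
  exists s : K -> C, [/\ s x = zeta, forall q : rat, s (ratr q) = ratr q,
    s 1 = 1, forall a b, s (a + b) = s a + s b & forall a b, s (a * b) = s a * s b].
Proof.
move=> gE rz; have [th hth] := primitive_ex; have /choice[pp hpp] := hth.
have [f fE] := ratpoly_ex th; have sf := ratpoly_size fE.
have [z rfz pz] : exists2 z : C, root (map_poly ratr f) z & (map_poly ratr (pp x)).[z] = zeta.
  set p := pp x.
  (* The resultant argument needs positive degree in T. A constant [p] means that [x] is rational,
     and then any root of f will do. *)
  have [sp|sp] := leqP (size p) 1.
    have [c pc] : exists c, p = c%:P by exists p`_0; exact: size1_polyC.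
    have : (1 < size (map_poly (ratr : rat -> C) f))%N by rewrite size_map_poly.
    rewrite ltn_neqAle eq_sym => /andP[/closed_rootP[z rz'] _]; exists z => //.
    rewrite pc map_polyC hornerC /=.
    have : g %| 'X - c%:P.
      apply: (ratpoly_dvd gE); rewrite rmorphB/= map_polyX map_polyC root_XsubC.
      by rewrite -(hpp x) -/p pc map_polyC hornerC.
    rewrite -(dvdp_map (ratr : {rmorphism rat -> C})) => /root_dvdp/(_ rz).
    by rewrite rmorphB/= map_polyX map_polyC root_XsubC => /eqP.
  pose Q1 : {poly {poly rat}} := map_poly polyC f.
  pose Q2 : {poly {poly rat}} := map_poly polyC p - 'X%:P.
  have sQ1 : size Q1 = size f by rewrite size_map_poly.
  have spC : size (map_poly (@polyC rat) p) = size p by rewrite size_map_poly.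
  have sX : (size ('X%:P : {poly {poly rat}}) < size (map_poly (@polyC rat) p))%N.
    by rewrite spC (leq_ltn_trans (size_polyC_leq1 _)).
  have sQ2 : size Q2 = size p by rewrite size_polyDl ?size_polyN.
  have lQ1 : lead_coef Q1 = (lead_coef f)%:P by rewrite lead_coef_map.
  have lQ2 : lead_coef Q2 = (lead_coef p)%:P by rewrite lead_coefDl ?size_polyN// lead_coef_map.
  set res := resultant Q1 Q2.
  have gres : g %| res.
    apply: (ratpoly_dvd gE).
    have [[u w] _ /= E] := resultant_in_ideal (p := Q1) (q := Q2) ltac:(by rewrite sQ1) ltac:(by rewrite sQ2).
    pose ev : {rmorphism {poly rat} -> K} := horner_eval x \o map_poly (in_alg K).
    have := congr1 (fun r => (map_poly ev r).[th]) E.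
    rewrite map_polyC hornerC rmorphD/= !rmorphM/= hornerD !hornerM.
    have e1 : map_poly ev Q1 = map_poly (in_alg K) f.
      rewrite -map_poly_comp; apply: eq_map_poly => c /=.
      by rewrite /horner_eval map_polyC hornerC.
    have e2 : map_poly ev Q2 = map_poly (in_alg K) p - x%:P.
      rewrite /Q2 [LHS]rmorphB; congr (_ - _); last first.
        by rewrite [LHS]map_polyC/= /horner_eval map_polyX hornerX.
      rewrite -[LHS]map_poly_comp.
      by apply: eq_map_poly => c /=; rewrite /horner_eval map_polyC hornerC.
    rewrite e1 e2 fE minPolyxx mulr0 add0r hornerD hornerN hornerC hpp subrr mulr0.
    by move=> e; rewrite rootE -/(horner_eval _ _); apply/eqP.
  pose ez : {rmorphism {poly rat} -> C} := horner_eval zeta \o map_poly ratr.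
  have ezC c : ez c%:P = ratr c by rewrite /= /horner_eval map_polyC hornerC.
  have f0 : f != 0 := monic_neq0 (ratpoly_monic fE).
  have p0 : p != 0 by rewrite -size_poly_gt0 (leq_trans _ sp).
  have res0 : ez res = 0.
    have := root_dvdp (_ : map_poly ratr g %| map_poly (ratr : rat -> C) res) rz.
    by rewrite dvdp_map => /(_ gres) /rootP.
  have := map_resultant (f := ez) (p := Q1) (q := Q2).
  rewrite lQ1 lQ2 !ezC !fmorph_eq0 !lead_coef_eq0 -/res res0 => /(_ f0 p0)/esym/eqP.
  rewrite resultant_eq0 ltn_neqAle eq_sym => /andP[/closed_rootP[z]].
  have e1 : map_poly ez Q1 = map_poly ratr f.
    by rewrite -map_poly_comp; apply: eq_map_poly => c; rewrite -ezC.
  have e2 : map_poly ez Q2 = map_poly ratr p - zeta%:P.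
    rewrite /Q2 [LHS]rmorphB; congr (_ - _); last first.
      by rewrite [LHS]map_polyC/= /horner_eval map_polyX hornerX.
    rewrite -[LHS]map_poly_comp.
    by apply: eq_map_poly => c; rewrite -ezC.
  rewrite e1 e2 root_gcd => /andP[rf rp] _; exists z => //.
  by apply/eqP; rewrite -subr_eq0; move: rp; rewrite rootE hornerD hornerN hornerC.
pose s (a : K) : C := (map_poly ratr (pp a)).[z].
have sE (q : {poly rat}) a : (map_poly (in_alg K) q).[th] = a -> s a = (map_poly ratr q).[z].
  move=> qa; apply/eqP; rewrite -subr_eq0 /s -hornerN -hornerD -rmorphB/=.
  have /dvdpP[u ->] : f %| pp a - q.
    by apply: (ratpoly_dvd fE); rewrite rootE rmorphB/= hornerD hornerN hpp qa subrr.
  by rewrite rmorphM hornerM (rootP rfz) mulr0.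
exists s; split=> [|q||a b|a b].
- exact: pz.
- rewrite (sE q%:P); first by rewrite map_polyC hornerC.
  by rewrite map_polyC hornerC; exact: (fmorph_eq_rat (in_alg K)).
- by rewrite (sE 1); rewrite rmorph1 hornerC.
- by rewrite (sE (pp a + pp b)); rewrite rmorphD/= hornerD// !hpp.
- by rewrite (sE (pp a * pp b)); rewrite rmorphM/= hornerM// !hpp.
Qed.

End Embeddings.

(** * A weak product formula *)

Section Star.
Context {R : realType} {K : fieldExtType rat}.
Implicit Types (w : place R K) (c : place R K -> R).

Lemma intK0 (m : int) : (m%:~R == 0 :> K) = (m == 0).
Proof. by rewrite -(rmorph_int (in_alg K)) fmorph_eq0 intr_eq0. Qed.

Lemma natK0 (m : nat) : (m%:R == 0 :> K) = (m == 0)%N.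
Proof. by rewrite (intK0 m%:Z). Qed.

Lemma ratpoly_size_le (x : K) g : ratpoly x g -> (size g <= (\dim {:K}).+1)%N.
Proof.
move=> gE; rewrite -(size_map_poly (in_alg K)) gE size_minPoly ltnS.
by rewrite adjoin_degreeE dimv1 divn1 dimvS// subvf.
Qed.

(** Gauss's lemma: the leading coefficients of the two integer factors have product 1, so the
    primitive multiple of [g] is [g] itself up to sign. *)
Lemma ratpoly_int (x : K) g : ratpoly x g -> integral_int x ->
  exists q : {poly int}, g = map_poly intr q.
Proof.
move=> gE [P Pm rP]; have gm := ratpoly_monic gE.
have : g %| map_poly intr P.
  apply: (ratpoly_dvd gE); rewrite -map_poly_comp.
  rewrite (eq_map_poly (g := intr))// => m /=; exact: (rmorph_int (in_alg K)).
move=> /dvdpP_rat_int[q [a a0 qE] [r rE]].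
have : lead_coef q * lead_coef r = 1 by rewrite -lead_coefM -rE; apply/eqP.
move=> /(congr1 absz); rewrite abszM => /eqP; rewrite muln_eq1 => /andP[lq _].
have ll : lead_coef q * lead_coef q = 1.
  by case: (lead_coef q) lq => [[|[|?]]|[|?]].
exists (lead_coef q *: q); rewrite map_polyZ/= {1}qE; congr (_ *: _).
have : a * (lead_coef q)%:~R = 1.
  have := eqP gm; rewrite qE lead_coefZ lead_coef_map_inj//; exact: intr_inj.
move=> /(congr1 (fun z => z * (lead_coef q)%:~R)).
by rewrite -mulrA -intrM ll mulr1 mul1r.
Qed.

Lemma av_natr_le (v : absval R K) (n : nat) : v n%:R <= n%:R.
Proof.
elim: n => [|n IH]; first by rewrite av0.
by rewrite -natr1 -[in leRHS]natr1; apply: le_trans (av_add _ _ _) _; rewrite av1 lerD2r.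
Qed.

Lemma av_intr_le (v : absval R K) (m : int) : v m%:~R <= `|m%:~R|.
Proof.
case: m => n; first by rewrite ger0_norm ?ler0z//; exact: av_natr_le.
by rewrite NegzE !mulrNz avN normrN ger0_norm ?ler0n//; exact: av_natr_le.
Qed.

Lemma av_int_lb (v : absval R K) (B : R) : exists2 e : R, 0 < e &
  forall m : int, m != 0 -> `|m%:~R| <= B -> e <= v m%:~R.
Proof.
have [e e0 he] : exists2 e : R, 0 < e & forall n : nat, (0 < n <= Num.truncn B)%N -> e <= v n%:R.
  elim: (Num.truncn B) => [|k [e e0 IH]]; first by exists 1 => // n; case: n.
  exists (Num.min e (v k.+1%:R)); first by rewrite lt_min e0 av_gt0// natK0.
  move=> n /andP[n0]; rewrite leq_eqVlt => /orP[/eqP->|nk].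
    by rewrite ge_min lexx orbT.
  by rewrite ge_min IH ?n0.
exists e => // m m0 mB.
have mE : v m%:~R = v (`|m|%N)%:R.
  by case: m {m0 mB} => n //; rewrite NegzE mulrNz avN.
rewrite mE; apply: he; rewrite absz_gt0 m0/=.
rewrite truncn_ge_nat; last exact: le_trans mB.
by rewrite natr_absz intr_norm.
Qed.

Lemma pnorm_roots (C : fieldType) (v : absval R C) (r : seq C) (B : R) : 1 <= B ->
  (forall z, z \in r -> v z <= B) ->
  pnorm v (\prod_(z <- r) ('X - z%:P)) <= (2 * B) ^+ size r.
Proof.
move=> B1; elim: r => [|z r IH] h.
  rewrite big_nil expr0; apply: pnorm_le => // i; rewrite coefC.
  by case: ifP; rewrite ?av1 ?av0.
rewrite big_cons mulrC /= exprSr.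
apply: le_trans (pnormM _ _ (n := 2) _) _; first by rewrite size_XsubC.
have pX : pnorm v ('X - z%:P) <= B.
  apply: pnorm_le => [|i]; first lra.
  rewrite coefB coefX coefC; case: i => [|[|i]] /=.
  - by rewrite sub0r avN h// mem_head.
  - by rewrite subr0 av1.
  - by rewrite subr0 av0; lra.
apply: (@le_trans _ _ (2 * ((2 * B) ^+ size r * B))); last by rewrite mulrCA.
have IH' : pnorm v (\prod_(z <- r) ('X - z%:P)) <= (2 * B) ^+ size r.
  by apply: IH => u ur; rewrite h// in_cons ur orbT.
apply: ler_pM; rewrite ?mulr_ge0 ?pnorm_ge0//; first by rewrite (le_trans ler01)// avc_ge1// ler1n.
  by rewrite avc_le// ler1n.
by rewrite ler_pM ?pnorm_ge0.
Qed.

(* Constants that are harmless in the product formula: bounded by a fixed real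
   at the archimedean places and killed by a fixed integer at the others. *)
Definition adm c := (forall v, 1 <= c v) /\
  exists2 M : nat, (0 < M)%N & exists B : R, forall v : place R K,
    (av_ultra v -> c v * v M%:R <= 1) /\ (av_archimedean v -> c v <= B).

(** Every complex root of the minimal polynomial is the image of [x] under an embedding. The
    absolute value pulled back along it yields an archimedean place, so the bound at that place
    bounds the root, and the roots bound the coefficients. *)
Lemma integral_bound (B : R) : 1 <= B -> exists N : R, forall x : K,
  integral_int x -> (forall u : place R K, av_archimedean u -> u x <= B) ->
  forall q : {poly int}, ratpoly x (map_poly intr q) -> forall i, `|(q`_i)%:~R| <= N.
Proof.
move=> B1; pose d := \dim {:K}.
(* The normalized value is the usual one to a power at least 1/d, so a root has modulus at most
   B^d. *)
pose B' := B ^+ d; have B'1 : 1 <= B' by exact: exprn_ege1.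
exists ((2 * B') ^+ d) => x ix xB q qE i.
have [C [ac acE]] := complex_absval R.
set g := map_poly intr q in qE.
have [r rE] := closed_field_poly_normal (map_poly (ratr : rat -> C) g).
have gm := ratpoly_monic qE.
rewrite lead_coef_map (monicP gm) rmorph1 scale1r in rE.
have rs : (size r <= d)%N.
  have := ratpoly_size_le qE; rewrite -(size_map_poly (ratr : {rmorphism rat -> C})).
  by rewrite [X in size (X : {poly _})]rE size_prod_XsubC ltnS.
have roots z : z \in r -> ac z <= B'.
  move=> zr; have rz : root (map_poly ratr g) z by rewrite rE root_prod_XsubC.
  have [s [sx sQ s1 sD sM]] := embedding_root qE rz.
  have s0 y : y != 0 -> s y != 0.
    move=> y0; apply/eqP => sy0; have := sM y y^-1; rewrite divff// s1 sy0 mul0r.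
    by move/eqP; rewrite oner_eq0.
  have s00 : s 0 = 0 by apply: (addrI (s 0)); rewrite -sD !addr0.
  have h1 y : 0 <= ac (s y) by exact: av_ge0.
  have h2 y : ac (s y) = 0 <-> y = 0.
    split=> [/av_eq0 h|->]; last by rewrite s00 av0.
    by apply/eqP; apply: contraT => /s0; rewrite h eqxx.
  have h3 y t : ac (s (y * t)) = ac (s y) * ac (s t) by rewrite sM av_mul.
  have h4 y t : ac (s (y + t)) <= ac (s y) + ac (s t) by rewrite sD av_add.
  pose v := AbsVal h1 h2 h3 h4.
  have vQ p : v (ratr p) = `|ratr p| by rewrite /= sQ acE.
  have [u uE] := arch_place vQ; have /andP[r0 r1] := local_ratioP v.
  have uar : av_archimedean u.
    move=> ul; have := ultra_nat 2%N ul; rewrite uE.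
    have -> : v 2%:R = 2%:R by have := vQ 2%:R; rewrite !ratr_nat normr_nat.
    by rewrite leNgt powR_gt1// ltr1n.
  have := xB u uar; rewrite uE /= sx => hB.
  have [z1|z1] := leP (ac z) 1; first exact: le_trans B'1.
  have ld : (0 < local_degree v)%N by have /andP[] := local_degreeP v.
  have d0 : 0 < (d%:R : R) by rewrite ltr0n (leq_trans ld)//; have /andP[] := local_degreeP v.
  have : (ac z `^ local_ratio v) `^ d%:R <= B `^ d%:R.
    by rewrite ge0_ler_powR// ?nnegrE ?powR_ge0 ?(le_trans ler01).
  rewrite -powRrM powR_mulrn ?(le_trans ler01)// -/B' => h; apply: le_trans h.
  rewrite /local_ratio divfK ?gt_eqF// -[leLHS]powRr1 ?av_ge0//.
  by rewrite ler_powR ?(ltW z1)// ler1n.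
have -> : `|(q`_i)%:~R| = ac (map_poly ratr g)`_i :> R.
  by rewrite !coef_map/= ratr_int -(ratr_int C) acE ratr_int.
apply: le_trans (pnorm_coef _ _ _) _; rewrite rE.
apply: le_trans (pnorm_roots B'1 roots) _.
rewrite ler_weXn2l//; lra.
Qed.

Lemma place_integral (x : K) : (forall u : place R K, av_ultra u -> u x <= 1) -> integral_int x.
Proof.
move=> h; apply: contrapT => /(not_integral_absval R)[v [p [pp ul vp vx]]].
have [u uul uE] := ultra_place ul pp vp; have /andP[r0 _] := local_ratioP v.
by have := h u uul; rewrite uE leNgt powR_gt1.
Qed.

(* A weak form of the product formula: the constant term of the minimal
   polynomial of M x is a nonzero integer of bounded size divisible by M x. *)
Lemma star w c : adm c -> exists2 e : R, 0 < e & forall x : K, x != 0 ->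
  (forall v : place R K, ~ same_place v w -> v x <= c v) -> e <= w x.
Proof.
move=> [c1 [M M0 [B hB]]].
pose Bm := M%:R * Num.max B 1.
have Mr : 1 <= (M%:R : R) by rewrite ler1n.
have Bm1 : 1 <= Bm by rewrite mulr_ege1// le_max lexx orbT.
have [N hN] := integral_bound Bm1.
pose N' := Num.max N 1; have N'1 : 1 <= N' by rewrite le_max lexx orbT.
have [e0 e00 he0] := av_int_lb w N.
pose d := \dim {:K}; have d0 : 0 < (d%:R : R) by rewrite ltr0n adim_gt0.
pose D := d%:R * N' * M%:R.
have N'0 : 0 < N' := lt_le_trans ltr01 N'1.
have Mr0 : 0 < (M%:R : R) := lt_le_trans ltr01 Mr.
have D0 : 0 < D by rewrite /D !mulr_gt0.
(* The first bound makes [w (M x)] at most 1; the second contradicts the lower bound [e0] for [w] of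
   the constant term. *)
exists (Num.min M%:R^-1 (e0 / D)).
  by rewrite lt_min invr_gt0 Mr0 divr_gt0.
move=> x x0 hx; rewrite leNgt; apply/negP; rewrite lt_min => /andP[xM xe].
pose y := M%:R * x; have Mz : (M%:R : K) != 0 by rewrite natK0 -lt0n.
have y0 : y != 0 by rewrite mulf_neq0.
have wx1 : w x <= 1 by rewrite (le_trans (ltW xM))// invf_le1.
have wy : w y <= M%:R * w x by rewrite av_mul ler_wpM2r ?av_ge0 ?av_natr_le.
have wy1 : w y <= 1.
  by rewrite (le_trans wy)// mulrC -ler_pdivlMr// div1r ltW.
(* Places equivalent to [w] are not covered by the bounds on [x]; there the assumed smallness of
   [w x] is used. *)
have sameP (u : place R K) : same_place u w -> u x <= 1.
  move=> [s [s0 us]]; rewrite us; have -> : 1 = (1 : R) `^ s by rewrite powR1.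
  by rewrite ge0_ler_powR ?nnegrE ?av_ge0// ltW.
have iy : integral_int y.
  apply: place_integral => u uul; rewrite av_mul.
  have [su|nsu] := pselect (same_place u w).
    by rewrite mulr_ile1 ?av_ge0 ?ultra_nat ?sameP.
  rewrite mulrC; apply: le_trans ((hB u).1 uul).
  by rewrite ler_wpM2r ?av_ge0 ?hx.
have yB (u : place R K) : av_archimedean u -> u y <= Bm.
  move=> uar; rewrite av_mul ler_pM ?av_ge0 ?av_natr_le// le_max.
  have [su|nsu] := pselect (same_place u w); first by rewrite sameP ?orbT.
  by rewrite (le_trans (hx u nsu)) ?(hB u).2.
have [g gE] := ratpoly_ex y; have [q qE] := ratpoly_int gE iy.
rewrite qE in gE; have qN := hN y iy yB q gE.
have sq : size q = size (minPoly 1%AS y).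
  by rewrite -gE size_map_poly size_rat_int_poly.
have rq : root (map_poly intr q) y.
  have := root_minPoly 1%AS y; rewrite -gE -map_poly_comp.
  by rewrite (eq_map_poly (g := intr))// => m /=; exact: (rmorph_int (in_alg K)).
have s1 : (1 < size q)%N by rewrite sq -gE size_map_poly; exact: ratpoly_size gE.
have sd : ((size q).-1 <= d)%N.
  by rewrite -ltnS prednK ?(ltnW s1)// sq -gE size_map_poly; exact: ratpoly_size_le gE.
have q0 : q`_0 != 0.
  apply/eqP => q0; have X1 : 'X %| minPoly 1%AS y.
    rewrite -[X in X %| _]subr0 dvdp_XsubCl rootE horner_coef0 -gE !coef_map q0 /=.
    by rewrite mulr0z scale0r.
  have := minPoly_irr (polyOverX _) X1; rewrite -size_poly_eq1 size_polyX orbF.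
  move=> /eqp_root/(_ y); rewrite root_minPoly rootX => yz.
  by rewrite yz in y0.
have : w (q`_0)%:~R <= d%:R * (N' * w y).
  have [k qs] : exists k, size q = k.+2 by case: (size q) s1 => [|[|k]]// _; exists k.
  have := rootP rq; rewrite (@horner_coef_wide _ (size q)) ?size_poly//.
  rewrite qs big_ord_recl/= expr0 mulr1 coef_map/= => /eqP.
  rewrite addr_eq0 => /eqP ->; rewrite avN.
  have b0 : 0 <= N' * w y by rewrite mulr_ge0 ?av_ge0 ?(le_trans ler01).
  apply: le_trans (av_sum (b := N' * w y) b0 _) _.
    move=> i _; rewrite coef_map/= av_mul ler_pM ?av_ge0//.
      by rewrite (le_trans (av_intr_le _ _))// le_max qN.
    by rewrite avX exprS ler_piMr ?av_ge0// exprn_ile1 ?av_ge0.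
  rewrite ler_wpM2r// card_ord; apply: le_trans (avc_le _ _) _; first by rewrite ler1n.
  by rewrite ler_nat (leq_trans _ sd)// qs.
have := he0 _ q0 (qN 0%N) => /le_trans h /h{h}.
rewrite leNgt => /negP; apply.
apply: (@le_lt_trans _ _ (d%:R * (N' * (M%:R * w x)))).
  by rewrite !ler_wpM2l// ?(le_trans ler01)// ltW.
by rewrite !mulrA -/D mulrC -ltr_pdivlMr.
Qed.

End Star.

(** * Calculus of admissible constants *)

Section Adm.
Context {R : realType} {K : fieldExtType rat}.
Implicit Types (c : place R K -> R) (v : place R K).

Lemma adm_avc B : 1 <= B -> adm (fun v => avc v B).
Proof.
move=> B1; split=> [v|]; first exact: avc_ge1.
exists 1%N => //; exists B => v; split=> h; first by rewrite avc_ultra// mul1r av1.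
by rewrite avc_arch.
Qed.

Lemma adm1 : adm (fun _ : place R K => 1).
Proof.
split=> [v//|]; exists 1%N => //; exists 1 => v; split=> // _.
by rewrite av1 mulr1.
Qed.

Lemma admM c c' : adm c -> adm c' -> adm (fun v => c v * c' v).
Proof.
move=> [c1 [M M0 [B hB]]] [c1' [M' M0' [B' hB']]]; split=> [v|].
  by rewrite mulr_ege1.
have cp v : 0 <= c v := le_trans ler01 (c1 v).
have cp' v : 0 <= c' v := le_trans ler01 (c1' v).
exists (M * M')%N; first by rewrite muln_gt0 M0.
exists (B * B') => v; split=> h.
  rewrite natrM av_mul mulrACA -[leRHS]mulr1.
  by rewrite ler_pM ?mulr_ge0 ?av_ge0 ?(hB v).1 ?(hB' v).1.
by rewrite ler_pM ?(hB v).2 ?(hB' v).2.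
Qed.

Lemma admX c k : adm c -> adm (fun v => c v ^+ k).
Proof.
move=> hc; elim: k => [|k IH].
  by under eq_fun do rewrite expr0; exact: adm1.
by under eq_fun do rewrite exprS; exact: admM.
Qed.

Lemma adm_ge0 c v : adm c -> 0 <= c v.
Proof. by move=> [h _]; exact: le_trans ler01 (h v). Qed.

Lemma adm_ge1 c v : adm c -> 1 <= c v.
Proof. by move=> [h _]. Qed.

Lemma place_arch_int v (m : int) : av_archimedean v -> m != 0 -> 1 <= v m%:~R.
Proof.
move=> ar m0; have [_ /(_ ar m%:~R)] := place_normalized v.
rewrite !ratr_int => ->; rewrite -intr_norm.
have h : 1 <= (`|m|%:~R : R) by rewrite ler1z -gtz0_ge1 normr_gt0.
have /andP[r0 _] := local_ratioP v.
apply: (@le_trans _ _ (1 `^ local_ratio v)); first by rewrite powR1.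
by apply: (ge0_ler_powR (ltW r0)); rewrite ?nnegrE ?(le_trans ler01 h).
Qed.

(** Let l be the leading coefficient of an integer relation for [x]. Dividing the relation by a
    power of v(x) bounds v(l x) by the other coefficients: l clears the denominators at ultrametric
    places, and at archimedean ones, where v(l) is at least 1, this is Cauchy's root bound. *)
Lemma adm_el (x : K) : adm (fun v => Num.max 1 (v x)).
Proof.
split=> [v|]; first by rewrite le_max lexx.
have [g gE] := ratpoly_ex x; have [f [a a0 fE]] := rat_poly_scale g.
have g0 : g != 0 := monic_neq0 (ratpoly_monic gE).
have f0 : f != 0 by apply/eqP => f0; move: g0; rewrite fE f0 map_poly0 scaler0 eqxx.
have rf : root (map_poly intr f) x.
  have : root (map_poly (in_alg K) g) x by rewrite gE root_minPoly.
  rewrite fE map_polyZ/= rootZ; last by rewrite scaler_eq0 oner_eq0 orbF invr_eq0 intr_eq0.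
  rewrite -map_poly_comp (eq_map_poly (g := intr))// => m /=; exact: (rmorph_int (in_alg K)).
have sf : size f = (size f).-1.+1 by rewrite prednK// size_poly_gt0.
set k := (size f).-1 in sf; set l : int := f`_k.
have k0 : (0 < k)%N.
  have sfg : size f = size g by rewrite fE size_scale ?invr_eq0 ?intr_eq0// size_rat_int_poly.
  by rewrite -ltnS -sf sfg; exact: ratpoly_size gE.
have l0 : l != 0 by rewrite /l /k -lead_coefE lead_coef_eq0.
have rel v (b : R) : (forall i : 'I_k, v (f`_i)%:~R <= b) -> 1 <= v x ->
    v l%:~R * v x ^+ k <= avc v k%:R * (b * v x ^+ k.-1).
  move=> hb vx1; rewrite -avX -av_mul.
  have := rootP rf; rewrite (@horner_coef_wide _ (size f)) ?size_poly//.
  rewrite sf big_ord_recr/= coef_map/= addrC => /eqP; rewrite addr_eq0 => /eqP ->.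
  rewrite avN -[k in avc v k%:R]card_ord.
  apply: av_sum => [|i _].
    by rewrite mulr_ge0 ?exprn_ge0 ?av_ge0// (le_trans _ (hb (Ordinal k0)))// av_ge0.
  rewrite coef_map/= av_mul; apply: ler_pM; rewrite ?av_ge0//; first exact: hb.
  by rewrite avX ler_weXn2l// -ltnS prednK.
have vabs v : v (`|l|%N)%:R = v l%:~R.
  by case: (l) => m //; rewrite NegzE mulrNz avN.
exists `|l|%N; first by rewrite absz_gt0.
pose S : R := \sum_(i < k) `|(f`_i)%:~R|.
have S0 : 0 <= S by apply: sumr_ge0.
have hS v (i : 'I_k) : v (f`_i)%:~R <= S.
  apply: le_trans (av_intr_le _ _) _; rewrite /S (bigD1 i)//= lerDl.
  by apply: sumr_ge0.
exists (Num.max 1 (k%:R * S)) => v; split=> [ul|ar].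
  rewrite vabs; have [vx|vx] := leP (v x) 1.
    by rewrite mul1r -vabs ultra_nat.
  have hi (i : 'I_k) : v (f`_i)%:~R <= 1.
    by case: (f`_i) => m; [exact: ultra_nat|rewrite NegzE mulrNz avN; exact: ultra_nat].
  have := rel v 1 hi (ltW vx); rewrite avc_ultra// !mul1r -[in v x ^+ k](prednK k0) exprS mulrA.
  rewrite -ler_pdivlMr ?exprn_gt0 ?(lt_trans ltr01 vx)// divff ?gt_eqF ?exprn_gt0 ?(lt_trans ltr01 vx)//.
  by rewrite mulrC.
have [vx|vx] := leP (v x) 1; first by rewrite le_max lexx.
have vx0 : 0 < v x := lt_trans ltr01 vx.
rewrite le_max; apply/orP; right.
have := rel v S (hS v) (ltW vx); rewrite avc_arch// -[in v x ^+ k](prednK k0) exprS !mulrA.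
rewrite ler_pM2r ?exprn_gt0//; apply: le_trans.
by rewrite ler_peMl ?(ltW vx0)// place_arch_int.
Qed.

Lemma adm_seq (r : seq K) : exists2 c, adm c & forall v x, x \in r -> v x <= c v.
Proof.
elim: r => [|x r [c hc IH]]; first by exists (fun=> 1); [exact: adm1|].
exists (fun v => c v * Num.max 1 (v x)); first by apply: admM => //; exact: adm_el.
move=> v y; rewrite in_cons => /orP[/eqP->|/IH/le_trans]; last first.
  by apply; rewrite ler_peMr ?(adm_ge0 _ hc)// le_max lexx.
apply: (@le_trans _ _ (Num.max 1 (v x))); first by rewrite le_max lexx orbT.
by rewrite ler_peMl ?(adm_ge1 _ hc)// le_max ler01.
Qed.

Lemma adm_fam (I : finType) (f : I -> K) : exists2 c, adm c & forall v i, v (f i) <= c v.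
Proof.
have [c hc h] := adm_seq (codom f); exists c => // v i.
by apply: h; exact: codom_f.
Qed.

Lemma adm_pnorm_fam (I : finType) (f : I -> {poly K}) :
  exists2 c, adm c & forall v i, pnorm v (f i) <= c v.
Proof.
have [N hN] : exists N, forall i, (size (f i) <= N)%N.
  by exists (\max_i size (f i)) => i; exact: leq_bigmax.
have [c hc h] := adm_fam (fun ij : I * 'I_N => (f ij.1)`_ij.2); exists c => // v i.
apply: pnorm_le => [|j]; first exact: adm_ge0.
have [jN|Nj] := ltnP j N; first exact: (h v (i, Ordinal jN)).
by rewrite nth_default ?(leq_trans (hN i))// av0; exact: adm_ge0.
Qed.

Lemma adm_lin (I : finType) (f : I -> {linear {poly K} -> {poly K}}) (N : nat) :
  exists2 c, adm c & forall v i (P : {poly K}), (size P <= N)%N -> pnorm v (f i P) <= c v * pnorm v P.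
Proof.
have [N0|N0] := posnP N.
  exists (fun=> 1); first exact: adm1.
  move=> v i P; rewrite N0 leqn0 size_poly_eq0 => /eqP->.
  by rewrite raddf0 mul1r.
have [c hc h] := adm_pnorm_fam (fun ij : I * 'I_N => f ij.1 'X^(ij.2)).
have N1 : 1 <= (N%:R : R) by rewrite ler1n.
exists (fun v => avc v N%:R * c v); first by apply: admM => //; exact: adm_avc.
move=> v i P sP; rewrite -mulrA.
have -> : f i P = \sum_(j < N) P`_j *: f i 'X^j.
  rewrite -[P in LHS](poly_rV_K sP) /rVpoly poly_def linear_sum.
  by apply: eq_bigr => j _; rewrite linearZ/= valK mxE.
apply: pnorm_le => [|j].
  by rewrite !mulr_ge0 ?pnorm_ge0 ?(adm_ge0 _ hc)// (le_trans ler01)// avc_ge1.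
rewrite coef_sum -[N in avc v N%:R]card_ord; apply: av_sum => [|k _].
  by rewrite mulr_ge0 ?pnorm_ge0 ?(adm_ge0 _ hc).
rewrite coefZ av_mul mulrC ler_pM ?av_ge0 ?pnorm_coef//.
by apply: le_trans (pnorm_coef _ _ _) _; exact: (h v (i, k)).
Qed.

End Adm.

(** * Affine translates and the invariant pairing *)

Section Affine.
Context {F : fieldType} (a c : F).

Definition aff (k : nat) : {poly F} := iter k (fun q => q \Po (a *: 'X + c%:P)) 'X.

Lemma affS k : aff k.+1 = aff k \Po (a *: 'X + c%:P). Proof. by []. Qed.

Lemma affD k l : aff (k + l) = aff k \Po aff l.
Proof.
by elim: l => [|l IH]; rewrite ?addn0 ?comp_polyXr// addnS !affS IH comp_polyA.
Qed.

Lemma affE k : exists b, aff k = a ^+ k *: 'X + b%:P.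
Proof.
elim: k => [|k [b IH]]; first by exists 0; rewrite expr0 scale1r addr0.
exists (a ^+ k * c + b); rewrite affS IH comp_polyD comp_polyZ comp_polyX comp_polyC.
by rewrite scalerDr scalerA -exprSr -[_ *: c%:P]mul_polyC -polyCM -addrA -polyCD.
Qed.

Definition sh k (P : {poly F}) := P \Po aff k.

Lemma shD k l P : sh (k + l) P = sh l (sh k P).
Proof. by rewrite /sh affD comp_polyA. Qed.

Lemma shM k P Q : sh k (P * Q) = sh k P * sh k Q.
Proof. exact: rmorphM. Qed.

Lemma shZ k b P : sh k (b *: P) = b *: sh k P.
Proof. exact: comp_polyZ. Qed.

Lemma sh_sum k (I : Type) (r : seq I) (p : pred I) (f : I -> {poly F}) :
  sh k (\sum_(i <- r | p i) f i) = \sum_(i <- r | p i) sh k (f i).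
Proof. exact: raddf_sum. Qed.

Lemma sh0 P : sh 0 P = P.
Proof. exact: comp_polyXr. Qed.

Lemma horner_sh (L : fieldType) (i : {rmorphism F -> L}) (x : nat -> L) k p (P : {poly F}) :
  (forall q, x q.+1 = i a * x q + i c) ->
  (map_poly i (sh k P)).[x p] = (map_poly i P).[x (p + k)%N].
Proof.
move=> hx; rewrite map_comp_poly horner_comp; congr (_.[_]).
elim: k p => [|k IH] p; first by rewrite map_polyX hornerX addn0.
rewrite affS map_comp_poly horner_comp rmorphD/= map_polyZ/= map_polyX map_polyC/=.
by rewrite hornerD hornerZ hornerX hornerC -hx IH addSnnS.
Qed.

Hypothesis a0 : a != 0.

Lemma size_aff k : size (aff k) = 2.
Proof.
have [b ->] := affE k.
by rewrite size_polyDl size_scale ?expf_neq0 ?size_polyX// (leq_ltn_trans (size_polyC_leq1 _)).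
Qed.

Lemma size_sh k P : size (sh k P) = size P.
Proof. by rewrite /sh size_comp_poly2 ?size_aff. Qed.

Lemma sh_eq0 k P : (sh k P == 0) = (P == 0).
Proof. by rewrite -!size_poly_eq0 size_sh. Qed.

Lemma aff_inv k : exists2 q : {poly F}, aff k \Po q = 'X & q \Po aff k = 'X.
Proof.
have [b ->] := affE k; have ak : a ^+ k != 0 by rewrite expf_neq0.
exists ((a ^+ k)^-1 *: ('X - b%:P)).
  rewrite comp_polyD comp_polyZ comp_polyX comp_polyC scalerA divff// scale1r.
  by rewrite subrK.
by rewrite comp_polyZ comp_polyB comp_polyX comp_polyC addrK scalerA mulVf// scale1r.
Qed.

Lemma sh_surj k P : exists Q, sh k Q = P.
Proof.
have [q _ h2] := aff_inv k; exists (P \Po q).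
by rewrite /sh -comp_polyA h2 comp_polyXr.
Qed.

Lemma sh_dvdp k P Q : (sh k P %| sh k Q) = (P %| Q).
Proof.
apply/idP/idP => [/dvdpP[u E]|/dvdpP[u ->]]; last by rewrite /sh rmorphM/= dvdp_mull.
have [q h1 _] := aff_inv k; apply/dvdpP; exists (u \Po q).
have := congr1 (comp_poly q) E; rewrite rmorphM/= /sh -!comp_polyA h1 !comp_polyXr.
by [].
Qed.

Lemma sh_eqp k P Q : (sh k P %= sh k Q) = (P %= Q).
Proof. by rewrite /eqp !sh_dvdp. Qed.

Lemma sh_irr k P : irreducible_poly P -> irreducible_poly (sh k P).
Proof.
move=> [s1 irr]; split=> [|q sq dq]; first by rewrite size_sh.
have [q' qE] := sh_surj k q; move: sq dq; rewrite -qE size_sh sh_dvdp sh_eqp.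
exact: irr.
Qed.

End Affine.

Section Pairing.
Context {F : fieldType} (a c : F) (n : nat) (lam : F) (chi : {poly F}).
Local Notation s := (sh a c).
Hypothesis a0 : a != 0.
Hypothesis A : forall P : {poly F}, (size P <= n.+1)%N -> \sum_(k < n.+2) chi`_k *: s k P = 0.
Hypothesis B : forall P : {poly F}, (size P <= n.+1)%N ->
  \sum_(l < n.+2) (chi`_(n.+1 - l) * lam ^+ l) *: s l P = 0.

(** A triangular Toeplitz kernel made from the coefficients of [chi], twisted by [lam ^+ l] so that
    moving both indices by one amounts to applying [lam] times the shift. *)
Definition pterm (P Q : {poly F}) k l :=
  (if (k <= l)%N then chi`_(n.+1 + k - l) * lam ^+ l else 0) *: (s k P * s l Q).

Definition pair (P Q : {poly F}) := \sum_(k < n.+1) \sum_(l < n.+1) pterm P Q k l.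

(* Both sides are the double sum over 0 <= k <= l <= n + 1: the extra row and
   column vanish by hypotheses A and B. *)
Lemma pair_inv (P Q : {poly F}) : (size P <= n.+1)%N -> (size Q <= n.+1)%N ->
  lam *: s 1 (pair P Q) = pair P Q.
Proof.
move=> sP sQ.
have shift k l : lam *: s 1 (pterm P Q k l) = pterm P Q k.+1 l.+1.
  rewrite /pterm ltnS shZ shM -!shD !addn1.
  rewrite scalerA; case: ifP => _; last by rewrite mulr0.
  by rewrite addnS subSS exprS; congr (_ *: _); ring.
transitivity (\sum_(k < n.+2) \sum_(l < n.+2) pterm P Q k l).
  rewrite big_ord_recl/= (_ : \sum_(l < n.+2) pterm P Q 0 l = 0) ?add0r; last first.
    have := congr1 (fun z => P * z) (B sQ); rewrite mulr0 mulr_sumr => E0.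
    by rewrite -[RHS]E0; apply: eq_bigr => l _; rewrite /pterm/= addn0 sh0 scalerAr.
  rewrite /pair sh_sum scaler_sumr; apply: eq_bigr => k _.
  rewrite [in RHS]big_ord_recl [X in _ = X + _](_ : _ = 0) ?add0r; last first.
    by rewrite /pterm /= /bump leq0n scale0r.
  by rewrite sh_sum scaler_sumr; apply: eq_bigr => l _; rewrite shift.
rewrite (eq_bigr (fun k : 'I_n.+2 => \sum_(l < n.+1) pterm P Q k l + pterm P Q k n.+1)); last first.
  by move=> k _; rewrite big_ord_recr.
rewrite big_split/= [X in _ + X](_ : _ = 0) ?addr0.
  rewrite big_ord_recr/= [X in _ + X]big1 ?addr0// => l _.
  by rewrite /pterm leqNgt ltn_ord scale0r.
have := congr1 (fun z => (lam ^+ n.+1 *: s n.+1 Q) * z) (A sP); rewrite mulr0 mulr_sumr => E0.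
rewrite -[RHS]E0; apply: eq_bigr => k _.
rewrite /pterm -ltnS ltn_ord addKn -scalerAr -scalerAl scalerA.
by rewrite [s n.+1 Q * _]mulrC.
Qed.

Lemma pair_bilin (P Q : {poly F}) : (size P <= n.+1)%N -> (size Q <= n.+1)%N ->
  pair P Q = \sum_(i < n.+1) \sum_(j < n.+1) (P`_i * Q`_j) *: pair 'X^i 'X^j.
Proof.
move=> sP sQ.
have E (T : {poly F}) : (size T <= n.+1)%N -> T = \sum_(i < n.+1) T`_i *: 'X^i.
  by move=> sT; rewrite -[T in LHS](poly_rV_K sT) /rVpoly poly_def; apply: eq_bigr => i _; rewrite valK mxE.
have ts k l : pterm P Q k l = \sum_(i < n.+1) \sum_(j < n.+1) (P`_i * Q`_j) *: pterm 'X^i 'X^j k l.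
  rewrite /pterm {1}(E P sP) {1}(E Q sQ) !sh_sum mulr_suml scaler_sumr.
  apply: eq_bigr => i _; rewrite mulr_sumr scaler_sumr; apply: eq_bigr => j _.
  by rewrite !shZ -scalerAl -scalerAr !scalerA; congr (_ *: _); ring.
rewrite {1}/pair.
under eq_bigr => k _ do under eq_bigr => l _ do rewrite ts.
under eq_bigr => k _ do rewrite exchange_big/=.
rewrite exchange_big/=; apply: eq_bigr => i _.
under eq_bigr => k _ do rewrite exchange_big/=.
rewrite exchange_big/=; apply: eq_bigr => j _.
by rewrite scaler_sumr; apply: eq_bigr => k _; rewrite scaler_sumr.
Qed.

Lemma pair_horner (L : fieldType) (i : {rmorphism F -> L}) (x : nat -> L) (P Q : {poly F}) :
  (forall q, x q.+1 = i a * x q + i c) ->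
  (map_poly i (pair P Q)).[x 0%N] = \sum_(k < n.+1) \sum_(l < n.+1)
    (map_poly i P).[x k] * (if (k <= l)%N then i (chi`_(n.+1 + k - l) * lam ^+ l) else 0)
    * (map_poly i Q).[x l].
Proof.
move=> hx; rewrite rmorph_sum/= horner_sum; apply: eq_bigr => k _.
rewrite rmorph_sum/= horner_sum; apply: eq_bigr => l _.
rewrite /pterm map_polyZ/= hornerZ rmorphM/= hornerM !(horner_sh _ _ _ hx) !add0n.
by case: ifP => _; rewrite ?rmorph0; ring.
Qed.

End Pairing.

(* The same bilinear form in coordinates: g on coefficients, u on the values
   along the orbit x. *)
Definition tri_pairing (F L : fieldType) (i : {rmorphism F -> L}) (n : nat)
    (x : nat -> L) (g : nat -> nat -> F) (u : nat -> nat -> L) :=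
  [/\ forall k l, (l < k)%N -> u k l = 0, forall k, u k k != 0 &
    forall P Q : {poly F}, (size P <= n.+1)%N -> (size Q <= n.+1)%N ->
      i (\sum_(a < n.+1) \sum_(b < n.+1) P`_a * Q`_b * g a b) =
      \sum_(k < n.+1) \sum_(l < n.+1) (map_poly i P).[x k] * u k l * (map_poly i Q).[x l]].

Section Additive.
Context {F : fieldType}.

Lemma aff_add (gam : F) k : aff 1 gam k = 'X + (gam *+ k)%:P.
Proof.
elim: k => [|k IH]; first by rewrite mulr0n addr0.
rewrite affS IH comp_polyD comp_polyX comp_polyC scale1r -addrA -polyCD.
by rewrite mulrS.
Qed.

Lemma size_sh_sub (gam : F) (P : {poly F}) N : (size P <= N.+1)%N ->
  (size (sh 1 gam 1 P - P)%R <= N)%N.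
Proof.
move=> sP; have [->|P0] := eqVneq P 0.
  by rewrite /sh comp_poly0 subrr size_poly0.
apply/leq_sizeP => j; rewrite leq_eqVlt => /orP[/eqP<-|Nj]; last first.
  by rewrite coefB !nth_default ?subrr ?size_sh ?oner_neq0// (leq_trans sP).
have [sPN|sPN] := leqP (size P) N.
  by rewrite coefB !nth_default ?subrr ?size_sh ?oner_neq0.
have sE : size P = N.+1 by apply/eqP; rewrite eqn_leq sP sPN.
have lP : P`_N = lead_coef P by rewrite lead_coefE sE.
have lsP : (sh 1 gam 1 P)`_N = lead_coef (sh 1 gam 1 P).
  by rewrite lead_coefE size_sh ?oner_neq0// sE.
rewrite coefB lP lsP /sh aff_add lead_coef_comp; last first.
  by rewrite size_polyDl ?size_polyX// (leq_ltn_trans (size_polyC_leq1 _)).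
rewrite lead_coefDl ?lead_coefX ?size_polyX ?(leq_ltn_trans (size_polyC_leq1 _))//.
by rewrite expr1n mulr1 subrr.
Qed.

(** The sum is the N-th difference of [P], and each difference lowers the degree. *)
Lemma diff_vanish (gam : F) N : forall P : {poly F}, (size P <= N)%N ->
  \sum_(k < N.+1) (('X - 1) ^+ N)`_k *: sh 1 gam k P = 0.
Proof.
elim: N => [|N IH] P sP.
  move: sP; rewrite leqn0 size_poly_eq0 => /eqP ->; apply: big1 => k _.
  by rewrite /sh comp_poly0 scaler0.
have := IH _ (size_sh_sub gam sP); set q := ('X - 1) ^+ N => E.
have sq : q`_N.+1 = 0.
  by rewrite nth_default// /q -polyC1 size_exp_XsubC.
have cE k : (('X - 1) ^+ N.+1)`_k = (if (k == 0)%N then 0 else q`_k.-1) - q`_k.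
  by rewrite exprSr mulrBr mulr1 coefB coefMX.
under eq_bigr => k _ do rewrite cE scalerBl.
rewrite sumrB big_ord_recl/= scale0r add0r [X in _ - X]big_ord_recr/= sq scale0r addr0.
rewrite -sumrB -[RHS]E; apply: eq_bigr => k _.
rewrite /bump leq0n add1n -scalerBr; congr (_ *: _).
by rewrite -[X in sh _ _ X]add1n shD /sh rmorphB.
Qed.

(** Reversing the coefficients amounts to taking the N-th difference with step [- gam] and
    translating the result by N steps of [gam]. *)
Lemma diff_vanish_rev (gam : F) N (P : {poly F}) : (size P <= N)%N ->
  \sum_(l < N.+1) (('X - 1) ^+ N)`_(N - l) *: sh 1 gam l P = 0.
Proof.
move=> sP; rewrite (reindex_inj rev_ord_inj)/=.
have := congr1 (sh 1 gam N) (diff_vanish (- gam) sP).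
rewrite sh_sum [sh _ _ _ 0]comp_poly0 => E; rewrite -[RHS]E; apply: eq_bigr => k _.
have kN : (k <= N)%N by rewrite -ltnS.
rewrite subSS subKn// shZ; congr (_ *: _).
rewrite /sh !aff_add -comp_polyA comp_polyD comp_polyX comp_polyC -addrA -polyCD.
by rewrite mulNrn -mulrnBr.
Qed.

Lemma translation_invariant_const (gam : F) (W : {poly F}) :
  (forall k : nat, (k.+1)%:R != 0 :> F) -> gam != 0 -> sh 1 gam 1 W = W -> exists e, W = e%:P.
Proof.
move=> ch g0 hW; exists W.[0].
apply/eqP; rewrite -subr_eq0; apply/negPn/negP => p0.
set p := W - _ in p0.
have hk k : W.[gam *+ k] = W.[0].
  elim: k => [|k IH]; first by rewrite mulr0n.
  rewrite -IH -[in RHS]hW /sh aff_add horner_comp hornerD hornerX hornerC mulr1n.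
  by rewrite mulrSr.
have inj : injective (fun k : nat => gam *+ k).
  have aux k l : (k < l)%N -> gam *+ k <> gam *+ l.
    move=> kl /eqP; rewrite eq_sym -subr_eq0 -mulrnBr ?(ltnW kl)// -mulr_natr mulf_eq0 (negbTE g0)/=.
    by rewrite -(prednK (_ : 0 < l - k)%N) ?subn_gt0// (negbTE (ch _)).
  by move=> k l e; have [/aux|/aux h|//] := ltngtP k l => //; case: h.
have := max_poly_roots (p := p) (rs := [seq gam *+ k | k <- iota 0 (size p)]) p0.
rewrite size_map size_iota ltnn => h; suff : false by []; apply: h.
- by apply/allP => _ /mapP[k _ ->]; rewrite rootE /p hornerD hornerN hornerC hk subrr.
- by rewrite map_inj_uniq ?iota_uniq.
Qed.

Lemma additive_pairing (L : fieldType) (i : {rmorphism F -> L}) n (x : nat -> L) (gam : F) :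
  (forall k : nat, (k.+1)%:R != 0 :> F) -> gam != 0 ->
  (forall q, x q.+1 = i 1 * x q + i gam) ->
  exists g u, tri_pairing i n x g u.
Proof.
move=> ch g0 hx; pose chi : {poly F} := ('X - 1) ^+ n.+1.
have A (P : {poly F}) : (size P <= n.+1)%N -> \sum_(k < n.+2) chi`_k *: sh 1 gam k P = 0 by exact: diff_vanish.
have B (P : {poly F}) : (size P <= n.+1)%N ->
    \sum_(l < n.+2) (chi`_(n.+1 - l) * 1 ^+ l) *: sh 1 gam l P = 0.
  by move=> sP; under eq_bigr => l _ do rewrite expr1n mulr1; exact: diff_vanish_rev.
pose g (a b : nat) : F := (pair 1 gam n 1 chi 'X^a 'X^b)`_0.
pose u (k l : nat) : L := if (k <= l)%N then i (chi`_(n.+1 + k - l) * 1 ^+ l) else 0.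
exists g, u; split=> [k l lk|k|P Q sP sQ].
- by rewrite /u leqNgt lk.
- rewrite /u leqnn addnK expr1n mulr1 fmorph_eq0 /chi.
  have : lead_coef (('X - 1 : {poly F}) ^+ n.+1) = 1.
    by rewrite lead_coef_exp -polyC1 lead_coefXsubC expr1n.
  by rewrite lead_coefE -polyC1 size_exp_XsubC/= => ->; exact: oner_neq0.
(* With [lam = 1] the pairing is a translation-invariant polynomial, hence a constant, and so a
   scalar-valued form. *)
- have [e We] : exists e, pair 1 gam n 1 chi P Q = e%:P.
    apply: (translation_invariant_const ch g0).
    by rewrite -[RHS](pair_inv A B sP sQ) scale1r.
  have := pair_horner n 1 chi P Q hx; rewrite We map_polyC hornerC => <-.
  have := congr1 (fun W : {poly F} => W`_0) (pair_bilin 1 gam 1 chi sP sQ).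
  rewrite We coefC eqxx /= => ->; congr (i _); rewrite coef_sum; apply: eq_bigr => a _.
  by rewrite coef_sum; apply: eq_bigr => b _; rewrite coefZ.
Qed.

End Additive.

Section Multiplicative.
Context {F : fieldType}.

Lemma aff_mul (gam : F) k : aff gam 0 k = gam ^+ k *: 'X.
Proof.
elim: k => [|k IH]; first by rewrite expr0 scale1r.
by rewrite affS IH comp_polyZ comp_polyX addr0 scalerA -exprSr.
Qed.

Lemma coef_sh_mul (gam : F) k (P : {poly F}) b : (sh gam 0 k P)`_b = gam ^+ (k * b) * P`_b.
Proof.
rewrite /sh aff_mul comp_polyE coef_sum.
have -> : \sum_(j < size P) (P`_j *: (gam ^+ k *: 'X) ^+ j)`_b =
    \sum_(j < size P | j == b :> nat) gam ^+ (k * b) * P`_b.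
  rewrite [RHS]big_mkcond/=; apply: eq_bigr => j _.
  rewrite exprZn !coefZ coefXn -exprM eq_sym; case: eqP => [->|_]; last by rewrite !mulr0.
  by rewrite mulr1 mulrC.
have [bP|Pb] := ltnP b (size P); first by rewrite (big_pred1 (Ordinal bP)).
rewrite nth_default ?mulr0//; apply: big1 => j /eqP jb.
have := ltn_ord j; rewrite jb => h. by have := leq_ltn_trans Pb h; rewrite ltnn.
Qed.

Lemma multiplicative_pairing (L : fieldType) (i : {rmorphism F -> L}) n (x : nat -> L) (gam : F) :
  gam != 0 -> (forall k : nat, (1 <= k <= n)%N -> gam ^+ k != 1) -> x 0%N != 0 ->
  (forall q, x q.+1 = i gam * x q + i 0) ->
  exists g u, tri_pairing i n x g u.
Proof.
move=> g0 g1 x0 hx; pose chi : {poly F} := \prod_(k < n.+1) ('X - (gam ^+ k)%:P).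
(* With this [lam] the reversed sum in [B] evaluates [chi] at (lam gam^b)^-1 = gam^(n-b), again one
   of its roots. *)
pose lam := (gam ^+ n)^-1.
have gn k : gam ^+ k != 0 by rewrite expf_neq0.
have lam0 : lam != 0 by rewrite invr_eq0.
have schi : size chi = n.+2.
  have -> : chi = \prod_(k <- enum 'I_n.+1) ('X - (gam ^+ k)%:P) by rewrite big_enum.
  by rewrite size_prod_XsubC size_enum_ord.
have chi_root (b : nat) : (b <= n)%N -> chi.[gam ^+ b] = 0.
  move=> bn; apply/eqP; rewrite horner_prod; apply/prodf_eq0.
  by exists (inord b) => //; rewrite hornerXsubC inordK ?ltnS// subrr.
have chi_sum z : \sum_(k < n.+2) chi`_k * z ^+ k = chi.[z].
  by rewrite -schi -horner_coef.
have chi1 : chi`_n.+1 = 1.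
  have : lead_coef chi = 1 by apply/eqP/monic_prod_XsubC.
  by rewrite lead_coefE schi.
have A (P : {poly F}) : (size P <= n.+1)%N -> \sum_(k < n.+2) chi`_k *: sh gam 0 k P = 0.
  move=> sP; apply/polyP => b; rewrite coef0 coef_sum.
  have [bn|nb] := leqP b n; last first.
    by apply: big1 => k _; rewrite coefZ [(sh _ _ _ _)`_b]nth_default ?mulr0// size_sh// (leq_trans sP).
  under eq_bigr => k _ do rewrite coefZ coef_sh_mul mulrA mulnC exprM.
  by rewrite -mulr_suml chi_sum chi_root// mul0r.
have B (P : {poly F}) : (size P <= n.+1)%N ->
    \sum_(l < n.+2) (chi`_(n.+1 - l) * lam ^+ l) *: sh gam 0 l P = 0.
  move=> sP; apply/polyP => b; rewrite coef0 coef_sum.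
  have [bn|nb] := leqP b n; last first.
    by apply: big1 => k _; rewrite coefZ [(sh _ _ _ _)`_b]nth_default ?mulr0// size_sh// (leq_trans sP).
  pose mu := lam * gam ^+ b; have mu0 : mu != 0 by rewrite mulf_neq0.
  have muV : mu^-1 = gam ^+ (n - b).
    by rewrite /mu /lam invfM invrK -{1}(subnK bn) exprD mulfK.
  rewrite (reindex_inj rev_ord_inj)/=.
  rewrite (eq_bigr (fun k : 'I_n.+2 => (chi`_k * mu^-1 ^+ k) * (mu ^+ n.+1 * P`_b))).
    by rewrite -mulr_suml chi_sum muV chi_root ?leq_subr// mul0r.
  move=> k _; have kn : (k <= n.+1)%N by rewrite -ltnS.
  rewrite coefZ coef_sh_mul subSS subKn// mulnC exprM.
  have -> : mu ^+ n.+1 = mu ^+ (n.+1 - k) * mu ^+ k by rewrite -exprD subnK.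
  have -> : mu ^+ (n.+1 - k) = lam ^+ (n.+1 - k) * gam ^+ b ^+ (n.+1 - k) by rewrite -exprMn.
  have mk : mu ^+ k != 0 by rewrite expf_neq0.
  rewrite exprVn -!mulrA; congr (_ * _); rewrite [RHS]mulrC.
  by move: (mu ^+ k) mk => z z0; field.
pose W := pair gam 0 n lam chi.
pose g (a b : nat) : F := (W 'X^a 'X^b)`_n.
(* The pairing will be a multiple of X^n. Its value at the start of the orbit is divided by
   [x 0%N ^+ n] to recover the coefficient that [g] records. *)
pose u (k l : nat) : L :=
  (if (k <= l)%N then i (chi`_(n.+1 + k - l) * lam ^+ l) else 0) / x 0%N ^+ n.
exists g, u; split=> [k l lk|k|P Q sP sQ].
- by rewrite /u leqNgt lk mul0r.
- rewrite /u leqnn addnK chi1 mul1r; apply: mulf_neq0.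
    by rewrite fmorph_eq0; exact: expf_neq0.
  by rewrite invr_eq0; exact: expf_neq0.
(* The pairing is an eigenvector of the dilation: X^j occurs only if gam^j = gam^n. Its degree is at
   most 2n, so j differs from n by at most n. *)
- have We : W P Q = (W P Q)`_n *: 'X^n.
    have inv := pair_inv A B sP sQ; rewrite -/(W P Q) in inv.
    have sW : (size (W P Q) <= (2 * n).+1)%N.
      rewrite /W /pair; apply: (leq_trans (size_sum _ _ _)); apply/bigmax_leqP => k _.
      apply: (leq_trans (size_sum _ _ _)); apply/bigmax_leqP => l _.
      apply: (leq_trans (size_scale_leq _ _)); apply: (leq_trans (size_polyMleq _ _)).
      by rewrite !size_sh//; lia.
    apply/polyP => j; rewrite coefZ coefXn; case: eqP => [->|jn]; first by rewrite mulr1.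
    rewrite mulr0; have [jW|Wj] := ltnP j (2 * n).+1; last first.
      by rewrite nth_default// (leq_trans sW).
    have := congr1 (fun T : {poly F} => T`_j) inv; rewrite coefZ coef_sh_mul mul1n mulrA.
    move=> /eqP; rewrite -subr_eq0 -[X in _ - X]mul1r -mulrBl mulf_eq0 => /orP[|/eqP//].
    rewrite subr_eq0 => /eqP e; exfalso.
    have {}e : gam ^+ j = gam ^+ n by apply: (mulfI lam0); rewrite e mulVf.
    have [lt|gt|//] := ltngtP j n.
      have jn' : (1 <= n - j <= n)%N by lia.
      have := g1 _ jn'; rewrite -(inj_eq (mulIf (gn j))) -exprD subnK ?(ltnW lt)//.
      by rewrite mul1r e eqxx.
    have jn' : (1 <= j - n <= n)%N by lia.
    have := g1 _ jn'; rewrite -(inj_eq (mulIf (gn n))) -exprD subnK ?(ltnW gt)//.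
    by rewrite mul1r e eqxx.
  have xn0 : x 0%N ^+ n != 0 by rewrite expf_neq0.
  apply: (mulIf xn0).
  have := pair_horner n lam chi P Q hx; rewrite -/(W P Q) We map_polyZ/= hornerZ map_polyXn hornerXn => E.
  transitivity (i (W P Q)`_n * x 0%N ^+ n).
    congr (i _ * _).
    have := congr1 (fun T : {poly F} => T`_n) (pair_bilin gam 0 lam chi sP sQ).
    rewrite -/(W P Q) => ->; rewrite coef_sum; apply: eq_bigr => a _.
    by rewrite coef_sum; apply: eq_bigr => b _; rewrite coefZ.
  rewrite E mulr_suml; apply: eq_bigr => k _; rewrite mulr_suml; apply: eq_bigr => l _.
  rewrite /u; move: (x 0%N ^+ n) xn0 => z z0; set e := (if _ then _ else _).
  by rewrite [e]lock; field.
Qed.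

End Multiplicative.

(** * Annihilators *)

Section Annihilator.
Context {F : fieldType} (phi : {scalar {poly F}}) (s : nat).

(* phi will be the pairing with Q. *)
Definition ann (P : {poly F}) := forall B : {poly F}, (size B <= s)%N -> phi (P * B) = 0.

Lemma annZ z P : ann P -> ann (z *: P).
Proof. by move=> aP B sB; rewrite -scalerAl linearZ/= aP// mulr0. Qed.

Lemma ann_eqp P Q : P %= Q -> ann P -> ann Q.
Proof.
move=> /eqpP[[u v] /= /andP[u0 v0] E] aP.
by rewrite -[Q]scale1r -(mulVf v0) -scalerA -E; apply: annZ; apply: annZ.
Qed.

(* Bezout writes B as A' U + P' V, where G A' = A and G P' = P; reducing U
   modulo P' keeps both U and V within the size bound. *)
Lemma ann_gcdp (A P : {poly F}) : A != 0 ->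
  (size A <= s.+1)%N -> (size P <= s.+1)%N -> ann A -> ann P -> ann (gcdp A P).
Proof.
move=> A0 sA sP aA aP; have [->|P0] := eqVneq P 0.
  by rewrite gcdp0.
have /dvdpP[A' EA] : gcdp A P %| A by exact: dvdp_gcdl.
have /dvdpP[P' EP] : gcdp A P %| P by exact: dvdp_gcdr.
have cop0 : coprimep (A %/ gcdp A P) (P %/ gcdp A P) by apply: coprimep_div_gcd; rewrite A0.
have G0 : gcdp A P != 0 by rewrite gcdp_eq0 negb_and A0.
move: (gcdp A P) EA EP cop0 G0 => G EA EP cop0 G0.
have cop : coprimep A' P' by move: cop0; rewrite EA EP !mulpK.
have A'0 : A' != 0 by apply/eqP => h; move: A0; rewrite EA h mul0r eqxx.
have P'0 : P' != 0 by apply/eqP => h; move: P0; rewrite EP h mul0r eqxx.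
have sA' : (size A' <= s.+1)%N.
  by apply: leq_trans sA; apply: dvdp_leq => //; rewrite EA dvdp_mulr.
have sP' : (size P' <= s.+1)%N.
  by apply: leq_trans sP; apply: dvdp_leq => //; rewrite EP dvdp_mulr.
have /Bezout_eq1_coprimepP[[u v]/= uv] := cop => B sB.
pose U := (u * B) %% P'.
have sU : (size U < size P')%N by rewrite ltn_modp.
have /dvdpP[V EV] : P' %| B - A' * U.
  have -> : B - A' * U = P' * (v * B + A' * ((u * B) %/ P')).
    rewrite -[in LHS](mul1r B) -uv /U.
    have := divp_eq (u * B) P'; move: (_ %/ _) (_ %% _) => q r E.
    by rewrite mulrDl -[u * A' * B]mulrA [A' * B]mulrC mulrA E; ring.
  exact: dvdp_mulr.
have -> : G * B = A * U + P * V.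
  by rewrite EA EP -[B in LHS](subrK (A' * U)) EV; ring.
rewrite linearD aA ?aP ?addr0//; last first.
  by rewrite -ltnS (leq_trans sU).
have [->|V0] := eqVneq V 0; first by rewrite size_poly0.
have sVP : size (V * P') = (size V + size P').-1 by rewrite size_mul.
have sAU : (size (A' * U)%R <= (size A' + size U).-1)%N by exact: size_polyMleq.
have : (size (B - A' * U)%R <= maxn (size B) (size (A' * U)%R))%N.
  by rewrite (leq_trans (size_polyD _ _))// size_polyN.
rewrite EV sVP; move: (size_poly_gt0 P'); rewrite P'0.
by rewrite leq_max; move=> p0 /orP[]; lia.
Qed.

(** Divide [D * B] by [C]: the quotient is no longer than [B] because [D] is no longer than [C], and
    the remainder is a legitimate multiplier for [A]. *)
Lemma ann_mid (A C D : {poly F}) : C != 0 -> (size C <= s.+1)%N -> (size D <= size C)%N ->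
  ann A -> ann (A * C) -> ann (A * D).
Proof.
move=> C0 sC sD aA aAC B sB.
have sr : (size ((D * B) %% C)%R < size C)%N by rewrite ltn_modp.
have E : A * D * B = A * C * ((D * B) %/ C) + A * ((D * B) %% C).
  by rewrite -[_ * D * B]mulrA {1}(divp_eq (D * B) C); ring.
rewrite E linearD aAC ?aA ?addr0//; first by rewrite -ltnS (leq_trans sr).
rewrite size_divp//; have := size_polyMleq D B; move: sB sD.
by move: (size C) (size D) (size B) (size (D * B)%R) => x y z u; lia.
Qed.

(** By [ann_gcdp] the gcd of a shortest annihilating polynomial with any other one is again
    annihilating, so the shortest one divides it. *)
Lemma ann_min (P : {poly F}) : P != 0 -> (size P <= s.+1)%N -> ann P ->
  exists A : {poly F}, [/\ A != 0, (size A <= s.+1)%N, ann A &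
    forall Q : {poly F}, (size Q <= s.+1)%N -> ann Q -> A %| Q].
Proof.
move=> P0 sP aP.
pose good k := `[< exists A : {poly F}, [/\ A != 0, size A = k & ann A] >].
have ex : exists k, good k by exists (size P); apply/asboolP; exists P.
have [k /asboolP[A [A0 sA aA]] kmin] := ex_minnP ex.
have sk : (k <= s.+1)%N by apply: leq_trans sP; apply: kmin; apply/asboolP; exists P.
exists A; split=> //; rewrite ?sA// => Q sQ aQ.
have G0 : gcdp A Q != 0 by rewrite gcdp_eq0 negb_and A0.
have aG : ann (gcdp A Q) by apply: ann_gcdp; rewrite ?sA.
have : (k <= size (gcdp A Q))%N by apply: kmin; apply/asboolP; exists (gcdp A Q).
rewrite -sA => h.
have : gcdp A Q %= A by rewrite -dvdp_size_eqp ?dvdp_gcdl// eqn_leq h dvdp_leq ?dvdp_gcdl.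
by move=> /eqp_dvdl <-; exact: dvdp_gcdr.
Qed.

End Annihilator.

Section ShiftKernel.
Context {F : fieldType} (a c : F) (a0 : a != 0) (phi : {scalar {poly F}}) (s N t : nat).
Hypothesis Ns : (N <= s)%N.
Local Notation sh := (sh a c).

Definition shker (P : {poly F}) :=
  (size P <= N.+1)%N /\ forall k, (k <= t)%N -> ann phi s (sh k P).

(** [ann_gcdp], applied to every shift, makes a shortest element [L] divide the whole kernel. Then
    [ann_mid] admits every cofactor no longer than the longest one, so the kernel consists of all
    multiples of [L] up to a certain degree. *)
Lemma shker_struct : (exists2 P, P != 0 & shker P) ->
  exists (L : {poly F}) (e : nat), [/\ L != 0, (0 < e)%N &
    forall P, shker P <-> exists2 D : {poly F}, (size D <= e)%N & P = L * D].
Proof.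
move=> [P0 nP0 kP0].
pose good k := `[< exists2 P : {poly F}, P != 0 /\ size P = k & shker P >].
have ex : exists k, good k by exists (size P0); apply/asboolP; exists P0.
have [k /asboolP[L [nL sL] kL] kmin] := ex_minnP ex.
have dvd P : shker P -> L %| P.
  move=> [sP hP].
  have nG : gcdp L P != 0 by rewrite gcdp_eq0 negb_and nL.
  have kG : shker (gcdp L P).
    split=> [|j jt]; first by rewrite (leq_trans _ kL.1)// dvdp_leq ?dvdp_gcdl.
    have e1 : gcdp (sh j L) (sh j P) %= sh j (gcdp L P) by rewrite eqp_sym; exact: gcdp_comp_poly.
    apply: (ann_eqp e1); apply: ann_gcdp; rewrite ?sh_eq0 ?size_sh//.
    - by rewrite (leq_trans kL.1).
    - by rewrite (leq_trans sP).
    - exact: kL.2.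
    - exact: hP.
  have : (k <= size (gcdp L P))%N by apply: kmin; apply/asboolP; exists (gcdp L P).
  rewrite -sL => h.
  have : gcdp L P %= L by rewrite -dvdp_size_eqp ?dvdp_gcdl// eqn_leq h dvdp_leq ?dvdp_gcdl.
  by move=> /eqp_dvdl <-; exact: dvdp_gcdr.
pose big j := `[< exists2 D : {poly F}, size D = j & shker (L * D) >].
have big1 : big 1%N by apply/asboolP; exists 1; rewrite ?size_poly1// mulr1.
have bigN j : big j -> (j <= N.+1)%N.
  move=> /asboolP[D <- [sLD _]]; have [->|D0] := eqVneq D 0; first by rewrite size_poly0.
  by rewrite (leq_trans _ sLD)// dvdp_leq ?mulf_neq0// dvdp_mull.
have [e /asboolP[C sC kC] emax] := ex_maxnP (ex_intro (fun j => big j) 1%N big1) bigN.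
have e0 : (0 < e)%N by exact: emax.
exists L, e; split=> // P; split=> [kP|[D sD ->]].
  have /dvdpP[D E] := dvd _ kP; exists D; last by rewrite mulrC.
  by apply: emax; apply/asboolP; exists D; rewrite // mulrC -E.
have C0 : C != 0 by rewrite -size_poly_gt0 sC.
split=> [|j jt].
  have [->|D0] := eqVneq D 0; first by rewrite mulr0 size_poly0.
  apply: leq_trans kC.1; rewrite !size_mul// sC.
  by rewrite -!subn1 leq_sub2r// leq_add2l.
rewrite /sh rmorphM/=; apply: (@ann_mid _ _ _ _ (sh j C)).
- by rewrite sh_eq0.
- rewrite size_sh// sC -ltnS ltnS; apply: leq_trans (_ : N.+1 <= _)%N; last by rewrite ltnS.
  by apply: bigN; apply/asboolP; exists C.
- by rewrite !size_sh// sC.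
- exact: kL.2.
- by have := kC.2 j jt; rewrite /sh rmorphM.
Qed.

(** If no shift of [E] divided [A], then [A], which divides every shift of [L], would divide every
    shift of L/E. By [ann_mid] L/E would then lie in the kernel, although it is shorter than [L]. *)
Lemma irr_dvd_min (L : {poly F}) e (A E : {poly F}) : (0 < e)%N -> L != 0 ->
  (forall P, shker P <-> exists2 D : {poly F}, (size D <= e)%N & P = L * D) ->
  A != 0 -> (size A <= s.+1)%N -> ann phi s A ->
  (forall Q : {poly F}, (size Q <= s.+1)%N -> ann phi s Q -> A %| Q) ->
  irreducible_poly E -> E %| L -> exists2 k, (k <= t)%N & sh k E %| A.
Proof.
move=> e0 L0 hL A0 sA aA minA irrE /dvdpP[M EM].
have kL : shker L by apply/hL; exists 1; rewrite ?mulr1// size_poly1.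
apply: contrapT => no.
have M0 : M != 0 by apply/eqP => h; move: L0; rewrite EM h mul0r eqxx.
have sL : (size M < size L)%N.
  rewrite EM size_mul ?(irredp_neq0 irrE)//; have [sE _] := irrE.
  move: sE (size_poly_gt0 M); rewrite M0.
  by move: (size (M : {poly F})) (size E) => x y; lia.
have /hL[D _ ED] : shker M.
  split=> [|k kt]; first by rewrite (leq_trans (ltnW sL))// kL.1.
  have /dvdpP[C EC] : A %| sh k L.
    by apply: minA; [rewrite size_sh// (leq_trans kL.1)|exact: kL.2].
  have cop : coprimep A (sh k E).
    rewrite coprimep_sym irreducible_poly_coprime; last exact: sh_irr.
    by apply/negP => h; apply: no; exists k.
  have /dvdpP[D ED] : A %| sh k M.
    have : A %| sh k L by rewrite EC dvdp_mull.
    by rewrite EM shM Gauss_dvdpl.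
  have C0 : C != 0.
    by apply/eqP => h; move: EC; rewrite h mul0r => /eqP; rewrite sh_eq0// (negbTE L0).
  have nM : sh k M != 0 by rewrite sh_eq0.
  have D0 : D != 0 by apply/eqP => h; move: nM; rewrite ED h mul0r eqxx.
  have hs : (size (D * A)%R < size (C * A)%R)%N by rewrite -EC -ED !size_sh.
  rewrite ED mulrC; apply: (ann_mid C0) => //.
  - apply: (@leq_trans (size (sh k L))); first by rewrite EC dvdp_leq ?mulf_neq0// dvdp_mulr.
    by rewrite size_sh// (leq_trans kL.1).
  - move: hs; rewrite !size_mul//; move: (size_poly_gt0 A); rewrite A0.
    by move: (size (C : {poly F})) (size (D : {poly F})) (size A) => x y z; lia.
  - by rewrite mulrC -EC; exact: kL.2.
have D0 : D != 0 by apply/eqP => h; move: M0; rewrite ED h mulr0 eqxx.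
by move: sL; rewrite {1}ED ltnNge dvdp_leq ?mulf_neq0// dvdp_mulr.
Qed.

End ShiftKernel.

(** * Determinant estimates *)

Section Linear.
Context {F : fieldType}.

Lemma rank_row_select m n k (B : 'M[F]_(m, n)) : \rank B = k ->
  exists f : 'I_k -> 'I_m, row_free (rowsub f B).
Proof. by move=> <-; exists (maxrankfun B); exact: maxrowsub_free. Qed.

(* With M = colsub f A and X a left inverse of M, the product of col_mx X T and
   row_mx M S is block triangular with determinant that of T *m S. *)
Lemma det_key (r e q : nat) (A : 'M[F]_(r + e, q)) (T : 'M[F]_(e, r + e)) :
  row_free T -> (T :=: kermx A)%MS ->
  exists (f : 'I_r -> 'I_q) (mu : F), mu != 0 /\
    forall S : 'M[F]_(r + e, e), mu * \det (T *m S) = \det (row_mx (colsub f A) S).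
Proof.
move=> fT kT.
have rA : \rank A^T = r.
  rewrite mxrank_tr; have := mxrank_ker A; rewrite -kT (eqP fT).
  by have := rank_leq_row A; lia.
have [f ff] : exists f : 'I_r -> 'I_q, row_free (rowsub f A^T).
  exact: rank_row_select.
have [X XM] : exists X, X *m colsub f A = 1%:M.
  have /row_freeP[X hX] := ff; exists X^T.
  by rewrite -trmx1 -hX trmx_mul; congr (_ *m _); apply/matrixP => i j; rewrite !mxE.
have TM : T *m colsub f A = 0.
  have TA : T *m A = 0 by apply/sub_kermxP; rewrite kT.
  apply/matrixP => i j; have := congr1 (fun B : 'M[F]_(e, q) => B i (f j)) TA.
  by rewrite !mxE => E; rewrite -[RHS]E; apply: eq_bigr => k _; rewrite !mxE.
have key S : \det (col_mx X T) * \det (row_mx (colsub f A) S) = \det (T *m S).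
  by rewrite -det_mulmx mul_col_row XM TM det_ublock det1 mul1r.
have nz : \det (col_mx X T) != 0.
  have /row_freeP[S TS] := fT; apply/eqP => h; have := key S.
  by rewrite h mul0r TS det1 => /eqP; rewrite eq_sym oner_eq0.
exists f, (\det (col_mx X T))^-1; split=> [|S]; first by rewrite invr_eq0.
by rewrite -key mulKf.
Qed.

(** As a Schur complement the factors [U] and [V] of the low-rank part occupy separate blocks. Every
    entry is then bounded by a row weight times a column weight, a form the sum [V *m U + N] does
    not have. *)
Lemma det_schur (q r e : nat) (U : 'M[F]_(q, r)) (V : 'M[F]_(r + e, q)) (N : 'M[F]_(r + e, r))
    (S : 'M[F]_(r + e, e)) :
  \det (row_mx (V *m U + N) S) = \det (block_mx 1%:M (row_mx (- U) 0) V (row_mx N S)).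
Proof.
have := det_mulmx (block_mx 1%:M 0 (- V) 1%:M) (block_mx 1%:M (row_mx (- U) 0) V (row_mx N S)).
rewrite det_lblock !det1 !mul1r mulmx_block !mul1mx !mul0mx !addr0 => <-.
rewrite mulmx1 addNr mul_mx_row mulmx0 mulNmx mulmxN opprK add_row_mx add0r.
by rewrite det_ublock det1 mul1r.
Qed.

End Linear.

Section LowRank.
Context {R : realType} {F : fieldType} (v : absval R F).

Lemma det_low_rank_le (q r e : nat) (U : 'M[F]_(q, r)) (V : 'M[F]_(r + e, q)) (N : 'M[F]_(r + e, r))
    (S : 'M[F]_(r + e, e)) (C Y d : R) : 1 <= C -> 1 <= Y -> 0 < d -> d <= 1 ->
  (forall i j, v (U i j) <= C * Y) -> (forall i j, v (V i j) <= C) ->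
  (forall i j, v (N i j) <= C * d) -> (forall i j, v (S i j) <= C) ->
  v (\det (row_mx (V *m U + N) S)) <=
    avc v (q + (r + e))`!%:R * (Y / d) ^+ q * C ^+ (q + (r + e)) * d ^+ r.
Proof.
move=> C1 Y1 d0 d1 hU hV hN hS.
have C0 : 0 < C := lt_le_trans ltr01 C1.
have Yd1 : 1 <= Y / d by rewrite ler_pdivlMr// mul1r (le_trans d1).
have Yd0 : 0 < Y / d := lt_le_trans ltr01 Yd1.
(* The size Y of the entries of [U] is split as Y/d for the row times d for the column. Thus each of
   the [r] columns keeps its factor d, and the low-rank part costs only [q] factors Y/d. *)
pose rw (i : 'I_(q + (r + e))) : R := if fintype.split i is inl _ then Y / d else 1.
pose cw (i : 'I_(q + (r + e))) : R :=
  if fintype.split i is inr j then (if fintype.split j is inl _ then C * d else C) else C.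
have h (i j : 'I_(q + (r + e))) :
    v ((block_mx 1%:M (row_mx (- U) 0) V (row_mx N S)) i j) <= rw i * cw j.
  have Cd0 : 0 <= C * d by rewrite mulr_ge0 ?ltW.
  rewrite /rw /cw !mxE; case: (fintype.split i) => i'; rewrite !mxE.
    case: (fintype.split j) => j'; rewrite !mxE.
      case: (i' == j'); rewrite ?av1 ?av0; last by rewrite mulr_ge0 ?ltW.
      by rewrite mulr_ege1.
    case: (fintype.split j') => k; rewrite !mxE ?avN ?av0; last by rewrite mulr_ge0 ?ltW.
    by rewrite mulrCA divfK ?gt_eqF.
  rewrite mul1r; case: (fintype.split j) => j'; rewrite ?mxE; first exact: hV.
  by case: (fintype.split j') => k.
rewrite det_schur; apply: le_trans (det_le h) _; rewrite -!mulrA ler_wpM2l//.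
  by rewrite (le_trans ler01)// avc_ge1// ler1n fact_gt0.
have e1 (i : 'I_q) : fintype.split (lshift (r + e) i) = inl i by exact: (unsplitK (inl i)).
have e2 (i : 'I_(r + e)) : fintype.split (rshift q i) = inr i by exact: (unsplitK (inr i)).
have e3 (i : 'I_r) : fintype.split (lshift e i) = inl i by exact: (unsplitK (inl i)).
have e4 (i : 'I_e) : fintype.split (rshift r i) = inr i by exact: (unsplitK (inr i)).
have -> : \prod_i rw i = (Y / d) ^+ q.
  rewrite big_split_ord/= [X in _ * X]big1 ?mulr1; last by move=> i _; rewrite /rw e2.
  by rewrite (eq_bigr (fun=> Y / d)) ?prodr_const ?card_ord// => i _; rewrite /rw e1.
have -> : \prod_i cw i = C ^+ q * ((C * d) ^+ r * C ^+ e).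
  rewrite !big_split_ord/= (eq_bigr (fun=> C)); last by move=> i _; rewrite /cw e1.
  rewrite [X in _ * (X * _)](eq_bigr (fun=> C * d)); last by move=> i _; rewrite /cw e2 e3.
  rewrite [X in _ * (_ * X)](eq_bigr (fun=> C)); last by move=> i _; rewrite /cw e2 e4.
  by rewrite !prodr_const !card_ord.
by rewrite [(C * d) ^+ r]exprMn !exprD le_eqVlt; apply/orP; left; apply/eqP; ring.
Qed.

End LowRank.

(** * The linear system for the shifted annihilators *)

Section Bil.
Context {F : fieldType} (n : nat) (g : nat -> nat -> F).

Definition bil (Q P : {poly F}) : F :=
  \sum_(x < n.+1) \sum_(y < n.+1) P`_x * Q`_y * g x y.

Lemma bil_is_scalar Q : scalar (bil Q).
Proof.
move=> z P P'; rewrite /bil mulr_sumr -big_split/=; apply: eq_bigr => x _.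
rewrite mulr_sumr -big_split/=; apply: eq_bigr => y _.
by rewrite coefD coefZ; ring.
Qed.

HB.instance Definition _ Q := GRing.isLinear.Build F {poly F} F *%R (bil Q) (bil_is_scalar Q).

End Bil.

Section AbsSum.
Context {R : realType} {F : fieldType} (v : absval R F).

Lemma av_sum_tri (I : Type) (r : seq I) (A : pred I) (f : I -> F) :
  v (\sum_(i <- r | A i) f i) <= \sum_(i <- r | A i) v (f i).
Proof.
elim/big_rec2 : _ => [|i y z _ IH]; first by rewrite av0.
by apply: le_trans (av_add _ _ _) _; rewrite lerD2l.
Qed.

Lemma av_sum_le (I : finType) (A : pred I) (f : I -> F) (b : R) : 0 <= b ->
  (forall i, A i -> v (f i) <= b) -> v (\sum_(i | A i) f i) <= #|I|%:R * b.
Proof.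
move=> b0 h; apply: le_trans (av_sum_tri _ _ _) _.
apply: (@le_trans _ _ (\sum_(i : I) b)); last by rewrite sumr_const mulr_natl.
by rewrite big_mkcond/=; apply: ler_sum => i _; case: ifP => [/h|].
Qed.

End AbsSum.

Lemma fin_bound (R : realType) (I : finType) (f : I -> R) :
  exists2 B : R, 1 <= B & forall i, f i <= B.
Proof.
have S0 : 0 <= \sum_i `|f i| by apply: sumr_ge0.
exists (1 + \sum_i `|f i|) => [|i]; first by lra.
apply: le_trans (ler_norm _) _; rewrite (bigD1 i)//=.
have : 0 <= \sum_(j | j != i) `|f j| by apply: sumr_ge0.
lra.
Qed.

Section Matrices.
Context {F : fieldType} (a c : F) (n m t s : nat) (a0 : a != 0) (g : nat -> nat -> F).
Let I := ('I_t.+1 * 'I_s)%type.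
Let q := #|{: I}|.
Variable Q : {poly F}.
Local Notation sh := (sh a c).
Local Notation ker := (shker a c (bil n g Q) s m t).

(** Rows stand for the monomials of the unknown, columns for the test conditions, and the left
    kernel is [shker]. The number of rows stays a variable because [det_key] needs it in the form
    [r + e]. *)
Definition sysmx d : 'M[F]_(d, q) :=
  \matrix_(i, j) bil n g Q (sh (enum_val j : I).1 'X^i * 'X^((enum_val j : I).2)).

Definition multmx e d (L : {poly F}) : 'M[F]_(e, d) := \matrix_(i, j) (L * 'X^i)`_j.

Lemma sysmx_ker d (p : 'rV[F]_d) : d = m.+1 -> p *m sysmx d = 0 <-> ker (rVpoly p).
Proof.
move=> dm.
have E (j : 'I_q) : (p *m sysmx d) 0 j =
    bil n g Q (sh (enum_val j : I).1 (rVpoly p) * 'X^((enum_val j : I).2)).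
  have -> : rVpoly p = \sum_(i < d) p 0 i *: 'X^i.
    by rewrite /rVpoly poly_def; apply: eq_bigr => i _; rewrite valK.
  rewrite sh_sum mulr_suml linear_sum !mxE; apply: eq_bigr => i _.
  by rewrite mxE shZ -scalerAl linearZ.
split=> [h|[_ h]].
  split=> [|k kt B sB]; first by rewrite -dm size_poly.
  have -> : B = \sum_(b < s) B`_b *: 'X^b.
    by rewrite -[B in LHS](poly_rV_K sB) /rVpoly poly_def; apply: eq_bigr => b _; rewrite valK mxE.
  rewrite mulr_sumr linear_sum big1// => b _.
  rewrite -scalerAr linearZ/=.
  have := congr1 (fun M : 'rV[F]_q => M 0 (enum_rank ((inord k, b) : I))) h.
  by rewrite E mxE enum_rankK/= inordK ?ltnS// => ->; rewrite mulr0.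
apply/rowP => j; rewrite E mxE; apply: h; first by rewrite -ltnS.
by rewrite size_polyXn.
Qed.

Lemma multmxE e d (L D : {poly F}) : (size D <= e)%N ->
  (poly_rV D : 'rV[F]_e) *m multmx e d L = poly_rV (L * D).
Proof.
move=> sD; apply/rowP => j; rewrite !mxE.
have E : D = \sum_(i < e) D`_i *: 'X^i.
  by rewrite -[D in LHS](poly_rV_K sD) /rVpoly poly_def; apply: eq_bigr => i _; rewrite valK mxE.
rewrite [in RHS]E mulr_sumr coef_sum; apply: eq_bigr => i _.
by rewrite !mxE -scalerAr coefZ.
Qed.

Lemma sysmx_det (L : {poly F}) (r e : nat) : (r + e = m.+1)%N -> L != 0 ->
  (size L + e <= m.+2)%N ->
  (forall P, ker P <-> exists2 D : {poly F}, (size D <= e)%N & P = L * D) ->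
  exists (f : 'I_r -> 'I_q) (mu : F), mu != 0 /\
    forall S : 'M[F]_(r + e, e), mu * \det (multmx e (r + e) L *m S) =
      \det (row_mx (colsub f (sysmx (r + e))) S).
Proof.
move=> re L0 sLe hL.
have sLD (D : {poly F}) : (size D <= e)%N -> (size (L * D)%R <= r + e)%N.
  move=> sD; have [->|D0] := eqVneq D 0; first by rewrite mulr0 size_poly0.
  rewrite re size_mul// -ltnS prednK ?addn_gt0 ?size_poly_gt0 ?L0//.
  by rewrite (leq_trans _ sLe)// leq_add2l.
apply: det_key.
  rewrite -kermx_eq0 -submx0; apply/rV_subP => p /sub_kermxP hp.
  suff -> : p = 0 by exact: sub0mx.
  have := congr1 rVpoly hp; rewrite -[p in p *m _]rVpolyK multmxE ?size_poly//.
  rewrite poly_rV_K ?sLD ?size_poly// linear0 => /eqP.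
  by rewrite mulf_eq0 (negbTE L0)/= => /eqP h; rewrite -[p]rVpolyK h linear0.
apply/eqmxP/andP; split; apply/rV_subP => p.
  move=> /submxP[D ->]; apply/sub_kermxP/(sysmx_ker _ re)/hL.
  exists (rVpoly D); first exact: size_poly.
  by rewrite -[D in D *m _]rVpolyK multmxE ?size_poly// poly_rV_K// sLD// size_poly.
move=> /sub_kermxP/(sysmx_ker _ re)/hL[D sD E].
by rewrite -[p]rVpolyK E -(multmxE _ _ sD) submxMl.
Qed.

End Matrices.

(** With this column selection as [S], the determinant in [sysmx_det] becomes the minor bounded
    below by [toep_bound]. *)
Lemma multmx_toep (F : fieldType) (L : {poly F}) (e d r0 : nat) : (r0 < size L)%N -> (size L + e <= d.+1)%N ->
  multmx e d L *m (\matrix_(i < d, j < e) (i == (r0 + j)%N :> nat)%:R) = toep e r0 L.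
Proof.
move=> rL sd; apply/matrixP => i j; rewrite !mxE.
have rj : (r0 + j < d)%N by have := ltn_ord j; lia.
rewrite (bigD1 (Ordinal rj))//= !mxE eqxx mulr1 big1 ?addr0// => k kj.
by rewrite !mxE (_ : (_ == _ :> nat) = false) ?mulr0//; apply: negbTE.
Qed.

Section Split.
Context {F L : fieldType} (i : {rmorphism F -> L}) (a c : F) (n m t s : nat) (a0 : a != 0).
Context (x : nat -> L) (g : nat -> nat -> F) (u : nat -> nat -> L).
Hypothesis hx : forall q, x q.+1 = i a * x q + i c.
Hypothesis tri : tri_pairing i n x g u.
Hypothesis ms : (m + s = n.+1)%N.
Hypothesis tn : (t <= n.+1)%N.
Let I := ('I_t.+1 * 'I_s)%type.
Let q := #|{: I}|.
Variable Q : {poly F}.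
Hypothesis sQ : (size Q <= n.+1)%N.
Local Notation ev l := (map_poly i Q).[x l].

Definition vmx d : 'M[L]_(d, 2 * t) := \matrix_(r, p) x p ^+ r.

Definition umx : 'M[L]_(2 * t, q) := \matrix_(p, j)
  \sum_(k < t | (k + (enum_val j : I).1)%N == p :> nat)
    x k ^+ (enum_val j : I).2 * \sum_(l < n.+1 | (l < t)%N) u k l * ev l.

Definition nmx d : 'M[L]_(d, q) := \matrix_(r, j)
  \sum_(k < n.+1) x (k + (enum_val j : I).1)%N ^+ r * x k ^+ (enum_val j : I).2 *
    \sum_(l < n.+1 | (t <= l)%N) u k l * ev l.

(** By triangularity the terms with [l < t] have [k < t] as well, so after a shift by at most t they
    involve the orbit only at indices below 2t: this is the part of rank at most 2t. The other terms
    contain a small value of [Q]. *)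
Lemma sysmx_split d : d = m.+1 ->
  map_mx i (sysmx a c n t s g Q d) = vmx d *m umx + nmx d.
Proof.
move=> dm; apply/matrixP => r j; rewrite !mxE.
have [u0 _ tE] := tri.
set k0 := (enum_val j : I).1; set b := (enum_val j : I).2.
have sP : (size (sh a c k0 'X^r * 'X^b)%R <= n.+1)%N.
  rewrite size_mul ?sh_eq0 -?size_poly_eq0 ?size_polyXn// size_sh// size_polyXn.
  have := ltn_ord r; have := ltn_ord b; rewrite {2}dm; lia.
rewrite [LHS](tE _ _ sP sQ).
have hor k : (map_poly i (sh a c k0 'X^r * 'X^b)).[x k] = x (k + k0)%N ^+ r * x k ^+ b.
  by rewrite rmorphM/= hornerM (horner_sh _ _ _ hx) !map_polyXn !hornerXn.
transitivity (\sum_(k < n.+1) x (k + k0)%N ^+ r * x k ^+ b *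
   (\sum_(l < n.+1 | (l < t)%N) u k l * ev l + \sum_(l < n.+1 | (t <= l)%N) u k l * ev l)).
  apply: eq_bigr => k _.
  rewrite (eq_bigr (fun l : 'I_n.+1 => x (k + k0)%N ^+ r * x k ^+ b * (u k l * ev l))); last first.
    by move=> l _; rewrite hor mulrA.
  rewrite -mulr_sumr (bigID (fun l : 'I_n.+1 => (l < t)%N))/=; congr (_ * (_ + _)).
  by apply: eq_bigl => l; rewrite -leqNgt.
under eq_bigr do rewrite mulrDr.
rewrite big_split/=; congr (_ + _).
rewrite (bigID (fun k : 'I_n.+1 => (k < t)%N))/= [X in _ + X]big1 ?addr0; last first.
  move=> k; rewrite -leqNgt => tk; rewrite big1 ?mulr0// => l lt.
  by rewrite u0 ?mul0r// (leq_trans lt).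
pose G (k : nat) := x k ^+ b * \sum_(l < n.+1 | (l < t)%N) u k l * ev l.
transitivity (\sum_(k < t) x (k + k0)%N ^+ r * G k).
  rewrite [RHS](big_ord_widen n.+1 (fun k => x (k + k0)%N ^+ r * G k))//.
  by apply: eq_bigr => k _; rewrite mulrA.
transitivity (\sum_(p < 2 * t) \sum_(k < t | (k + k0)%N == p :> nat) x p ^+ r * G k); last first.
  by apply: eq_bigr => p _; rewrite !mxE mulr_sumr.
rewrite (exchange_big_dep xpredT)//=; apply: eq_bigr => k _.
have kp : (k + k0 < 2 * t)%N by have := ltn_ord k; have := ltn_ord k0; rewrite ltnS; lia.
by rewrite (big_pred1 (Ordinal kp))// => p; rewrite -val_eqE eq_sym.
Qed.

End Split.

Section SplitBound.
Context {R : realType} {F L : fieldType} (v : absval R L) (i : {rmorphism F -> L}).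
Context (n m t s : nat) (x : nat -> L) (u : nat -> nat -> L).
Hypothesis ms : (m + s = n.+1)%N.
Hypothesis tn : (t <= n.+1)%N.

Lemma split_bound : exists2 C : R, 1 <= C & forall (Q : {poly F}) (Y d : R),
  0 <= Y -> 0 <= d -> (size Q <= n.+1)%N -> pnorm v (map_poly i Q) <= Y ->
  (forall l, (t <= l <= n)%N -> v (map_poly i Q).[x l] <= d) ->
  [/\ forall r j, v (vmx t x m.+1 r j) <= C,
      forall p j, v (umx i n t s x u Q p j) <= C * Y &
      forall r j, v (nmx i n t s x u Q m.+1 r j) <= C * d].
Proof.
have s_le : (s <= n.+1)%N by lia.
have m_le : (m.+1 <= n.+2)%N by lia.
have [Bx Bx1 hBx] := fin_bound (fun pr : 'I_((n + t).+1 + 2 * t) * 'I_n.+3 => v (x pr.1 ^+ nat_of_ord pr.2)).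
have [Bu Bu1 hBu] := fin_bound (fun kl : 'I_n.+1 * 'I_n.+1 => v (u kl.1 kl.2)).
have hx p r : (p <= n + t)%N \/ (p <= 2 * t)%N -> (r <= n.+2)%N -> v (x p ^+ r) <= Bx.
  move=> hp hr; have p1 : (p < (n + t).+1 + 2 * t)%N by case: hp; lia.
  by have := hBx (inord p, inord r); rewrite /= !inordK.
have hu k l : (k <= n)%N -> (l <= n)%N -> v (u k l) <= Bu.
  by move=> kn ln; have := hBu (inord k, inord l); rewrite /= !inordK.
have Bx0 : 0 <= Bx by lra.
have Bu0 : 0 <= Bu by lra.
pose N : R := n.+1%:R.
have N1 : 1 <= N by rewrite ler1n.
have N0 : 0 <= N by lra.
pose C := N * (Bx * Bx * (N * (Bu * (N * Bx)))).
have C1 : 1 <= C by rewrite /C !mulr_ege1.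
have tN : t%:R <= N by rewrite ler_nat.
exists C => // Q Y d Y0 d0 sQ nQ hQ.
have evY l : (l <= n)%N -> v (map_poly i Q).[x l] <= N * (Y * Bx).
  move=> ln; rewrite (horner_coef_wide _ (_ : size (map_poly i Q) <= n.+1)%N) ?size_map_poly//.
  rewrite /N -[X in X%:R * _]card_ord; apply: av_sum_le => [|k _]; first exact: mulr_ge0.
  rewrite av_mul ler_pM ?av_ge0//; first exact: le_trans (pnorm_coef _ _ _) nQ.
  by apply: hx; [left; rewrite (leq_trans ln)// leq_addr|exact: leqW (ltnW (ltn_ord k))].
split=> [r j|p j|r j]; rewrite mxE.
- apply: (@le_trans _ _ Bx); first by apply: hx; [right; apply: ltnW|rewrite (leq_trans (ltnW (ltn_ord r)))].
  have -> : C = Bx * (N * (Bx * (N * (Bu * (N * Bx))))) by rewrite /C; ring.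
  by rewrite ler_peMr// !mulr_ege1.
- set jj := enum_val j.
  apply: (@le_trans _ _ (#|'I_t|%:R * (Bx * (N * (Bu * (N * (Y * Bx))))))).
    apply: av_sum_le => [|k _]; first by rewrite !mulr_ge0.
    rewrite av_mul ler_pM ?av_ge0//.
      by apply: hx; [left; rewrite (leq_trans (ltnW (ltn_ord k)))// leq_addl|rewrite (leq_trans (ltnW (ltn_ord jj.2)))// (leq_trans s_le)// leqnSn].
    rewrite /N -[X in X%:R * (Bu * _)]card_ord; apply: av_sum_le => [|l lt]; first by rewrite !mulr_ge0.
    rewrite av_mul ler_pM ?av_ge0//; first by apply: hu; [rewrite -ltnS (leq_trans (ltn_ord k))|rewrite -ltnS].
    by apply: evY; rewrite -ltnS.
  rewrite card_ord.
  have -> : C * Y = N * (Bx * (N * (Bu * (N * (Y * Bx))))) * Bx by rewrite /C; ring.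
  rewrite -[leLHS]mulr1 ler_pM ?mulr_ge0//.
  by rewrite ler_wpM2r ?mulr_ge0.
- set jj := enum_val j.
  apply: (@le_trans _ _ (N * (Bx * Bx * (N * (Bu * d))))).
    rewrite /N -[X in X%:R * (Bx * Bx * _)]card_ord.
    apply: av_sum_le => [|k _]; first by rewrite !mulr_ge0.
    have kn : (k <= n)%N by rewrite -ltnS.
    rewrite 2!av_mul !ler_pM ?mulr_ge0 ?av_ge0//.
    - by apply: hx; [left; rewrite leq_add// -ltnS ltn_ord|rewrite (leq_trans (ltnW (ltn_ord r)))].
    - by apply: hx; [left; rewrite (leq_trans kn)// leq_addr|rewrite (leq_trans (ltnW (ltn_ord jj.2)))// (leq_trans s_le)// leqnSn].
    - rewrite -[X in X%:R * (Bu * _)]card_ord; apply: av_sum_le => [|l tl]; first by rewrite !mulr_ge0.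
      rewrite av_mul ler_pM ?av_ge0//; first by apply: hu => //; rewrite -ltnS.
      by apply: hQ; rewrite tl -ltnS ltn_ord.
  have -> : C * d = N * (Bx * Bx * (N * (Bu * d))) * (N * Bx) by rewrite /C; ring.
  by rewrite ler_peMr ?mulr_ge0// mulr_ege1.
Qed.

End SplitBound.

(** * The elimination system *)

(* (sa, sc) is (1, gamma) in the additive and (gamma, 0) in the multiplicative
   case, and sx numbers the orbit from 0. *)
Record setup (R : realType) (K : fieldExtType rat) (w : place R K) := Setup {
  sn : nat; st : nat; sa : K; sc : K; sx : nat -> completion w;
  sg : nat -> nat -> K; su : nat -> nat -> completion w;
  st_gt0 : (0 < st)%N;
  sn_ge : (4 * st <= sn)%N;
  sa_neq0 : sa != 0;
  sxS : forall q, sx q.+1 = emb w sa * sx q + emb w sc;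
  spairing : tri_pairing (emb w) sn sx sg su;
  sx_inj : forall i j, (i < j <= sn)%N -> sx i != sx j;
  sfree : forall (P : {poly K}) k p, (1 < size P)%N -> (p <= sn)%N ->
    (map_poly (emb w) P).[sx p] = 0 -> (0 < k)%N -> (k * (size P).-1 <= sn)%N ->
    ~~ (sh sa sc k P %= P) }.

Section System.
Context {R : realType} {K : fieldExtType rat} {w : place R K} (S : setup w).
Local Notation n := (sn S).
Local Notation t := (st S).
Local Notation sh := (sh (sa S) (sc S)).
Local Notation ev Q l := (map_poly (emb w) Q).[sx S l].

(** The bound for the degree of L. Together with the number [ss] of multipliers it adds up to n + 1,
    so all products stay in the range of the pairing, and halving ensures [sm <= ss], as the
    annihilator lemmas require. *)
Definition sm := (n.+1)./2.
Definition ss := (n.+1 - sm)%N.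
Definition kap : R := (4 * t)%:R / (n%:R + 1 - (4 * t)%:R).
(** The saving in the exponent at [w]: 2t(1 + kap) - kap(m + 1 - e) equals kap e - theta. *)
Definition theta : R := kap * (sm.+1%:R - (2 * t)%:R) - (2 * t)%:R.

Definition sys (Y : R) (Q : {poly K}) :=
  [/\ Q != 0, (size Q <= n.+1)%N, forall v, ~ same_place v w -> pnorm v Q <= 1,
     pnorm w Q <= Y & forall l, (t <= l <= n)%N -> cabs w (ev Q l) <= Y `^ (- kap)].

Definition sker (Q : {poly K}) := shker (sa S) (sc S) (bil n (sg S) Q) ss sm t.

Lemma sm_ss : (sm + ss = n.+1)%N.
Proof. by rewrite /ss subnKC// /sm; lia. Qed.

Lemma sm_le_ss : (sm <= ss)%N.
Proof. by rewrite /ss /sm; lia. Qed.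

Lemma sm_le_n : (sm <= n)%N.
Proof. by rewrite /sm; have := sn_ge S; have := st_gt0 S; lia. Qed.

Lemma t2_le_sm : (2 * t <= sm)%N.
Proof. by rewrite /sm; have := sn_ge S; lia. Qed.

Lemma kapD_gt0 : 0 < n%:R + 1 - (4 * t)%:R :> R.
Proof. by have := sn_ge S; rewrite -(ler_nat R); lra. Qed.

Lemma kap_gt0 : 0 < kap.
Proof. by rewrite divr_gt0 ?kapD_gt0// ltr0n muln_gt0/= st_gt0. Qed.

(** The product of kap and n + 1 - 4t is 4t, while twice m + 1 - 2t is at least n + 2 - 4t; so theta
    is at least kap/2. *)
Lemma theta_gt0 : 0 < theta.
Proof.
have h : (n%:R + 1 - (4 * t)%:R + 1 : R) <= 2 * (sm.+1%:R - (2 * t)%:R).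
  have : (n + 2 <= 2 * sm.+1)%N by rewrite /sm; lia.
  rewrite -(ler_nat R) natrD !natrM; lra.
have t0 : 0 < t%:R :> R by rewrite ltr0n st_gt0.
have D0 := kapD_gt0; set D := (n%:R + 1 - _) in h D0.
have E : kap * D = 4 * t%:R by rewrite /kap divfK ?gt_eqF// natrM.
rewrite /theta; set Z := (_ - _) in h *.
have : kap * (D + 1) <= kap * (2 * Z) by rewrite ler_pM2l ?kap_gt0.
have := kap_gt0; rewrite mulrDr E natrM; lra.
Qed.

Lemma map_emb_pnorm (v : absval R K) (Q : {poly K}) :
  pnorm (cabs v) (map_poly (emb v) Q) = pnorm v Q.
Proof.
rewrite /pnorm size_map_poly; apply: eq_bigr => i _.
by rewrite coef_map; exact: cabs_emb.
Qed.

Lemma system_adm : exists2 b : place R K -> R, adm b &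
  forall (v : place R K) (Q : {poly K}), pnorm v Q <= 1 ->
    forall i j, v (sysmx (sa S) (sc S) n t ss (sg S) Q sm.+1 i j) <= b v.
Proof.
have [b hb Hb] := @adm_fam R K _ (fun r : 'I_sm.+1 * 'I_#|{: 'I_t.+1 * 'I_ss}| * ('I_n.+1 * 'I_n.+1) =>
  (sh (enum_val r.1.2).1 'X^(r.1.1) * 'X^((enum_val r.1.2).2))`_(r.2.1) * sg S r.2.1 r.2.2).
exists (fun v : place R K => avc v n.+1%:R * (avc v n.+1%:R * b v)).
  by do 2?apply: admM => //; apply: adm_avc; rewrite ler1n.
move=> v Q nQ i j; rewrite mxE /bil -[X in avc _ X%:R * (_ * _)]card_ord.
have b0 := adm_ge0 v hb.
apply: av_sum => [|k _].
  by rewrite mulr_ge0// (le_trans ler01)// avc_ge1// ler1n.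
rewrite -[X in avc _ X%:R * _]card_ord; apply: av_sum => // l _.
rewrite mulrAC av_mul -[leRHS]mulr1 ler_pM ?av_ge0//.
  exact: (Hb v ((i, j), (k, l))).
exact: le_trans (pnorm_coef _ _ _) nQ.
Qed.

End System.

Section DetBound.
Context {R : realType} {K : fieldExtType rat} {w : place R K} (S : setup w).
Local Notation n := (sn S).
Local Notation t := (st S).
Local Notation sh := (sh (sa S) (sc S)).
Local Notation ev Q l := (map_poly (emb w) Q).[sx S l].
Local Notation m := (sm S).
Local Notation kap := (kap S).
Local Notation theta := (theta S).

Lemma toepB_bound : exists2 B : R, 1 <= B & forall e d, (e <= m.+2)%N -> (d <= m.+2)%N -> toepB e d <= B.
Proof.
have [B B1 hB] := fin_bound (fun ed : 'I_m.+3 * 'I_m.+3 => toepB ed.1 ed.2 : R).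
exists B => // e d em dm; have := hB (inord e, inord d).
by rewrite /= !inordK.
Qed.

(** The factor [mu] from [det_key] is the same for all column selections, so the offset of the
    Toeplitz minor may depend on the place while [mu] does not. Away from [w] the system is bounded
    entrywise; at [w] it splits into a part of rank at most 2t and a small part. *)
Lemma det_system : exists2 c : place R K -> R, adm c & exists2 C : R, 1 <= C &
  forall (Y : R) (Q L : {poly K}) (e : nat), 1 <= Y -> sys S Y Q -> L != 0 ->
    (size L + e <= m.+2)%N ->
    (forall P, sker S Q P <-> exists2 D : {poly K}, (size D <= e)%N & P = L * D) ->
    exists2 mu : K, mu != 0 &
      (forall v : place R K, ~ same_place v w -> v mu * pnorm v L ^+ e <= c v) /\
      w mu * pnorm w L ^+ e <= C * Y `^ (kap * e%:R - theta).
Proof.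
have [b hb Hb] := system_adm S; have [B B1 hB] := toepB_bound.
have tn : (t <= n.+1)%N by have := sn_ge S; lia.
have [Cw Cw1 hC] := split_bound (cabs w) (emb w) (sx S) (su S) (sm_ss S) tn.
pose f1 : R := m.+1`!%:R; pose f2 : R := (2 * t + m.+1)`!%:R.
have f11 : 1 <= f1 by rewrite ler1n fact_gt0.
have f21 : 1 <= f2 by rewrite ler1n fact_gt0.
exists (fun v : place R K => avc v B * (avc v f1 * b v ^+ m.+1)).
  by do 2?apply: admM => //; [exact: adm_avc|exact: adm_avc|exact: admX].
exists (B * (f2 * Cw ^+ (2 * t + m.+1))).
  by rewrite !mulr_ege1// exprn_ege1.
move=> Y Q L e Y1 [Q0 sQ nQ wQ smQ] L0 sLe hL.
have Y0 : 0 < Y := lt_le_trans ltr01 Y1.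
have e_le : (e <= m.+1)%N by move: sLe; have := size_poly_gt0 L; rewrite L0; lia.
have [r re] : exists r, (r + e = m.+1)%N by exists (m.+1 - e)%N; rewrite subnK.
have [f [mu [mu0 key]]] := sysmx_det re L0 sLe hL.
exists mu => //.
pose S0 r0 : 'M[K]_(r + e, e) := \matrix_(i, j) (i == (r0 + j)%N :> nat)%:R.
have main (v : place R K) : exists r0 : nat, v mu * pnorm v L ^+ e <=
    avc v B * v (\det (row_mx (colsub f (sysmx (sa S) (sc S) n t (ss S) (sg S) Q (r + e))) (S0 r0))).
  have [r0 rL h] := toep_bound v e L0 (leqnn (size L)).
  exists r0; rewrite -key multmx_toep//; last by rewrite re.
  rewrite [v (_ * _)]av_mul mulrCA ler_wpM2l ?av_ge0//; apply: le_trans h _.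
  rewrite ler_wpM2r ?av_ge0//; apply: le_avc; apply: hB; first exact: leqW.
  by rewrite (leq_trans (leq_addr e _)).
have S0v (v : place R K) r0 i j : v (S0 r0 i j) <= 1.
  by rewrite mxE; case: eqP => _; rewrite ?av1 ?av0.
split=> [v vw|].
  have [r0 h] := main v; apply: le_trans h _.
  rewrite ler_wpM2l//; first by rewrite (le_trans ler01)// avc_ge1.
  rewrite /f1 -re; apply: det_le_unif => i j; rewrite mxE.
  have b1 := adm_ge1 v hb.
  case: (fintype.split j) => k; last exact: le_trans (S0v _ _ _ _) b1.
  have := Hb v Q (nQ v vw) (cast_ord re i) (f k).
  by rewrite !mxE.
have [r0 h] := main w; apply: le_trans h _; rewrite -mulrA.
have B0 : 0 <= B by lra.
apply: ler_pM; rewrite ?av_ge0//; first by rewrite (le_trans ler01)// avc_ge1.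
  exact: avc_le.
pose d := Y `^ (- kap).
have d0 : 0 < d by rewrite powR_gt0.
have d1 : d <= 1.
  rewrite /d powRN invf_le1 ?powR_gt0//.
  have e1 : 1 = (1 : R) `^ kap by rewrite powR1.
  by rewrite {1}e1 ge0_ler_powR ?nnegrE// ltW// kap_gt0.
have := hC Q Y d (ltW Y0) (ltW d0) sQ; rewrite map_emb_pnorm => /(_ wQ smQ)[hV hU hN].
rewrite -[w _]cabs_emb -det_map_mx map_row_mx.
have -> : map_mx (emb w) (colsub f (sysmx (sa S) (sc S) n t (ss S) (sg S) Q (r + e))) =
    vmx t (sx S) (r + e) *m colsub f (umx (emb w) n t (ss S) (sx S) (su S) Q) +
    colsub f (nmx (emb w) n t (ss S) (sx S) (su S) Q (r + e)).
  have := sysmx_split (sa_neq0 S) (@sxS _ _ _ S) (spairing S) (sm_ss S) tn sQ re.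
  move=> /matrixP E; apply/matrixP => i j; have := E i (f j); rewrite !mxE => ->.
  by congr (_ + _); apply: eq_bigr => k _; rewrite !mxE.
apply: le_trans (det_low_rank_le Cw1 Y1 d0 d1 _ _ _ _) _.
- by move=> i j; have := hU i (f j); rewrite !mxE.
- by move=> i j; have := hV (cast_ord re i) j; rewrite !mxE.
- by move=> i j; have := hN (cast_ord re i) (f j); rewrite !mxE.
- by move=> i j; rewrite mxE cabs_emb; exact: le_trans (S0v _ _ _ _) Cw1.
rewrite re -/f2 -!mulrA; apply: ler_pM.
- by rewrite (le_trans ler01)// avc_ge1.
- by rewrite !mulr_ge0 ?exprn_ge0 ?ltW ?divr_gt0//; lra.
- exact: avc_le.
rewrite mulrCA ler_wpM2l ?exprn_ge0//; first by lra.
have -> : Y / d = Y `^ (1 + kap).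
  rewrite /d powRN invrK powRD; last by rewrite (gt_eqF Y0) implybT.
  by rewrite powRr1// ltW.
rewrite -!powR_mulrn ?powR_ge0// -!powRrM -powRD ?(gt_eqF Y0) ?implybT//.
rewrite le_eqVlt; apply/orP; left; apply/eqP; congr (_ `^ _).
rewrite /theta -re natrD natrM [(4 * t)%:R * (_ * _)]mulrA -[(4 * t)%:R / _]/kap; ring.
Qed.

End DetBound.

(** * Heights *)

Lemma powR_large (R : realType) (B s : R) : 0 < s ->
  exists2 Z : R, 1 <= Z & forall Y, Z <= Y -> B <= Y `^ s.
Proof.
move=> s0; pose B1 := Num.max 1 B; have B11 : 1 <= B1 by rewrite le_max lexx.
have B10 : 0 < B1 by lra.
have si : 0 < s^-1 by rewrite invr_gt0.
exists (B1 `^ s^-1) => [|Y hY].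
  have e1 : 1 = (1 : R) `^ s^-1 by rewrite powR1.
  by rewrite {1}e1 ge0_ler_powR ?nnegrE// ltW.
apply: (@le_trans _ _ B1); first by rewrite le_max lexx orbT.
have -> : B1 = (B1 `^ s^-1) `^ s by rewrite -powRrM mulVf ?gt_eqF// powRr1// ltW.
by rewrite ge0_ler_powR ?nnegrE ?powR_ge0 ?(le_trans (powR_ge0 _ _) hY)// ltW.
Qed.

Section Height.
Context {R : realType} {K : fieldExtType rat} {w : place R K} (S : setup w).
Local Notation n := (sn S).
Local Notation t := (st S).
Local Notation m := (sm S).
Local Notation kap := (kap S).
Local Notation theta := (theta S).

(** Divisible by every [e <= m + 1], so that estimates with exponent [e] can be raised to one common
    exponent. *)
Definition hN := m.+1`!.
Definition theta' : R := theta / m.+1%:R.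

(* Up to adm constants, mu stands for the product of the norms of P over the
   places other than w, so h bounds a power of the height of P. *)
Definition Ht (c : place R K -> R) (P : {poly K}) (h : R) :=
  exists2 mu : K, mu != 0 &
    (forall v : place R K, ~ same_place v w -> v mu * pnorm v P ^+ hN <= c v) /\
    w mu * pnorm w P ^+ hN <= h.

Lemma hN_gt0 : (0 < hN)%N.
Proof. exact: fact_gt0. Qed.

Lemma theta'_gt0 : 0 < theta'.
Proof. by rewrite divr_gt0 ?theta_gt0// ltr0n. Qed.

(** The leading coefficient of [Q] is nonzero and bounded by 1 away from [w], so [star] applies to
    it. *)
Lemma sys_ge : exists2 e : R, 0 < e & forall Y Q, sys S Y Q -> e <= pnorm w Q.
Proof.
have [e e0 he] := star w (@adm1 R K); exists e => // Y Q [Q0 _ vQ _ _].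
have l0 : lead_coef Q != 0 by rewrite lead_coef_eq0.
apply: le_trans (pnorm_coef _ _ (size Q).-1); rewrite -lead_coefE; apply: he => // v vw.
by rewrite lead_coefE; exact: le_trans (pnorm_coef _ _ _) (vQ v vw).
Qed.

Lemma kernel_exists : exists2 c : place R K -> R, adm c & exists2 C : R, 1 <= C &
  exists2 Y0 : R, 1 <= Y0 & forall (Y : R) (Q : {poly K}), Y0 <= Y -> sys S Y Q ->
  exists (L : {poly K}) (e : nat), [/\ L != 0, (0 < e)%N, (size L <= m.+1)%N,
    forall P, sker S Q P <-> exists2 D : {poly K}, (size D <= e)%N & P = L * D &
    Ht c L (C * Y `^ (hN%:R * (kap - theta')))].
Proof.
have [c hc [C C1 key]] := det_system S.
have [eps eps0 heps] := star w hc.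
have [Z Z1 hZ] := powR_large (C / eps + 1) (theta_gt0 S).
exists (fun v => c v ^+ hN); first exact: admX.
exists (C ^+ hN); first exact: exprn_ege1.
exists Z => // Y Q ZY sQ; have Y1 : 1 <= Y := le_trans Z1 ZY.
have Y0 : 0 < Y := lt_le_trans ltr01 Y1.
have [ex|nex] := pselect (exists2 P, P != 0 & sker S Q P); last first.
  exfalso.
  have /(key Y Q 1 0%N Y1 sQ (oner_neq0 _)) : (size (1 : {poly K})%R + 0 <= m.+2)%N.
    by rewrite size_poly1.
  case=> [P|mu mu0 [hv hw]].
    split=> [kP|[D]]; last first.
      rewrite leqn0 size_poly_eq0 => /eqP -> ->; rewrite mulr0.
      split=> [|k _ B _]; first by rewrite size_poly0.
      by rewrite /sh comp_poly0 mul0r linear0.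
    exists 0; rewrite ?size_poly0// mulr0; apply/eqP/negPn/negP => P0.
    by apply: nex; exists P.
  have : eps <= w mu.
    by apply: heps => // v vw; have := hv v vw; rewrite expr0 mulr1.
  move: hw; rewrite expr0 mulr1 mulr0 sub0r powRN => hw hm.
  have := hZ Y ZY; have := le_trans hm hw.
  have T0 : 0 < Y `^ theta by rewrite powR_gt0.
  by rewrite ler_pdivlMr// mulrC -ler_pdivlMr//; lra.
have [L [e [L0 e0 hL]]] := shker_struct (sa_neq0 S) (sm_le_ss S) ex.
have sLe : (size L + e <= m.+2)%N.
  have /hL[+ _] : exists2 D : {poly K}, (size D <= e)%N & L * 'X^(e.-1) = L * D.
    by exists 'X^(e.-1); rewrite // size_polyXn prednK.
  by rewrite size_mulXn// -{2}(prednK e0); lia.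
have sL : (size L <= m.+1)%N by lia.
have e_le : (e <= m.+1)%N by move: sLe; have := size_poly_gt0 L; rewrite L0; lia.
exists L, e; split=> //.
have [mu mu0 [hv hw]] := key Y Q L e Y1 sQ L0 sLe hL.
have ek : (e * (hN %/ e))%N = hN by rewrite mulnC divnK// dvdn_fact// e0.
set k := (hN %/ e)%N in ek.
have kN : (k <= hN)%N by exact: leq_div.
exists (mu ^+ k); first by rewrite expf_neq0.
have E (v : absval R K) : v (mu ^+ k) * pnorm v L ^+ hN = (v mu * pnorm v L ^+ e) ^+ k.
  by rewrite avX -ek exprM exprMn.
split=> [v vw|]; rewrite E.
  apply: (@le_trans _ _ (c v ^+ k)); last by rewrite ler_weXn2l// adm_ge1.
  by apply: lerXn2r; rewrite ?nnegrE ?mulr_ge0 ?av_ge0 ?exprn_ge0 ?pnorm_ge0 ?adm_ge0// hv.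
apply: (@le_trans _ _ ((C * Y `^ (kap * e%:R - theta)) ^+ k)).
  apply: lerXn2r; rewrite ?nnegrE ?mulr_ge0 ?av_ge0 ?exprn_ge0 ?pnorm_ge0 ?powR_ge0//.
  by lra.
rewrite exprMn ler_pM ?exprn_ge0 ?powR_ge0//; [by lra|by rewrite ler_weXn2l|].
rewrite -powR_mulrn ?powR_ge0// -powRrM ler_powR//.
have k0 : 0 <= k%:R :> R by [].
(* The saving theta is collected hN/e times, hence at least hN/(m+1) times. *)
have tk : theta' * hN%:R <= theta * k%:R.
  rewrite /theta' -mulrA ler_pM2l ?theta_gt0// mulrC ler_pdivrMr ?ltr0n//.
  by rewrite -natrM ler_nat -ek mulnC leq_mul2l e_le orbT.
rewrite mulrBl mulrBr -mulrA -natrM ek.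
by rewrite [hN%:R * theta']mulrC [hN%:R * _]mulrC; lra.
Qed.

End Height.

(** * Values along the orbit and coordinates of the pairing *)

Section Small.
Context {R : realType} {K : fieldExtType rat} {w : place R K} (S : setup w).
Local Notation n := (sn S).
Local Notation t := (st S).
Local Notation m := (sm S).
Local Notation kap := (kap S).
Local Notation sh := (sh (sa S) (sc S)).
Local Notation ev Q l := (map_poly (emb w) Q).[sx S l].

(** The coordinates of [Q] under the pairing: pairing with P gives the sum of the P(x_k) weighted by
    these. By triangularity the k-th one involves [Q] only at x_l with l >= k. *)
Definition bk (Q : {poly K}) (k : nat) := \sum_(l < n.+1) su S k l * ev Q l.

Lemma ev_sh k p (P : {poly K}) : ev (sh k P) p = ev P (p + k)%N.
Proof. exact: (horner_sh _ _ _ (@sxS _ _ _ S)). Qed.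

Lemma emb_bil (Q P : {poly K}) b : (size Q <= n.+1)%N -> (size P <= m.+1)%N -> (b < ss S)%N ->
  emb w (bil n (sg S) Q (P * 'X^b)) = \sum_(k < n.+1) ev P k * sx S k ^+ b * bk Q k.
Proof.
move=> sQ sP bs; have [_ _ tE] := spairing S.
have sPb : (size (P * 'X^b)%R <= n.+1)%N.
  apply: leq_trans (size_polyMleq _ _) _; rewrite size_polyXn.
  by have := sm_ss S; move: sP bs; move: (size P) => z; lia.
rewrite [LHS](tE _ _ sPb sQ); apply: eq_bigr => k _.
rewrite rmorphM/= hornerM map_polyXn hornerXn /bk mulr_sumr.
by apply: eq_bigr => l _; rewrite mulrA.
Qed.

(** The relation is linear in the multiplier, hence extends from [K] to the completion. This allows
    multipliers with prescribed zeros on the orbit. *)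
Lemma ann_emb (Q P : {poly K}) (B : {poly completion w}) :
  (size Q <= n.+1)%N -> (size P <= m.+1)%N -> (size B <= ss S)%N ->
  ann (bil n (sg S) Q) (ss S) P -> \sum_(k < n.+1) ev P k * B.[sx S k] * bk Q k = 0.
Proof.
move=> sQ sP sB aP.
transitivity (\sum_(b < ss S) B`_b * emb w (bil n (sg S) Q (P * 'X^b))); last first.
  by rewrite big1// => b _; rewrite aP ?size_polyXn// rmorph0 mulr0.
rewrite (eq_bigr (fun b : 'I_(ss S) => \sum_(k < n.+1) B`_b * (ev P k * sx S k ^+ b * bk Q k))); last first.
  by move=> b _; rewrite emb_bil// mulr_sumr.
rewrite exchange_big/=; apply: eq_bigr => k _.
move: (bk Q k) => z; rewrite (horner_coef_wide _ sB) mulr_sumr mulr_suml.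
by apply: eq_bigr => b _; ring.
Qed.

Lemma bk_le : exists2 C : R, 1 <= C & forall (Q : {poly K}) k b, 0 <= b -> (k <= n)%N ->
  (forall l, (k <= l <= n)%N -> cabs w (ev Q l) <= b) -> cabs w (bk Q k) <= C * b.
Proof.
have [B B1 hB] := fin_bound (fun kl : 'I_n.+1 * 'I_n.+1 => cabs w (su S kl.1 kl.2)).
exists (n.+1%:R * B) => [|Q k b b0 kn h]; first by rewrite mulr_ege1// ler1n.
rewrite /bk -mulrA -[X in X%:R * _]card_ord; apply: av_sum_le => [|l _].
  by rewrite mulr_ge0//; lra.
have [u0 _ _] := spairing S.
have [lk|kl] := ltnP l k; first by rewrite u0// mul0r av0 mulr_ge0//; lra.
rewrite av_mul ler_pM ?av_ge0//; last by apply: h; rewrite kl -ltnS ltn_ord.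
by have := hB (inord k, l); rewrite /= inordK.
Qed.

Lemma ev_le : exists2 C : R, 1 <= C & forall (P : {poly K}) l, (l <= 2 * n)%N -> (size P <= n.+1)%N ->
  cabs w (ev P l) <= C * pnorm w P.
Proof.
have [B B1 hB] := fin_bound (fun l : 'I_(2 * n).+1 => cabs w (sx S l)).
have B0 : 0 <= B by lra.
exists (n.+1%:R * B ^+ n.+1) => [|P l ln sP].
  by rewrite mulr_ege1 ?exprn_ege1// ler1n.
have hl : cabs w (sx S l) <= B by have := hB (inord l); rewrite inordK.
apply: le_trans (horner_le _ B1 hl) _; first by rewrite size_map_poly; exact: sP.
rewrite map_emb_pnorm -mulrA [B ^+ _ * _]mulrC ler_wpM2r ?mulr_ge0 ?pnorm_ge0 ?exprn_ge0//.
by apply: avc_le; rewrite ler1n.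
Qed.

(** The coefficients of [Q] pass to these coordinates through a Vandermonde matrix at distinct
    points and a triangular matrix, both invertible. *)
Lemma norm_le_bk : exists2 C : R, 1 <= C & forall (Q : {poly K}) b, 0 <= b -> (size Q <= n.+1)%N ->
  (forall k, (k <= n)%N -> cabs w (bk Q k) <= b) -> pnorm w Q <= C * b.
Proof.
pose V : 'M[completion w]_n.+1 := Vandermonde n.+1 (\row_(l < n.+1) sx S l).
pose U : 'M[completion w]_n.+1 := \matrix_(l, k) su S k l.
have [u0 u1 _] := spairing S.
have uV : V *m U \in unitmx.
  rewrite unitmx_mul !unitmxE !unitfE; apply/andP; split.
    rewrite det_Vandermonde; apply/prodf_neq0 => i _; apply/prodf_neq0 => j ij.
    rewrite !mxE subr_eq0 eq_sym; apply: sx_inj.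
    by rewrite ij -ltnS ltn_ord.
  rewrite det_trig; first by apply/prodf_neq0 => i _; rewrite mxE u1.
  by apply/is_trig_mxP => i j ij; rewrite mxE u0.
have [B B1 hB] := fin_bound (fun ij : 'I_n.+1 * 'I_n.+1 => cabs w (invmx (V *m U) ij.1 ij.2)).
exists (n.+1%:R * B) => [|Q b b0 sQ h]; first by rewrite mulr_ege1// ler1n.
have B0 : 0 <= B by lra.
pose qv : 'rV[completion w]_n.+1 := \row_i emb w Q`_i.
have E k : (qv *m (V *m U)) 0 k = bk Q k.
  rewrite mulmxA mxE /bk; apply: eq_bigr => l _; rewrite !mxE mulrC; congr (_ * _).
  rewrite (horner_coef_wide _ (_ : size (map_poly (emb w) Q) <= n.+1)%N) ?size_map_poly//.
  by apply: eq_bigr => i _; rewrite !mxE coef_map.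
rewrite -mulrA; apply: pnorm_le => [|i]; first by rewrite !mulr_ge0.
have [iN|Ni] := ltnP i n.+1; last first.
  by rewrite nth_default ?(leq_trans sQ)// av0 !mulr_ge0.
have -> : Q`_i = Q`_(Ordinal iN) by [].
rewrite -cabs_emb; have -> : emb w Q`_(Ordinal iN) = qv 0 (Ordinal iN) by rewrite mxE.
rewrite -[qv](mulmxK uV) mxE -[X in X%:R * _]card_ord; apply: av_sum_le => [|k _].
  by rewrite !mulr_ge0.
rewrite av_mul mulrC ler_pM ?av_ge0//; first exact: (hB (k, Ordinal iN)).
by rewrite E h// -ltnS.
Qed.

End Small.

Section Test.
Context {R : realType} {K : fieldExtType rat} {w : place R K} (S : setup w).
Local Notation n := (sn S).
Local Notation t := (st S).
Local Notation m := (sm S).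
Local Notation kap := (kap S).
Local Notation sh := (sh (sa S) (sc S)).
Local Notation ev Q l := (map_poly (emb w) Q).[sx S l].

(** The coordinates [bk] of [Q] cannot all be small compared with its norm, and those of index at
    least t are; so one of index k0 < t is comparable to the norm. A multiplier vanishing at the
    other x_i with i < t isolates the value of each shift of [L] at x_k0. *)
Lemma small_values : exists2 C : R, 1 <= C & exists2 Y1 : R, 1 <= Y1 &
  forall (Y : R) (Q L : {poly K}), Y1 <= Y -> sys S Y Q -> sker S Q L ->
  exists2 k0, (k0 < t)%N & forall k, (k <= t)%N ->
    cabs w (ev L (k0 + k)%N) * pnorm w Q <= C * (pnorm w L * Y `^ (- kap)).
Proof.
have [Cb Cb1 hCb] := bk_le S; have [Ce Ce1 hCe] := ev_le S.
have [Cn Cn1 hCn] := norm_le_bk S; have [eps eps0 heps] := sys_ge S.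
have tn : (t <= n)%N by have := sn_ge S; lia.
pose B (j : nat) : {poly completion w} := \prod_(i < t | i != j :> nat) ('X - (sx S i)%:P).
have [BB BB1 hBB] := fin_bound (fun jk : 'I_t * 'I_n.+1 => cabs w (B jk.1).[sx S jk.2]).
have [BI BI1 hBI] := fin_bound (fun j : 'I_t => (cabs w (B j).[sx S j])^-1).
have sB j : (size (B j) <= ss S)%N.
  apply: leq_trans (size_poly_prod_leq _ _) _.
  under eq_bigr do rewrite size_XsubC.
  set A := (X in #|X|); have := max_card A; rewrite card_ord sum_nat_const => hA.
  have := t2_le_sm S; have := sm_le_ss S; have := st_gt0 S; move: hA.
  by move: #|A| => z; lia.
have [Z Z1 hZ] := powR_large (2 * Cn * Cb / eps) (kap_gt0 S).
pose C := 2 * Cn * BI * (n.+1%:R * (Ce * BB * Cb)).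
exists C; first by rewrite /C !mulr_ege1// ?ler1n//; lra.
exists Z => // Y Q L ZY sysQ [sL aL].
have [Q0 sQ nQ wQ smQ] := sysQ.
have e_le := heps _ _ sysQ; have q0 : 0 < pnorm w Q := lt_le_trans eps0 e_le.
have Y0 : 0 < Y by rewrite (lt_le_trans ltr01)// (le_trans Z1).
pose d := Y `^ (- kap); have d0 : 0 < d by rewrite powR_gt0.
have bt k : (t <= k <= n)%N -> cabs w (bk S Q k) <= Cb * d.
  move=> /andP[tk kn]; apply: hCb => //; first exact: ltW.
  by move=> l /andP[kl ln]; apply: smQ; rewrite (leq_trans tk kl).
have dle : 2 * Cn * (Cb * d) <= pnorm w Q.
  apply: le_trans e_le; have := hZ Y ZY; rewrite ler_pdivrMr// => h.
  by rewrite /d powRN mulrA ler_pdivrMr ?powR_gt0// [leRHS]mulrC.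
have [j hj] : exists j : 'I_t, pnorm w Q <= 2 * Cn * cabs w (bk S Q j).
  apply: contrapT => no.
  have hb k : (k <= n)%N -> cabs w (bk S Q k) <= pnorm w Q / (2 * Cn).
    move=> kn; rewrite ler_pdivlMr ?mulr_gt0//; try lra.
    rewrite mulrC; have [kt|tk] := ltnP k t.
      rewrite leNgt; apply/negP => h; apply: no.
      by exists (Ordinal kt); apply: ltW.
    apply: le_trans dle; rewrite ler_wpM2l ?mulr_ge0//; try lra.
    by apply: bt; rewrite tk.
  have := hCn Q _ _ sQ hb; rewrite divr_ge0 ?pnorm_ge0 ?mulr_ge0//; try lra.
  move=> /(_ isT); have -> : Cn * (pnorm w Q / (2 * Cn)) = pnorm w Q / 2.
    by field; rewrite gt_eqF//; lra.
  by lra.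
exists j => // k kt.
have sP : (size (sh k L) <= m.+1)%N by rewrite size_sh ?sa_neq0.
have jn : (j < n.+1)%N by rewrite ltnS (leq_trans (ltnW (ltn_ord j))).
have := ann_emb sQ sP (sB j) (aL k kt).
rewrite (bigID (fun i : 'I_n.+1 => (i < t)%N))/= (bigD1 (Ordinal jn))//=.
rewrite [X in _ + X + _]big1 ?addr0; last first.
  move=> i /andP[it ij].
  have -> : (B j).[sx S i] = 0; last by rewrite mulr0 mul0r.
  apply/eqP; rewrite horner_prod; apply/prodf_eq0.
  by exists (Ordinal it); rewrite ?hornerXsubC ?subrr//.
move=> /eqP; rewrite addr_eq0 => /eqP E0.
have {}E0 := congr1 (cabs w) E0.
have Bj0 : 0 < cabs w (B j).[sx S j].
  apply: av_gt0; rewrite horner_prod; apply/prodf_neq0 => i ij.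
  rewrite hornerXsubC subr_eq0; have [lt|gt|e] := ltngtP j i; last by rewrite e eqxx in ij.
    by apply: sx_inj; rewrite lt (leq_trans (ltnW (ltn_ord i))).
  by rewrite eq_sym; apply: sx_inj; rewrite gt (leq_trans (ltnW (ltn_ord j))).
have Ce0 : 0 <= Ce by lra.
have Cb0 : 0 <= Cb by lra.
have BB0 : 0 <= BB by lra.
have up : cabs w (ev L (j + k)%N) * cabs w (B j).[sx S j] * cabs w (bk S Q j) <=
    n.+1%:R * (Ce * pnorm w L * BB * (Cb * d)).
  have -> : cabs w (ev L (j + k)%N) * cabs w (B j).[sx S j] * cabs w (bk S Q j) =
      cabs w (ev (sh k L) j * (B j).[sx S j] * bk S Q j) by rewrite ev_sh !av_mul.
  rewrite [leLHS]E0 avN -[X in X%:R * _]card_ord; apply: av_sum_le => [|i it].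
    by rewrite !mulr_ge0 ?pnorm_ge0// ltW.
  rewrite -leqNgt in it; have iN : (i <= n)%N by rewrite -ltnS.
  rewrite 2!av_mul ev_sh !ler_pM ?mulr_ge0 ?av_ge0//.
  - apply: hCe; first by rewrite mul2n -addnn leq_add// (leq_trans kt).
    by rewrite (leq_trans sL)// ltnS sm_le_n.
  - exact: (hBB (j, i)).
  - by apply: bt; rewrite it.
have BIj := hBI j.
set T := cabs w (ev L _) in up *; have T0 : 0 <= T by exact: av_ge0.
apply: (@le_trans _ _ (T * (2 * Cn * cabs w (bk S Q j)))); first by rewrite ler_wpM2l.
have up2 : T * cabs w (bk S Q j) <= n.+1%:R * (Ce * pnorm w L * BB * (Cb * d)) * BI.
  apply: (@le_trans _ _ (n.+1%:R * (Ce * pnorm w L * BB * (Cb * d)) / cabs w (B j).[sx S j])).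
    by rewrite ler_pdivlMr// mulrAC.
  by rewrite ler_wpM2l// !mulr_ge0 ?pnorm_ge0// ltW.
have -> : C * (pnorm w L * d) = 2 * Cn * (n.+1%:R * (Ce * pnorm w L * BB * (Cb * d)) * BI).
  by rewrite /C; ring.
by rewrite mulrCA ler_wpM2l// mulr_ge0//; lra.
Qed.

End Test.

Section Test.
Context {R : realType} {K : fieldExtType rat} {w : place R K} (S : setup w).
Local Notation n := (sn S).
Local Notation t := (st S).
Local Notation m := (sm S).
Local Notation kap := (kap S).
Local Notation sh := (sh (sa S) (sc S)).
Local Notation ev Q l := (map_poly (emb w) Q).[sx S l].

Lemma bil_adm : exists2 c : place R K -> R, adm c &
  forall (v : place R K) (Q P : {poly K}) k b, (k <= t)%N -> (size P <= m.+1)%N -> pnorm v Q <= 1 ->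
    v (bil n (sg S) Q (sh k P * 'X^b)) <= c v * pnorm v P.
Proof.
have [c1 hc1 h1] := @adm_lin R K _ (fun k : 'I_t.+1 => comp_poly (aff (sa S) (sc S) k)) m.+1.
have [c2 hc2 h2] := @adm_fam R K _ (fun xy : 'I_n.+1 * 'I_n.+1 => sg S xy.1 xy.2).
exists (fun v : place R K => avc v n.+1%:R * (avc v n.+1%:R * (c1 v * c2 v))).
  by do 2?[apply: admM; first by apply: adm_avc; rewrite ler1n]; exact: admM.
move=> v Q P k b kt sP nQ; rewrite /bil -!mulrA -[X in avc _ X%:R * (avc _ _ * _)]card_ord.
have c10 := adm_ge0 v hc1; have c20 := adm_ge0 v hc2.
have N1 : 0 <= avc v (n.+1%:R : R) by rewrite (le_trans ler01)// avc_ge1// ler1n.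
apply: av_sum => [|x _]; first by rewrite !mulr_ge0 ?pnorm_ge0.
rewrite -[X in avc _ X%:R * _]card_ord; apply: av_sum => [|y _]; first by rewrite !mulr_ge0 ?pnorm_ge0.
have hP : v (sh k P * 'X^b)`_x <= c1 v * pnorm v P.
  rewrite coefMXn; case: ifP => _; first by rewrite av0 mulr_ge0 ?pnorm_ge0.
  apply: le_trans (pnorm_coef _ _ _) _; have := h1 v (inord k) P sP.
  by rewrite inordK.
have hQ : v Q`_y <= 1 := le_trans (pnorm_coef _ _ _) nQ.
have hg := h2 v (x, y).
have -> : c1 v * (c2 v * pnorm v P) = c1 v * pnorm v P * 1 * c2 v by ring.
by rewrite 2!av_mul !ler_pM ?mulr_ge0 ?av_ge0.
Qed.

(* Otherwise some value of the pairing, a nonzero element of K, would violate the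
   product formula. *)
Lemma height_test (C0 : R) : 1 <= C0 ->
  exists2 Y1 : R, 1 <= Y1 & forall c : place R K -> R, adm c ->
  exists2 e : R, 0 < e & forall (Y Y' : R) (Q Q' L : {poly K}) k0, Y1 <= Y -> Y <= Y' ->
    sys S Y Q -> sys S Y' Q' -> pnorm w Q <= 2 * pnorm w Q' -> sker S Q' L ->
    (k0 < t)%N -> (forall k, (k <= t)%N ->
      cabs w (ev L (k0 + k)%N) * pnorm w Q' <= C0 * (pnorm w L * Y' `^ (- kap))) ->
    Ht S c L (e * Y `^ (kap * (hN S)%:R)) ->
    ann (bil n (sg S) Q) (ss S) (sh k0 L).
Proof.
move=> C01.
have [Cb Cb1 hCb] := bk_le S; have [Ce Ce1 hCe] := ev_le S.
have [c2 hc2 h2] := bil_adm.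
have [Bx Bx1 hBx] := fin_bound (fun kb : 'I_n.+1 * 'I_(ss S) => cabs w (sx S kb.1 ^+ nat_of_ord kb.2)).
have tn : (t <= n)%N by have := sn_ge S; lia.
exists 1 => // c hc.
have hcc : adm (fun v => c2 v ^+ hN S * c v) by apply: admM => //; exact: admX.
have [eps eps0 heps] := star w hcc.
have Ce0 : 0 <= Ce by lra.
have Cb0 : 0 <= Cb by lra.
have Bx0 : 0 <= Bx by lra.
have C00 : 0 <= C0 by lra.
have C02 : 1 <= 2 * C0 by lra.
pose C4 := n.+1%:R * (2 * C0 * Ce * Cb * Bx).
have C41 : 1 <= C4 by rewrite /C4 !mulr_ege1// ?ler1n//; lra.
have C4N : 0 < C4 ^+ hN S by rewrite exprn_gt0//; lra.
(* Chosen so that the product tested in [star] comes out as at most eps/2. *)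
exists (eps / (2 * C4 ^+ hN S)); first by rewrite divr_gt0// mulr_gt0.
move=> Y Y' Q Q' L k0 Y1 YY' sysQ sysQ' QQ' [sL aL] k0t small [mu mu0 [hv hw]].
have [Q0 sQ nQ wQ smQ] := sysQ.
have Y0 : 0 < Y by lra.
pose d := Y `^ (- kap); have d0 : 0 < d by rewrite powR_gt0.
have d0' := ltW d0.
have dd : Y' `^ (- kap) <= d.
  rewrite /d !powRN lef_pV2 ?posrE ?powR_gt0//; last by lra.
  by rewrite ge0_ler_powR ?nnegrE ?(ltW (kap_gt0 S))//; lra.
have sP : (size (sh k0 L) <= m.+1)%N by rewrite size_sh ?sa_neq0.
have sLn : (size L <= n.+1)%N by rewrite (leq_trans sL)// ltnS sm_le_n.
have q'0 : 0 < pnorm w Q' by apply: pnorm_gt0; case: sysQ'.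
have main b : (b < ss S)%N -> bil n (sg S) Q (sh k0 L * 'X^b) = 0.
  move=> bs; apply/eqP/negPn/negP => z0; set z := bil _ _ _ _ in z0.
  have wz : w z <= C4 * (pnorm w L * d).
    rewrite -cabs_emb /z emb_bil// /C4 -mulrA -[X in X%:R * _]card_ord.
    apply: av_sum_le => [|k _]; first by rewrite !mulr_ge0 ?pnorm_ge0// ltW.
    have kn : (k <= n)%N by rewrite -ltnS.
    have hx := hBx (k, Ordinal bs); rewrite /= in hx.
    rewrite 2!av_mul ev_sh.
    have bQ : cabs w (bk S Q k) <= Cb * (Ce * (2 * pnorm w Q')).
      apply: hCb => //; first by rewrite !mulr_ge0 ?pnorm_ge0.
      move=> l /andP[_ ln]; apply: (le_trans (hCe Q l _ sQ)); first by rewrite (leq_trans ln)// leq_pmull.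
      by rewrite ler_wpM2l.
    have eL : cabs w (ev L (k + k0)%N) <= Ce * pnorm w L by apply: hCe => //; rewrite mul2n -addnn leq_add// (leq_trans (ltnW k0t)).
    (* For k < t the value of [L] is small relative to the norm of [Q'], which cancels against the
       bound for [bk S Q k]; for k >= t that coordinate is itself small. *)
    have [kt|tk] := ltnP k t.
      have := small k (ltnW kt); rewrite addnC -ler_pdivlMr// => h1.
      apply: (@le_trans _ _ (C0 * (pnorm w L * Y' `^ (- kap)) / pnorm w Q' * Bx * (Cb * (Ce * (2 * pnorm w Q'))))).
        by rewrite !ler_pM ?mulr_ge0 ?av_ge0.
      have -> : C0 * (pnorm w L * Y' `^ (- kap)) / pnorm w Q' * Bx * (Cb * (Ce * (2 * pnorm w Q'))) =
         2 * C0 * Ce * Cb * Bx * (pnorm w L * Y' `^ (- kap)) by field; rewrite gt_eqF.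
      by rewrite !ler_wpM2l ?mulr_ge0 ?pnorm_ge0.
    have bs' : cabs w (bk S Q k) <= Cb * d.
      apply: hCb => //.
      by move=> l /andP[kl ln]; apply: smQ; rewrite (leq_trans tk kl).
    apply: (@le_trans _ _ (Ce * pnorm w L * Bx * (Cb * d))).
      by rewrite !ler_pM ?mulr_ge0 ?av_ge0.
    have -> : Ce * pnorm w L * Bx * (Cb * d) = 1 * (Ce * Cb * Bx * (pnorm w L * d)) by ring.
    have -> : 2 * C0 * Ce * Cb * Bx * (pnorm w L * d) = 2 * C0 * (Ce * Cb * Bx * (pnorm w L * d)) by ring.
    by rewrite ler_wpM2r// !mulr_ge0 ?pnorm_ge0.
  have : eps <= w (mu * z ^+ hN S).
    apply: heps; first by rewrite mulf_neq0// expf_neq0.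
    move=> v vw; rewrite av_mul avX.
    have hz : v z ^+ hN S <= c2 v ^+ hN S * pnorm v L ^+ hN S.
      rewrite -exprMn lerXn2r ?nnegrE ?mulr_ge0 ?av_ge0 ?pnorm_ge0 ?(adm_ge0 _ hc2)//.
      by apply: h2 => //; [exact: ltnW|exact: nQ].
    apply: (@le_trans _ _ (v mu * (c2 v ^+ hN S * pnorm v L ^+ hN S))).
      by rewrite ler_wpM2l ?av_ge0.
    rewrite mulrCA ler_wpM2l ?exprn_ge0 ?(adm_ge0 _ hc2)//.
    exact: hv.
  apply/negP; rewrite -ltNge av_mul avX.
  apply: (@le_lt_trans _ _ (w mu * (C4 * (pnorm w L * d)) ^+ hN S)).
    have C40 : 0 <= C4 by lra.
    by rewrite ler_wpM2l ?av_ge0// lerXn2r ?nnegrE ?mulr_ge0 ?av_ge0 ?pnorm_ge0.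
  have -> : w mu * (C4 * (pnorm w L * d)) ^+ hN S = C4 ^+ hN S * d ^+ hN S * (w mu * pnorm w L ^+ hN S).
    by rewrite !exprMn; ring.
  apply: (@le_lt_trans _ _ (C4 ^+ hN S * d ^+ hN S * (eps / (2 * C4 ^+ hN S) * Y `^ (kap * (hN S)%:R)))).
    by rewrite ler_wpM2l// mulr_ge0 ?exprn_ge0//; lra.
  have -> : d ^+ hN S = (Y `^ (kap * (hN S)%:R))^-1.
    by rewrite -powR_mulrn ?powR_ge0// /d -powRrM mulNr powRN.
  have p0 : 0 < Y `^ (kap * (hN S)%:R) by rewrite powR_gt0.
  have -> : C4 ^+ hN S * (Y `^ (kap * (hN S)%:R))^-1 * (eps / (2 * C4 ^+ hN S) * Y `^ (kap * (hN S)%:R)) = eps / 2.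
    by field; rewrite !gt_eqF.
  by lra.
move=> B sB; rewrite -[B](poly_rV_K sB) /rVpoly poly_def mulr_sumr linear_sum big1// => b _.
by rewrite -scalerAr linearZ/= valK main ?mulr0.
Qed.

End Test.

(** * Comparison of two parameters *)

Section Near.
Context {F : fieldType} (a c : F).

(** Shift indices are natural numbers, so translations in either direction are expressed by shifting
    both polynomials. *)
Definition snear D (P Q : {poly F}) :=
  exists k l, [/\ (k <= D)%N, (l <= D)%N & sh a c k P %= sh a c l Q].

Lemma snear_refl D P : snear D P P.
Proof. by exists 0%N, 0%N; split=> //; exact: eqpxx. Qed.

Lemma snear_sym D P Q : snear D P Q -> snear D Q P.
Proof. by move=> [k [l [kD lD e]]]; exists l, k; rewrite eqp_sym. Qed.

Lemma snear_le D E P Q : (D <= E)%N -> snear D P Q -> snear E P Q.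
Proof. by move=> DE [k [l [kD lD e]]]; exists k, l; split=> //; exact: leq_trans DE. Qed.

Lemma snear_trans D E P Q T : a != 0 -> snear D P Q -> snear E Q T -> snear (D + E) P T.
Proof.
move=> a0 [k [l [kD lD e]]] [k' [l' [kE lE e']]].
exists (k + k')%N, (l + l')%N; split; [by lia|by lia|].
apply: (@eqp_trans _ (sh a c (l + k') Q)); first by rewrite !shD sh_eqp.
by rewrite addnC [(l + l')%N]addnC !shD sh_eqp.
Qed.

End Near.

Section Family.
Context {R : realType} {K : fieldExtType rat} {w : place R K} (S : setup w).
Local Notation n := (sn S).
Local Notation t := (st S).
Local Notation m := (sm S).
Local Notation kap := (kap S).
Local Notation sh := (sh (sa S) (sc S)).
Local Notation snear := (snear (sa S) (sc S)).
Local Notation ev Q l := (map_poly (emb w) Q).[sx S l].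

(** All that the study of recurring factors uses; the polynomials Q disappear from here on. In
    [gf_div] the index [k] does not depend on [j], which is what later yields t + 1 divisors of one
    L. *)
Record good_family (L : R -> {poly K}) (Y0 : R) : Prop := GoodFamily {
  gf_ge1 : 1 <= Y0;
  gf_size : forall Y, Y0 <= Y -> L Y != 0 /\ (size (L Y) <= m.+1)%N;
  gf_ht : exists2 c : place R K -> R, adm c & exists2 C : R, 1 <= C &
    forall Y, Y0 <= Y -> Ht S c (L Y) (C * Y `^ ((hN S)%:R * (kap - theta' S)));
  gf_small : exists2 C : R, 1 <= C & forall Y, Y0 <= Y ->
    exists2 k0, (k0 < t)%N & cabs w (ev (L Y) k0) <= C * (pnorm w (L Y) * Y `^ (- kap));
  gf_div : forall Y (P : {poly K}), Y0 <= Y -> irreducible_poly P -> P %| L Y ->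
    exists2 k, (k <= t)%N & forall j, (j <= t)%N -> sh k P %| sh j (L Y);
  gf_test : forall c : place R K -> R, adm c -> exists2 e : R, 0 < e &
    forall Y Y', Y0 <= Y -> Y <= Y' -> Ht S c (L Y') (e * Y `^ (kap * (hN S)%:R)) ->
    forall P : {poly K}, irreducible_poly P -> P %| L Y ->
    exists2 P' : {poly K}, irreducible_poly P' /\ P' %| L Y' & snear t P P' }.

(** The infimum of the norms need not be attained, but it is at least the bound from [sys_ge];
    exceeding it by less than that bound costs at most a factor 2. Near-minimality provides the norm
    comparison required by [height_test]. *)
Lemma near_minimal Y : (exists Q, sys S Y Q) ->
  exists2 Q, sys S Y Q & forall Q', sys S Y Q' -> pnorm w Q <= 2 * pnorm w Q'.
Proof.
move=> [Q0 hQ0]; have [e e0 he] := sys_ge S.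
pose E : set R := [set r | exists2 Q, sys S Y Q & r = pnorm w Q].
have lbE : lbound E e by move=> r [Q hQ ->]; exact: he hQ.
have hE : has_inf E by split; [exists (pnorm w Q0), Q0|exists e].
have infE : e <= inf E by apply: lb_le_inf => //; exists (pnorm w Q0), Q0.
have [r [Q hQ ->] hr] := inf_adherent e0 hE.
exists Q => // Q' hQ'.
have : inf E <= pnorm w Q' by apply: ge_inf; [exists e|exists Q'].
lra.
Qed.

Lemma family_exists : (exists Z, forall Y, Z <= Y -> exists Q, sys S Y Q) ->
  exists L Y0, good_family L Y0.
Proof.
move=> [Z0 hZ0].
have [c1 hc1 [C1 C11 [Z1 Z11 hker]]] := kernel_exists S.
have [C2 C21 [Z2 Z21 hsmall]] := small_values S.
have [Z3 Z31 htest] := height_test S C21.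
have [eps eps0 heps] := sys_ge S.
pose Y0 := Num.max (Num.max Z0 Z1) (Num.max Z2 Z3).
have Y0E Y : Y0 <= Y -> [/\ Z0 <= Y, Z1 <= Y, Z2 <= Y & Z3 <= Y].
  by rewrite !ge_max => /andP[/andP[-> ->] /andP[-> ->]].
have /choice[Q hQ] : forall Y, exists Q : {poly K}, Y0 <= Y -> sys S Y Q /\
    forall Q', sys S Y Q' -> pnorm w Q <= 2 * pnorm w Q'.
  move=> Y; have [hY|hY] := pselect (Y0 <= Y); last by exists 0 => /hY.
  have [z0 _ _ _] := Y0E _ hY; have [Q hQ mQ] := near_minimal (hZ0 _ z0).
  by exists Q.
have /choice[L hL] : forall Y, exists L : {poly K}, Y0 <= Y ->
    exists e, [/\ L != 0, (0 < e)%N, (size L <= m.+1)%N,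
    forall P, sker S (Q Y) P <-> exists2 D : {poly K}, (size D <= e)%N & P = L * D &
    Ht S c1 L (C1 * Y `^ ((hN S)%:R * (kap - theta' S)))].
  move=> Y; have [hY|hY] := pselect (Y0 <= Y); last by exists 0 => /hY.
  have [_ z1 _ _] := Y0E _ hY; have [sQ _] := hQ _ hY.
  by have [L [e H]] := hker _ _ z1 sQ; exists L => _; exists e.
have kerL Y : Y0 <= Y -> sker S (Q Y) (L Y).
  move=> hY; have [e [_ e0 _ H _]] := hL _ hY; apply/H.
  by exists 1; rewrite ?mulr1// size_poly1.
have minA Y : Y0 <= Y -> exists A : {poly K}, [/\ A != 0, (size A <= (ss S).+1)%N,
    ann (bil n (sg S) (Q Y)) (ss S) A &
    forall P : {poly K}, (size P <= (ss S).+1)%N -> ann (bil n (sg S) (Q Y)) (ss S) P -> A %| P].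
  move=> hY; have [sL aL] := kerL _ hY; have [e [L0 _ _ _ _]] := hL _ hY.
  apply: (@ann_min _ _ _ (L Y)) => //.
    by rewrite (leq_trans sL)// ltnS sm_le_ss.
  by have := aL 0%N; rewrite sh0; apply.
have irrA Y (A P : {poly K}) : Y0 <= Y -> A != 0 -> (size A <= (ss S).+1)%N ->
    ann (bil n (sg S) (Q Y)) (ss S) A ->
    (forall P : {poly K}, (size P <= (ss S).+1)%N -> ann (bil n (sg S) (Q Y)) (ss S) P -> A %| P) ->
    irreducible_poly P -> P %| L Y -> exists2 k, (k <= t)%N & sh k P %| A.
  move=> hY A0 sA aA mA irr dP; have [e [L0 e0 _ H _]] := hL _ hY.
  exact: (irr_dvd_min (sa_neq0 S) (sm_le_ss S) e0 L0 H A0 sA aA mA irr dP).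
have Y01 : 1 <= Y0 by rewrite !le_max Z11 orbT.
have sshL Y k : Y0 <= Y -> (size (sh k (L Y)) <= (ss S).+1)%N.
  by move=> hY; rewrite size_sh ?sa_neq0// (leq_trans (kerL _ hY).1)// ltnS sm_le_ss.
exists L, Y0; split=> //.
- by move=> Y hY; have [e [L0 _ sL _ _]] := hL _ hY.
- exists c1 => //; exists C1 => // Y hY.
  by have [e [_ _ _ _ h]] := hL _ hY.
- exists (C2 / eps + 1) => [|Y hY]; first by rewrite lerDr divr_ge0 ?ltW//; lra.
  have [_ _ z2 _] := Y0E _ hY; have [sQ _] := hQ _ hY.
  have [k0 k0t h] := hsmall _ _ _ z2 sQ (kerL _ hY).
  exists k0 => //; have := h 0%N (leq0n _); rewrite addn0 => h1.
  have e1 := heps _ _ sQ; set T := (pnorm w (L Y) * _) in h1 *.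
  have T0 : 0 <= T by rewrite mulr_ge0 ?pnorm_ge0 ?powR_ge0.
  rewrite mulrDl mul1r mulrAC.
  have : cabs w (ev (L Y) k0) * eps <= C2 * T.
    by apply: le_trans h1; rewrite ler_wpM2l ?av_ge0.
  by rewrite -ler_pdivlMr//; lra.
(* Every shift of L by at most t annihilates, hence is a multiple of the shortest annihilator [A],
   and some shift of [P] divides [A]. *)
- move=> Y P hY irr dP; have [A [A0 sA aA mA]] := minA _ hY.
  have [k kt dA] := irrA _ _ _ hY A0 sA aA mA irr dP.
  exists k => // j jt; apply: dvdp_trans dA _; apply: mA; first exact: sshL.
  exact: (kerL _ hY).2.
- move=> c hc; have [e e0 he] := htest c hc; exists e => // Y Y' hY YY' hH P irr dP.
  have hY' : Y0 <= Y' := le_trans hY YY'.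
  have [_ _ _ z3] := Y0E _ hY; have [_ _ z2' _] := Y0E _ hY'.
  have [sQ mQ] := hQ _ hY; have [sQ' mQ'] := hQ _ hY'.
  (* If the norm of Q_Y' is at most Y, then Q_Y' also solves the system for Y and near-minimality
     applies; otherwise its norm exceeds Y, hence that of Q_Y. *)
  have QQ' : pnorm w (Q Y) <= 2 * pnorm w (Q Y').
    have [hle|hlt] := leP (pnorm w (Q Y')) Y.
      apply: mQ; have [q1 q2 q3 q4 q5] := sQ'; split=> // l /q5 h.
      apply: le_trans h _; rewrite !powRN lef_pV2 ?posrE ?powR_gt0//; try lra.
      by rewrite ge0_ler_powR ?nnegrE ?(ltW (kap_gt0 S))//; lra.
    by have [_ _ _ q4 _] := sQ; lra.
  have [k0 k0t hs] := hsmall _ _ _ z2' sQ' (kerL _ hY').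
  have aS := he Y Y' (Q Y) (Q Y') (L Y') k0 z3 YY' sQ sQ' QQ' (kerL _ hY') k0t hs hH.
  have [A [A0 sA aA mA]] := minA _ hY.
  have [k kt dA] := irrA _ _ _ hY A0 sA aA mA irr dP.
  have dL : sh k P %| sh k0 (L Y') by apply: dvdp_trans dA _; apply: mA => //; exact: sshL.
  have [P' E'] := sh_surj (sc S) (sa_neq0 S) k0 (sh k P).
  have irr' : irreducible_poly (sh k P) by apply: sh_irr => //; exact: sa_neq0.
  exists P'; last by exists k, k0; split=> //; [exact: ltnW|rewrite E' eqpxx].
  split; last by rewrite -(sh_dvdp (sc S) (sa_neq0 S) k0) E'.
  rewrite -E' in irr'; have [s1 hi] := irr'; split=> [|q sq dq].
    by rewrite size_sh ?sa_neq0 in s1.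
  rewrite -(sh_eqp (sc S) (sa_neq0 S) k0); apply: hi; first by rewrite size_sh ?sa_neq0.
  by rewrite sh_dvdp ?sa_neq0.
Qed.

End Family.

Lemma irr_factor (F : fieldType) (P : {poly F}) : (1 < size P)%N ->
  exists2 f : {poly F}, irreducible_poly f & f %| P.
Proof.
move=> sP; pose good k := `[< exists f : {poly F}, [/\ size f = k, (1 < size f)%N & f %| P] >].
have ex : exists k, good k by exists (size P); apply/asboolP; exists P.
have [k /asboolP[f [sf s1 fP]] kmin] := ex_minnP ex.
exists f => //; split=> // q sq qf.
have P0 : P != 0 by rewrite -size_poly_gt0 ltnW.
have f0 : f != 0 by rewrite -size_poly_gt0 ltnW.
have q0 : q != 0 by apply: contraTneq qf => ->; rewrite dvd0p.
have q1 : (1 < size q)%N by move: sq (size_poly_gt0 q); rewrite q0; case: (size q) => [|[|]].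
rewrite -dvdp_size_eqp// eqn_leq dvdp_leq//= sf; apply: kmin; apply/asboolP.
by exists q; split=> //; exact: dvdp_trans fP.
Qed.

(** * Heights of divisors, translates and products *)

Section Transfer.
Context {R : realType} {K : fieldExtType rat} {w : place R K} (S : setup w).
Local Notation n := (sn S).
Local Notation t := (st S).
Local Notation m := (sm S).
Local Notation N := (hN S).
Local Notation sh := (sh (sa S) (sc S)).
Local Notation snear := (snear (sa S) (sc S)).
Implicit Types (c : place R K -> R) (P Q : {poly K}) (v : place R K).

Lemma Ht_mono c c' P h h' : (forall v, c v <= c' v) -> h <= h' -> Ht S c P h -> Ht S c' P h'.
Proof.
move=> cc hh [mu mu0 [hv hw]]; exists mu => //; split=> [v vw|]; last exact: le_trans hh.
exact: le_trans (hv v vw) (cc v).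
Qed.

Lemma Ht_scale c P h z : z != 0 -> Ht S c P h -> Ht S c (z *: P) h.
Proof.
move=> z0 [mu mu0 [hv hw]]; exists (mu / z ^+ N); first by rewrite mulf_neq0// invr_eq0 expf_neq0.
have E (v : absval R K) : v (mu / z ^+ N) * pnorm v (z *: P) ^+ N = v mu * pnorm v P ^+ N.
  have vz : v z != 0 by rewrite gt_eqF// av_gt0.
  by rewrite pnormZ exprMn av_mul avV avX mulrA divfK// expf_neq0.
by split=> [v vw|]; rewrite E//; exact: hv.
Qed.

Lemma Ht_eqp c P Q h : P %= Q -> Ht S c P h -> Ht S c Q h.
Proof.
move=> /eqpP[[a b] /= /andP[a0 b0] E] hP.
have -> : Q = (b^-1 * a) *: P by rewrite -scalerA E scalerA mulVf// scale1r.
by apply: Ht_scale => //; rewrite mulf_neq0// invr_eq0.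
Qed.

Lemma Ht_le c (c1 : place R K -> R) P Q h : adm c1 -> (forall v, pnorm v Q <= c1 v * pnorm v P) ->
  Ht S c P h -> Ht S (fun v => c1 v ^+ N * c v) Q (c1 w ^+ N * h).
Proof.
move=> hc1 PQ [mu mu0 [hv hw]].
have E v : v mu * pnorm v Q ^+ N <= c1 v ^+ N * (v mu * pnorm v P ^+ N).
  rewrite mulrCA ler_wpM2l ?av_ge0// -exprMn.
  by rewrite lerXn2r ?nnegrE ?mulr_ge0 ?pnorm_ge0 ?adm_ge0.
exists mu => //; split=> [v vw|]; apply: le_trans (E _) _; rewrite ler_wpM2l ?exprn_ge0 ?adm_ge0//.
exact: hv.
Qed.

(** Gelfond's inequality bounds the norm of [P] times that of its cofactor. The leading coefficient
    of the cofactor is a nonzero element of [K] bounded by its norm at every place, so its power can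
    be absorbed into [mu]. *)
Lemma Ht_dvdp : exists2 c1 : place R K -> R, adm c1 & exists2 C : R, 1 <= C &
  forall c P Q h, (size Q <= m.+1)%N -> Q != 0 -> P %| Q -> Ht S c Q h ->
    Ht S (fun v => c1 v * c v) P (C * h).
Proof.
pose B : R := toepB m.+1 m.+1 * (m.+1 * m.+1.-1`!)%:R.
have B1 : 1 <= B by rewrite mulr_ege1 ?toepB_ge1// ler1n muln_gt0 fact_gt0.
exists (fun v => avc v B ^+ N); first by apply: admX; exact: adm_avc.
exists (B ^+ N); first exact: exprn_ege1.
move=> c P Q h sQ Q0 /dvdpP[G QE] [mu mu0 [hv hw]].
have G0 : G != 0 by apply/eqP => h0; move: Q0; rewrite QE h0 mul0r eqxx.
have P0 : P != 0 by apply/eqP => h0; move: Q0; rewrite QE h0 mulr0 eqxx.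
have sP : (size P <= m.+1)%N by apply: leq_trans sQ; rewrite dvdp_leq// QE dvdp_mull.
have sG : (size G <= m.+1)%N by apply: leq_trans sQ; rewrite dvdp_leq// QE dvdp_mulr.
have l0 : lead_coef G != 0 by rewrite lead_coef_eq0.
have E v : v (mu * lead_coef G ^+ N) * pnorm v P ^+ N <= avc v B ^+ N * (v mu * pnorm v Q ^+ N).
  rewrite av_mul avX -mulrA -exprMn [leRHS]mulrCA ler_wpM2l ?av_ge0// -exprMn.
  have b0 : 0 <= avc v B by rewrite (le_trans ler01)// avc_ge1.
  rewrite lerXn2r ?nnegrE ?mulr_ge0 ?pnorm_ge0 ?av_ge0//.
  apply: (@le_trans _ _ (pnorm v G * pnorm v P)).
    by rewrite ler_wpM2r ?pnorm_ge0// lead_coefE pnorm_coef.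
  by rewrite QE; exact: gelfond.
exists (mu * lead_coef G ^+ N); first by rewrite mulf_neq0// expf_neq0.
split=> [v vw|]; apply: le_trans (E _) _.
  rewrite ler_wpM2l ?exprn_ge0//; first by rewrite (le_trans ler01)// avc_ge1.
  exact: hv.
apply: ler_pM; rewrite ?exprn_ge0 ?mulr_ge0 ?av_ge0 ?exprn_ge0 ?pnorm_ge0//.
  by rewrite (le_trans ler01)// avc_ge1.
rewrite lerXn2r ?nnegrE ?avc_le//; last by lra.
by rewrite (le_trans ler01)// avc_ge1.
Qed.

Lemma Ht_near D : exists2 c1 : place R K -> R, adm c1 & exists2 C : R, 1 <= C &
  forall c P Q h, (size P <= m.+1)%N -> snear D P Q -> Ht S c P h ->
    Ht S (fun v => c1 v * c v) Q (C * h).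
Proof.
have /choice[q hq] : forall k : 'I_D.+1, exists q : {poly K}, aff (sa S) (sc S) k \Po q = 'X.
  by move=> k; have [q] := aff_inv (sc S) (sa_neq0 S) k; exists q.
have [c1 hc1 h1] := @adm_lin R K _ (fun k : 'I_D.+1 => comp_poly (aff (sa S) (sc S) k)) m.+1.
have [c2 hc2 h2] := @adm_lin R K _ (fun k : 'I_D.+1 => comp_poly (q k)) m.+1.
exists (fun v => c2 v ^+ N * c1 v ^+ N); first by apply: admM; exact: admX.
exists (c2 w ^+ N * c1 w ^+ N); first by rewrite mulr_ege1// exprn_ege1// adm_ge1.
move=> c P Q h sP [k [l [kD lD e]]] hP.
have sE : size Q = size P.
  by have := eqp_size e; rewrite !size_sh ?sa_neq0.
have H1 : Ht S (fun v => c1 v ^+ N * c v) (sh k P) (c1 w ^+ N * h).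
  apply: (Ht_le (P := P)) => // v; have := h1 v (inord k) P sP.
  by rewrite inordK.
have H2 := Ht_eqp e H1.
have QE : Q = sh l Q \Po q (inord l).
  by rewrite /sh -comp_polyA; have := hq (inord l); rewrite inordK// => ->; rewrite comp_polyXr.
have H3 : Ht S (fun v => c2 v ^+ N * (c1 v ^+ N * c v)) Q (c2 w ^+ N * (c1 w ^+ N * h)).
  apply: (Ht_le (P := sh l Q)) => // v; rewrite {1}QE; apply: h2.
  by rewrite size_sh ?sa_neq0// sE.
by apply: Ht_mono H3 => [v|]; rewrite mulrA.
Qed.

Lemma Ht_const c P : adm c -> P != 0 -> (size P <= 1)%N -> Ht S c P 1.
Proof.
move=> hc P0 sP; have [z z0 ->] : exists2 z, z != 0 & P = z *: 1.
  exists P`_0; last by rewrite alg_polyC; exact: size1_polyC.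
  by move: P0; rewrite {1}(size1_polyC sP) polyC_eq0.
apply: Ht_scale => //; exists 1; first exact: oner_neq0.
have E (v : absval R K) : v 1 * pnorm v (1 : {poly K}) ^+ N = 1.
  by rewrite av1 mul1r /pnorm size_poly1 big_ord_recl big_ord0 coef1/= av1 max_l// expr1n.
by split=> [v _|]; rewrite E//; exact: adm_ge1.
Qed.

Lemma Ht_prod c1 k : adm c1 -> exists2 c, adm c & exists2 C : R, 1 <= C &
  forall P h, 1 <= h -> P != 0 -> (size P <= k.+1)%N ->
    (forall f, irreducible_poly f -> f %| P -> Ht S c1 f h) -> Ht S c P (C * h ^+ k).
Proof.
move=> hc1; elim: k => [|k [c hc [C C1 IH]]].
  exists (fun=> 1); first exact: adm1.
  by exists 1 => // P h _ P0 sP _; rewrite expr0 mulr1; apply: Ht_const => //; exact: adm1.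
have b1 : 1 <= k.+2%:R :> R by rewrite ler1n.
have hb : adm (fun v => avc v (k.+2%:R : R) ^+ N) by apply: admX; exact: adm_avc.
exists (fun v => avc v k.+2%:R ^+ N * (c v * c1 v)); first by apply: admM => //; exact: admM.
exists (k.+2%:R ^+ N * C) => [|P h h1 P0 sP hP]; first by rewrite mulr_ege1// exprn_ege1.
have h0 : 0 <= h by lra.
have [sP1|sP1] := leqP (size P) 1.
  apply: (@Ht_mono (fun=> 1) _ _ 1).
  - by move=> v; rewrite !mulr_ege1 ?(adm_ge1 _ hb) ?(adm_ge1 _ hc) ?(adm_ge1 _ hc1).
  - by rewrite !mulr_ege1// exprn_ege1.
  - by apply: Ht_const => //; exact: adm1.
have [f irr fP] := irr_factor sP1; have /dvdpP[G PE] := fP.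
have G0 : G != 0 by apply/eqP => h0'; move: P0; rewrite PE h0' mul0r eqxx.
have f0 : f != 0 by exact: irredp_neq0.
have sG : (size G <= k.+1)%N.
  have [sf _] := irr; move: sP sf; rewrite PE size_mul//.
  by move: (size (G : {poly K})) (size f) => y z; lia.
have [mu mu0 [hv hw]] : Ht S c G (C * h ^+ k).
  by apply: IH => // g ig dg; apply: hP => //; rewrite PE dvdp_mulr.
have [nu nu0 [hv' hw']] := hP f irr fP.
have E v : v (mu * nu) * pnorm v P ^+ N <=
    avc v k.+2%:R ^+ N * ((v mu * pnorm v G ^+ N) * (v nu * pnorm v f ^+ N)).
  have -> : avc v k.+2%:R ^+ N * ((v mu * pnorm v G ^+ N) * (v nu * pnorm v f ^+ N)) =
     v (mu * nu) * (avc v k.+2%:R * (pnorm v G * pnorm v f)) ^+ N.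
    by rewrite av_mul !exprMn; ring.
  have a0 : 0 <= avc v (k.+2%:R : R) by rewrite (le_trans ler01)// avc_ge1.
  rewrite ler_wpM2l ?av_ge0// lerXn2r ?nnegrE ?mulr_ge0 ?pnorm_ge0//.
  rewrite PE; apply: pnormM; apply: leq_trans sP.
  by rewrite dvdp_leq.
exists (mu * nu); first by rewrite mulf_neq0.
split=> [v vw|]; apply: le_trans (E _) _.
  rewrite ler_wpM2l ?(adm_ge0 _ hb)// ler_pM ?mulr_ge0 ?av_ge0 ?exprn_ge0 ?pnorm_ge0//.
    exact: hv.
  exact: hv'.
have -> : k.+2%:R ^+ N * C * h ^+ k.+1 = k.+2%:R ^+ N * ((C * h ^+ k) * h) by rewrite exprSr; ring.
apply: ler_pM; rewrite ?(adm_ge0 _ hb) ?mulr_ge0 ?av_ge0 ?exprn_ge0 ?pnorm_ge0//.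
  by rewrite lerXn2r ?nnegrE ?avc_le// (le_trans ler01)// avc_ge1.
by rewrite ler_pM ?mulr_ge0 ?av_ge0 ?exprn_ge0 ?pnorm_ge0.
Qed.

(** Bounds the height of a polynomial through its irreducible factors alone. Applied to L at two
    parameters, it gives a bound that does not grow with the larger one. *)
Lemma Ht_transfer D c : adm c -> exists2 c' : place R K -> R, adm c' & exists2 C : R, 1 <= C &
  forall P Q h, (size P <= m.+1)%N -> P != 0 -> (size Q <= m.+1)%N -> Q != 0 -> 1 <= h ->
    (forall f, irreducible_poly f -> f %| Q -> exists2 g : {poly K}, g %| P & snear D g f) ->
    Ht S c P h -> Ht S c' Q (C * h ^+ m).
Proof.
move=> hc; have [c1 hc1 [C1 C11 H1]] := Ht_dvdp; have [c2 hc2 [C2 C21 H2]] := Ht_near D.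
have hcc : adm (fun v => c2 v * (c1 v * c v)) by apply: admM => //; exact: admM.
have [c' hc' [C C1' H3]] := Ht_prod m hcc.
exists c' => //; exists (C * (C2 * C1) ^+ m).
  by rewrite mulr_ege1// exprn_ege1// mulr_ege1.
move=> P Q h sP P0 sQ Q0 h1 hf hP; rewrite -mulrA -exprMn; apply: H3 => //.
  by rewrite !mulr_ege1.
move=> f irr fQ; have [g gP gf] := hf f irr fQ.
have sg : (size g <= m.+1)%N by apply: leq_trans sP; exact: dvdp_leq.
by rewrite -mulrA; apply: (H2 _ g) => //; apply: (H1 _ _ P).
Qed.

End Transfer.

(** * Recurring factors *)

Lemma irr_eqp (F : fieldType) (P Q : {poly F}) :
  irreducible_poly P -> irreducible_poly Q -> P %| Q -> P %= Q.
Proof. by move=> [sP _] [_ hQ] PQ; apply: hQ => //; rewrite gtn_eqF. Qed.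

Lemma coprime_factors_size (F : fieldType) (I : eqType) (f : I -> {poly F}) (r : seq I) :
  forall P : {poly F}, uniq r -> P != 0 ->
  (forall i, i \in r -> irreducible_poly (f i) /\ f i %| P) ->
  (forall i j, i \in r -> j \in r -> i != j -> ~~ (f i %= f j)) ->
  (\sum_(i <- r) (size (f i)).-1 < size P)%N.
Proof.
elim: r => [|i r IH] P; first by rewrite big_nil size_poly_gt0.
move=> /= /andP[ir ur] P0 hP hne; rewrite big_cons.
have [irr iP] := hP i (mem_head _ _); have /dvdpP[G PE] := iP.
have G0 : G != 0 by apply/eqP => h; move: P0; rewrite PE h mul0r eqxx.
have hG : (\sum_(i <- r) (size (f i)).-1 < size G)%N.
  apply: IH => // [j jr|j k jr kr]; last by apply: hne; rewrite inE ?jr ?kr orbT.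
  have jr' : j \in i :: r by rewrite inE jr orbT.
  have [irrj jP] := hP j jr'; split=> //.
  have cop : coprimep (f j) (f i).
    rewrite irreducible_poly_coprime//; apply/negP => /(irr_eqp irrj irr); apply/negP.
    apply: hne; rewrite ?mem_head//; apply: contraNneq ir => <-; exact: jr.
  by rewrite -(Gauss_dvdpl _ cop) -PE.
rewrite PE size_mul ?(irredp_neq0 irr)//.
have [s1 _] := irr; move: s1 hG; move: (size (f i)) (size (G : {poly F})) => x y.
by move: (\sum_(_ <- _) _)%N => z; lia.
Qed.

Lemma bernoulli_large (R : realType) (eta : R) (k : nat) : 0 < eta ->
  exists M : nat, k%:R <= (1 + eta) ^+ M.
Proof.
move=> e0; exists (Num.truncn (k%:R / eta)).+1; set M := _.+1.
have B j : 1 + j%:R * eta <= (1 + eta) ^+ j.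
  elim: j => [|j IH]; first by rewrite mul0r addr0 expr0.
  rewrite exprS; apply: (@le_trans _ _ ((1 + eta) * (1 + j%:R * eta))).
    rewrite -natr1; have : 0 <= j%:R * eta * eta by rewrite !mulr_ge0// ltW.
    lra.
  by rewrite ler_wpM2l//; lra.
apply: le_trans (B M); have : k%:R / eta < M%:R by rewrite /M truncnS_gt.
by rewrite ltr_pdivrMr//; lra.
Qed.

Section Chain.
Context {R : realType} {K : fieldExtType rat} {w : place R K} (S : setup w).
Local Notation n := (sn S).
Local Notation t := (st S).
Local Notation m := (sm S).
Local Notation kap := (kap S).
Local Notation sh := (sh (sa S) (sc S)).
Local Notation snear := (snear (sa S) (sc S)).
Local Notation ev Q l := (map_poly (emb w) Q).[sx S l].
Context (L : R -> {poly K}) (Y0 : R) (gL : good_family S L Y0).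

Definition factors (N : nat) Y (G : 'I_N -> {poly K}) :=
  forall i, irreducible_poly (G i) /\ G i %| L Y.

Definition far (N s : nat) (G : 'I_N -> {poly K}) :=
  forall i j, i != j -> ~ snear s (G i) (G j).

Lemma far_le N s s' (G : 'I_N -> {poly K}) : (s <= s')%N -> far s' G -> far s G.
Proof. by move=> ss h i j ij /(snear_le ss); exact: h. Qed.

Lemma far_card N s Y (G : 'I_N -> {poly K}) : Y0 <= Y -> factors Y G -> far s G -> (N <= m)%N.
Proof.
move=> hY fG hG; have [L0 sL] := gf_size gL hY.
rewrite -ltnS; apply: leq_trans sL.
have : (\sum_(i <- enum 'I_N) (size (G i)).-1 < size (L Y))%N; last first.
  apply: leq_ltn_trans; rewrite big_enum/= -[X in (X <= _)%N]card_ord -sum1_card.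
  by apply: leq_sum => i _; have [[s1 _] _] := fG i; case: (size (G i)) s1 => [|[|]].
apply: coprime_factors_size => //; first exact: enum_uniq.
move=> i j _ _ ij; apply/negP => e; apply: (hG i j ij).
by exists 0%N, 0%N; split=> //; rewrite !sh0.
Qed.

(** The size of such families is bounded by [far_card], so a largest one exists. The first clause
    holds for every distance and every threshold, so both can be fixed after all constants; only the
    second clause determines [s0]. *)
Lemma maximal_far : exists N s0 (Z0 : R),
  (forall s Z, exists Y (G : 'I_N -> {poly K}), [/\ Z <= Y, factors Y G & far s G]) /\
  (forall Y (G : 'I_N.+1 -> {poly K}), Z0 <= Y -> factors Y G -> ~ far s0 G).
Proof.
pose good N := `[< forall s (Z : R), exists Y (G : 'I_N -> {poly K}),
  [/\ Z <= Y, factors Y G & far s G] >].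
have good0 : good 0%N.
  apply/asboolP => s Z; exists Z, (fun=> 0); split=> //; first by case.
  by case.
have ub N : good N -> (N <= m)%N.
  move=> /asboolP /(_ 0%N Y0)[Y [G [hY fG hG]]]; exact: far_card fG hG.
have [N gN Nmax] := ex_maxnP (ex_intro (fun k => good k) 0%N good0) ub.
have : ~~ good N.+1 by apply/negP => /Nmax; rewrite ltnn.
move=> /asboolPn/existsNP[s0 /existsNP[Z0 H]].
exists N, s0, Z0; split; first exact/asboolP.
by move=> Y G hY fG hG; apply: H; exists Y, G.
Qed.

(** Adjoin [f] to the family [G]. The members of [G] inherit their mutual distance from [F], so by
    maximality [f] must be near one of them. *)
Lemma near_some N s0 D (F G : 'I_N -> {poly K}) Y :
  (forall G' : 'I_N.+1 -> {poly K}, factors Y G' -> ~ far s0 G') ->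
  factors Y G -> (forall i, snear D (F i) (G i)) -> far (s0 + 2 * D) F ->
  forall f, irreducible_poly f -> f %| L Y -> exists i, snear (s0 + D) (F i) f.
Proof.
move=> H fG nFG farF f irr fL; apply: contrapT => no.
pose G' (i : 'I_N.+1) := if unlift ord_max i is Some j then G j else f.
have gf j : ~ snear s0 (G j) f.
  by move=> h; apply: no; exists j; rewrite addnC; apply: (snear_trans (sa_neq0 S) (nFG j)).
apply: (H G') => [i|i j ij].
  by rewrite /G'; case: unliftP => [j _|_]; [exact: fG|].
rewrite /G'; case: unliftP => [i' iE|iE]; case: unliftP => [j' jE|jE].
- have ij' : i' != j' by apply: contraNneq ij => e; rewrite iE jE e.
  move=> h; apply: (farF i' j' ij').
  have h1 := snear_trans (sa_neq0 S) (nFG i') h.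
  have h2 := snear_trans (sa_neq0 S) h1 (snear_sym (nFG j')).
  by apply: snear_le h2; lia.
- exact: gf.
- by move=> /snear_sym; exact: gf.
- by rewrite iE jE eqxx in ij.
Qed.

(** Evaluation is multiplicative and the norm is submultiplicative up to a constant, so lower bounds
    for the values of the factors pass to the product. *)
Lemma values_ge (B : R) q k : 1 <= B -> exists2 C : R, 1 <= C & forall P : {poly K},
  (size P <= k.+1)%N -> P != 0 ->
  (forall f, irreducible_poly f -> f %| P -> pnorm w f <= B * cabs w (ev f q)) ->
  pnorm w P <= C * cabs w (ev P q).
Proof.
move=> B1; elim: k => [|k [C C1 IH]].
  exists 1 => // P sP P0 _; rewrite mul1r (size1_polyC sP) map_polyC hornerC cabs_emb.
  apply: pnorm_le => [|i]; first exact: av_ge0.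
  by rewrite coefC; case: eqP => _ //; rewrite av0 av_ge0.
exists (k.+2%:R * C * B) => [|P sP P0 hP]; first by rewrite !mulr_ege1// ler1n.
have [sP1|sP1] := leqP (size P) 1.
  have D1 : 1 <= k.+2%:R * C * B by rewrite !mulr_ege1// ler1n.
  rewrite (size1_polyC sP1) map_polyC hornerC cabs_emb.
  apply: (@le_trans _ _ (w P`_0)); last by rewrite ler_peMl ?av_ge0.
  apply: pnorm_le => [|i]; first exact: av_ge0.
  by rewrite coefC; case: eqP => _ //; rewrite av0 av_ge0.
have [f irr fP] := irr_factor sP1; have /dvdpP[G PE] := fP.
have G0 : G != 0 by apply/eqP => h0'; move: P0; rewrite PE h0' mul0r eqxx.
have f0 : f != 0 by exact: irredp_neq0.
have sG : (size G <= k.+1)%N.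
  have [sf _] := irr; move: sP sf; rewrite PE size_mul//.
  by move: (size (G : {poly K})) (size f) => y z; lia.
have hG : pnorm w G <= C * cabs w (ev G q).
  by apply: IH => // g ig dg; apply: hP => //; rewrite PE dvdp_mulr.
have hf := hP f irr fP.
have sf : (size f <= k.+2)%N by apply: leq_trans sP; exact: dvdp_leq.
rewrite PE; apply: le_trans (pnormM _ _ sf) _.
have -> : cabs w (ev (G * f) q) = cabs w (ev G q) * cabs w (ev f q).
  by rewrite rmorphM hornerM; exact: av_mul.
have -> : k.+2%:R * C * B * (cabs w (ev G q) * cabs w (ev f q)) =
  k.+2%:R * ((C * cabs w (ev G q)) * (B * cabs w (ev f q))) by ring.
have k2 : 1 <= k.+2%:R :> R by rewrite ler1n.
apply: ler_pM; rewrite ?mulr_ge0 ?pnorm_ge0 ?avc_le//; first by rewrite (le_trans ler01)// avc_ge1.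
by apply: ler_pM; rewrite ?pnorm_ge0.
Qed.

End Chain.

Section Vanishing.
Context {R : realType} {K : fieldExtType rat} {w : place R K} (S : setup w).
Local Notation n := (sn S).
Local Notation t := (st S).
Local Notation m := (sm S).
Local Notation N := ((hN S)%:R : R).
Local Notation kap := (kap S).
Local Notation th := (theta' S).
Local Notation sh := (sh (sa S) (sc S)).
Local Notation snear := (snear (sa S) (sc S)).
Local Notation ev Q l := (map_poly (emb w) Q).[sx S l].
Context (L : R -> {poly K}) (Y0 : R) (gL : good_family S L Y0).

Lemma N_gt0 : 0 < N.
Proof. by rewrite ltr0n hN_gt0. Qed.

Lemma height_step (C e Y Y' : R) c : 1 <= C -> 0 < e -> 1 <= Y ->
  Y' `^ (N * (kap - th)) * C <= e * Y `^ (kap * N) ->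
  Ht S c (L Y') (C * Y' `^ (N * (kap - th))) -> Ht S c (L Y') (e * Y `^ (kap * N)).
Proof. by move=> C1 e0 Y1 h; apply: Ht_mono => //; rewrite mulrC. Qed.

(** For eta = th/(2 kap) the product (1 + eta)(kap - th) is less than kap - th/2; the remaining th/2
    absorbs the constants. *)
Lemma power_step (C e Y : R) : 1 <= Y -> 0 < e -> 0 <= C -> C / e <= Y `^ (N * (th / 2)) ->
  (Y `^ (1 + th / (2 * kap))) `^ (N * (kap - th)) * C <= e * Y `^ (kap * N).
Proof.
move=> Y1 e0 C0; rewrite ler_pdivrMr// => h.
have k0 := kap_gt0 S; have t0 := theta'_gt0 S; have n0 := N_gt0.
rewrite -powRrM; apply: (@le_trans _ _ (Y `^ (N * (kap - th / 2)) * C)).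
  rewrite ler_wpM2r// ler_powR// mulrCA ler_wpM2l ?(ltW n0)//.
  have -> : (1 + th / (2 * kap)) * (kap - th) = kap - th / 2 - th * th / (2 * kap).
    by field; rewrite gt_eqF.
  by rewrite gerBl divr_ge0// mulr_ge0// ltW.
have -> : kap * N = N * (kap - th / 2) + N * (th / 2) by ring.
rewrite [Y `^ (_ + _)]powRD; last by rewrite (gt_eqF (lt_le_trans ltr01 Y1)) implybT.
rewrite mulrCA ler_wpM2l ?powR_ge0// mulrC; lra.
Qed.

Lemma double_step (C e Y : R) : 1 <= Y -> 0 < e -> 0 <= C ->
  C * 2 `^ (N * kap) / e <= Y `^ (N * th) ->
  (Y * 2) `^ (N * (kap - th)) * C <= e * Y `^ (kap * N).
Proof.
move=> Y1 e0 C0; rewrite ler_pdivrMr// => h.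
have k0 := kap_gt0 S; have t0 := theta'_gt0 S; have n0 := N_gt0.
rewrite powRM; [|lra|lra].
apply: (@le_trans _ _ (Y `^ (N * (kap - th)) * 2 `^ (N * kap) * C)).
  rewrite ler_wpM2r// ler_wpM2l ?powR_ge0// ler_powR//; first by lra.
  by rewrite ler_wpM2l ?(ltW n0)//; lra.
have -> : kap * N = N * (kap - th) + N * th by ring.
rewrite [Y `^ (_ + _)]powRD; last by rewrite (gt_eqF (lt_le_trans ltr01 Y1)) implybT.
rewrite -mulrA [leRHS]mulrCA ler_wpM2l ?powR_ge0// mulrC; lra.
Qed.

(* Boundedly many steps Y -> Y^(1 + eta) make the parameter a power of Y large
   enough to dominate the heights of all polynomials built from factors near those
   of L_Y; from then on the parameter can be doubled indefinitely. *)
Lemma vanishing_factor : exists Y (P : {poly K}) q,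
  [/\ Y0 <= Y, irreducible_poly P /\ P %| L Y, (q < t)%N & ev P q = 0].
Proof.
apply: contrapT => nov.
have k0 := kap_gt0 S; have t0 := theta'_gt0 S; have n0 := N_gt0.
have [r [s0 [Z0 [exF maxF]]]] := maximal_far gL.
have [c0 hc0 [C0 C01 ht0]] := gf_ht gL.
have [e0 e00 test0] := gf_test gL hc0.
pose eta := th / (2 * kap).
have eta0 : 0 < eta by rewrite divr_gt0// mulr_gt0.
(* [Ht_transfer] raises the height to the power m, and one more factor Y^(kap N) absorbs the
   constants: hence the exponent m + 1 to be reached. *)
have [M hM] := bernoulli_large m.+1 eta0.
pose D := (M * t)%N.
have [c1 hc1 [C1 C11 trans]] := Ht_transfer S (s0 + (D + (t + t))) hc0.
have [e1 e10 test1] := gf_test gL hc1.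
have [Za Za1 hZa] := powR_large (C0 / e0) (mulr_gt0 n0 (divr_gt0 t0 (ltr0Sn R 1))).
have [Zb Zb1 hZb] := powR_large (C0 * 2 `^ (N * kap) / e0) (mulr_gt0 n0 t0).
have [Zc Zc1 hZc] := powR_large (C1 * C0 ^+ m / e1) (mulr_gt0 k0 n0).
(* The factors drift by at most D = M t during the M power steps, then by t when L at Y_M is
   compared with a later L, and by another t in one doubling; twice this total must fit on top of
   [s0]. *)
have [Y [F [hY fF farF]]] := exF (s0 + 2 * (D + (t + t)))%N
  (Num.max (Num.max Y0 Z0) (Num.max Za (Num.max Zb Zc))).
move: hY; rewrite !ge_max => /andP[/andP[hY0 hZ0] /andP[hYa /andP[hYb hYc]]].
have Y1 : 1 <= Y := le_trans (gf_ge1 gL) hY0.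
have step Ya Yb (G : 'I_r -> {poly K}) : Y <= Ya -> Ya <= Yb ->
    Yb `^ (N * (kap - th)) * C0 <= e0 * Ya `^ (kap * N) -> factors L Ya G ->
    exists2 G' : 'I_r -> {poly K}, factors L Yb G' & forall i, snear t (G i) (G' i).
  move=> YYa YaYb hab fG.
  have ya : Y0 <= Ya := le_trans hY0 YYa; have yb : Y0 <= Yb := le_trans ya YaYb.
  have ya1 : 1 <= Ya := le_trans Y1 YYa.
  have hH := height_step C01 e00 ya1 hab (ht0 _ yb).
  have /choice[G' hG'] : forall i, exists G', (irreducible_poly G' /\ G' %| L Yb) /\ snear t (G i) G'.
    move=> i; have [irr dv] := fG i.
    by have [G' h1 h2] := test0 _ _ ya YaYb hH _ irr dv; exists G'.
  by exists G' => i; have [] := hG' i.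
pose Yj j := Y `^ ((1 + eta) ^+ j).
have eta1 j : 1 <= (1 + eta) ^+ j by rewrite exprn_ege1//; lra.
have YYj j : Y <= Yj j by rewrite -{1}[Y]powRr1 ?ler_powR//; lra.
have YjS j : Yj j.+1 = Yj j `^ (1 + eta) by rewrite /Yj -powRrM exprSr.
have chain j : exists2 G : 'I_r -> {poly K}, factors L (Yj j) G &
    forall i, snear (j * t) (F i) (G i).
  elim: j => [|j [G fG nG]].
    exists F; last by move=> i; exact: snear_refl.
    by rewrite /Yj expr0 powRr1 ?ltW//; lra.
  have y1 : 1 <= Yj j := le_trans Y1 (YYj j).
  have hs1 : Yj j <= Yj j.+1 by rewrite YjS -{1}[Yj j]powRr1 ?ler_powR//; lra.
  have hs2 : Yj j.+1 `^ (N * (kap - th)) * C0 <= e0 * Yj j `^ (kap * N).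
    rewrite YjS; apply: power_step => //; first by lra.
    by apply: hZa; exact: le_trans (YYj j).
  have [G' fG' nG'] := step _ _ _ (YYj j) hs1 hs2 fG.
  exists G'; first exact: fG'.
  move=> i; have := snear_trans (sa_neq0 S) (nG i) (nG' i).
  by rewrite mulSn addnC.
have [G0 fG0 nG0] := chain M.
pose Yp p := Yj M * 2 ^+ p.
have YjM0 : 0 < Yj M := lt_le_trans ltr01 (le_trans Y1 (YYj M)).
have YjYp p : Yj M <= Yp p.
  by rewrite ler_peMr ?(ltW YjM0)// exprn_ege1//; lra.
have YYp p : Y <= Yp p := le_trans (YYj M) (YjYp p).
have farle d : (d <= D + (t + t))%N -> far S (s0 + 2 * d) F.
  by move=> h; apply: far_le farF; rewrite leq_add2l leq_mul2l h orbT.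
(* The distance D + t does not accumulate. A doubling step shows that all factors of the new L are
   near some [F i]; its height is then bounded in terms of Y alone, so it can be compared directly
   with L at Y_M, which resets the distance. *)
have main p : exists2 G : 'I_r -> {poly K}, factors L (Yp p) G &
    forall i, snear (D + t) (F i) (G i).
  elim: p => [|p [G fG nG]].
    exists G0; first by rewrite /Yp expr0 mulr1.
    by move=> i; apply: snear_le (nG0 i); rewrite leq_addr.
  have yp1 : 1 <= Yp p := le_trans Y1 (YYp p).
  have YpS : Yp p.+1 = Yp p * 2 by rewrite /Yp exprSr mulrA.
  have hs1 : Yp p <= Yp p.+1 by rewrite YpS; lra.
  have hs2 : Yp p.+1 `^ (N * (kap - th)) * C0 <= e0 * Yp p `^ (kap * N).
    rewrite YpS; apply: double_step => //; first by lra.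
    by apply: hZb; exact: le_trans (YYp p).
  have [G' fG' nG'] := step _ _ _ (YYp p) hs1 hs2 fG.
  have yp : Y0 <= Yp p.+1 := le_trans hY0 (YYp p.+1).
  have nFG' i : snear (D + (t + t)) (F i) (G' i).
    by rewrite addnA; apply: (snear_trans (sa_neq0 S) (nG i)).
  have all := near_some (fun G => maxF (Yp p.+1) G (le_trans hZ0 (YYp p.+1))) fG' nFG' (farle _ (leqnn _)).
  have [L0 sL] := gf_size gL hY0; have [L0' sL'] := gf_size gL yp.
  pose h := C0 * Y `^ (N * kap).
  have pk1 : 1 <= Y `^ (N * kap).
    by rewrite -[leLHS](powRr0 Y) ler_powR// mulr_ge0// ltW.
  have h1 : 1 <= h by rewrite mulr_ege1.
  have hL : Ht S c0 (L Y) h.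
    apply: Ht_mono (ht0 _ hY0) => //; rewrite ler_wpM2l//; first by lra.
    by rewrite ler_powR// ler_wpM2l ?(ltW n0)//; lra.
  have hT : Ht S c1 (L (Yp p.+1)) (C1 * h ^+ m).
    apply: (trans (L Y)) => // f irr fL; have [i ni] := all f irr fL.
    by exists (F i) => //; have [] := fF i.
  have hT' : Ht S c1 (L (Yp p.+1)) (e1 * Yj M `^ (kap * N)).
    apply: Ht_mono hT => //.
    have := hZc Y hYc; rewrite ler_pdivrMr// => hc.
    rewrite /h exprMn mulrA.
    apply: (@le_trans _ _ (Y `^ (kap * N) * e1 * (Y `^ (N * kap)) ^+ m)).
      by rewrite ler_wpM2r// exprn_ge0// powR_ge0.
    rewrite mulrAC mulrC ler_wpM2l ?(ltW e10)//.
    rewrite [N * kap]mulrC -exprS -powR_mulrn ?powR_ge0// -!powRrM ler_powR//.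
    by rewrite [leRHS]mulrC ler_wpM2l// mulr_ge0// ltW.
  have y' : Y0 <= Yj M := le_trans hY0 (YYj M).
  have tst := test1 _ _ y' (YjYp p.+1) hT'.
  have /choice[G1 hG1] : forall i, exists G1, (irreducible_poly G1 /\ G1 %| L (Yp p.+1)) /\ snear t (G0 i) G1.
    move=> i; have [irr dv] := fG0 i.
    by have [G1 h2 h3] := tst _ irr dv; exists G1.
  exists G1 => i; have [a b] := hG1 i => //.
  exact: (snear_trans (sa_neq0 S) (nG0 i)).
pose E := (s0 + (D + t))%N.
(* A factor near [F i] satisfies sh b f ~ sh a (F i) with a, b at most E, hence agrees up to a
   scalar with one of these finitely many polynomials. *)
have /choice[H hH] : forall iab : 'I_r * 'I_E.+1 * 'I_E.+1, exists G : {poly K},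
    sh iab.2 G = sh iab.1.2 (F iab.1.1) by move=> iab; exact: sh_surj (sa_neq0 S) _ _.
(* Where the value vanishes the quotient is 0 by convention; [lower] uses the bound only at nonzero
   values. *)
have [B B1 hB] := fin_bound (fun q : 'I_r * 'I_E.+1 * 'I_E.+1 * 'I_t =>
  pnorm w (H q.1) / cabs w (ev (H q.1) q.2)).
have lower q f : (q < t)%N -> (exists i, snear E (F i) f) -> ev f q <> 0 ->
    pnorm w f <= B * cabs w (ev f q).
  move=> qt [i [a [b [aE bE e]]]] fq.
  have hG := hH (i, inord a, inord b); have hBG := hB (i, inord a, inord b, Ordinal qt).
  rewrite /= !inordK// in hG; rewrite [in X in X <= _]/= in hBG.
  set G := H _ in hG hBG.
  have [z fE] : exists z, f = z *: G.
    have : G %= f by rewrite -(sh_eqp (sc S) (sa_neq0 S) b) hG.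
    move=> /eqpP[[x y] /= /andP[x0 y0] xy].
    by exists (y^-1 * x); rewrite -scalerA xy scalerA mulVf// scale1r.
  have Gq : ev G q != 0.
    by apply/eqP => G0'; apply: fq; rewrite fE map_polyZ hornerZ G0' mulr0.
  have -> : cabs w (ev f q) = w z * cabs w (ev G q).
    by rewrite fE map_polyZ hornerZ -[w z]cabs_emb; exact: av_mul.
  rewrite fE pnormZ mulrCA ler_wpM2l ?av_ge0// -ler_pdivrMr; first exact: hBG.
  exact: av_gt0.
have /choice[Cq hCq] : forall q, exists C : R, 1 <= C /\ forall P : {poly K},
  (size P <= m.+1)%N -> P != 0 ->
  (forall f, irreducible_poly f -> f %| P -> pnorm w f <= B * cabs w (ev f q)) ->
  pnorm w P <= C * cabs w (ev P q).
  by move=> q; have [C h1 h2] := values_ge S q m B1; exists C.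
have [CC CC1 hCC] := fin_bound (fun q : 'I_t => Cq q).
have [Cs Cs1 small] := gf_small gL.
have [Zd Zd1 hZd] := powR_large (CC * Cs + 1) k0.
have [p hp] : exists p : nat, Zd <= Yp p.
  exists (Num.truncn Zd).+1; apply: (@le_trans _ _ (2 ^+ (Num.truncn Zd).+1)).
    apply/ltW; apply: (@lt_le_trans _ _ (Num.truncn Zd).+1%:R); first by rewrite truncnS_gt.
    by rewrite -natrX ler_nat ltnW// ltn_expl.
  by rewrite /Yp ler_peMl ?exprn_ge0//; exact: le_trans (YYj M).
have yp : Y0 <= Yp p := le_trans hY0 (YYp p).
have yp0 : 0 < Yp p := lt_le_trans ltr01 (le_trans Y1 (YYp p)).
have [k0' k0t hs] := small _ yp.
have [G fG nG] := main p.
have dD : (D + t <= D + (t + t))%N by rewrite addnA leq_addr.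
have all := near_some (fun G => maxF (Yp p) G (le_trans hZ0 (YYp p))) fG nG (farle _ dD).
have [L0 sL] := gf_size gL yp.
have [_ hC] := hCq k0'.
have hL : pnorm w (L (Yp p)) <= Cq k0' * cabs w (ev (L (Yp p)) k0').
  apply: hC => // f irr fL; apply: lower => //; first exact: all.
  by move=> f0; apply: nov; exists (Yp p), f, k0'.
have C2 : Cq k0' <= CC by exact: (hCC (Ordinal k0t)).
have nL : 0 < pnorm w (L (Yp p)) by exact: pnorm_gt0.
have := hZd _ hp; apply/negP; rewrite -ltNge.
have pp : 0 < Yp p `^ kap by rewrite powR_gt0.
have : pnorm w (L (Yp p)) <= CC * (Cs * (pnorm w (L (Yp p)) * Yp p `^ (- kap))).
  apply: le_trans hL _; apply: ler_pM => //; last exact: av_ge0.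
  by have [] := hCq k0'; lra.
rewrite powRN.
have -> : CC * (Cs * (pnorm w (L (Yp p)) / Yp p `^ kap)) = pnorm w (L (Yp p)) * (CC * Cs / Yp p `^ kap) by ring.
rewrite -{1}[pnorm w _]mulr1 ler_pM2l// ler_pdivlMr// mul1r; lra.
Qed.

End Vanishing.

(** * Degree of the vanishing factor *)

Lemma sh_irrE (F : fieldType) (a c : F) k (P : {poly F}) : a != 0 ->
  irreducible_poly (sh a c k P) -> irreducible_poly P.
Proof.
move=> a0 [s1 hi]; split=> [|q sq dq]; first by rewrite size_sh in s1.
by rewrite -(sh_eqp c a0 k); apply: hi; rewrite ?size_sh// sh_dvdp.
Qed.

Section Degree.
Context {R : realType} {K : fieldExtType rat} {w : place R K} (S : setup w).
Local Notation n := (sn S).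
Local Notation t := (st S).
Local Notation m := (sm S).
Local Notation sh := (sh (sa S) (sc S)).
Local Notation ev Q l := (map_poly (emb w) Q).[sx S l].

(* While the first r shifts of P are pairwise non-associate they contribute
   r deg P <= m <= n to the degree of L, and this rules out that the next one
   repeats any of them. *)
Lemma shifts_degree (L P : {poly K}) k q (f : nat -> {poly K}) :
  L != 0 -> (size L <= m.+1)%N -> irreducible_poly P -> (q <= n)%N -> ev P q = 0 ->
  (forall j, (j <= t)%N -> sh j (f j) = sh k P /\ f j %| L) ->
  ((size P).-1 * t.+1 <= m)%N.
Proof.
move=> L0 sL irr qn Pq hf; have a0 := sa_neq0 S.
have sf j : (j <= t)%N -> size (f j) = size P.
  by move=> /hf[E _]; have := congr1 (fun T : {poly K} => size T) E; rewrite !size_sh.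
have irrf j : (j <= t)%N -> irreducible_poly (f j).
  by move=> /hf[E _]; apply: (@sh_irrE _ (sa S) (sc S) j) => //; rewrite E; exact: sh_irr.
suff H r : (r <= t.+1)%N -> (forall i j, (i < r)%N -> (j < r)%N -> i != j -> ~~ (f i %= f j)) /\
    ((size P).-1 * r <= m)%N by have [] := H t.+1 (leqnn _).
elim: r => [|r IH] rt; first by rewrite muln0; split=> // i j.
have [hne hd] := IH (ltnW rt).
have new i : (i < r)%N -> ~~ (f i %= f r).
  move=> ir; apply/negP => e.
  have it : (i <= t)%N by rewrite -ltnS (ltn_trans ir).
  have [Ei _] := hf i it; have [Er _] := hf r rt.
  (* Both [sh i (f i)] and [sh r (f r)] equal [sh k P]; associate [f i] and [f r] would make [P]
     associate to its own shift by r - i, which [sfree] forbids. *)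
  have e2 : sh (r - i) P %= P.
    have e1 : sh r (f i) %= sh r (f r) by rewrite sh_eqp.
    rewrite -(sh_eqp (sc S) a0 k) -shD addnC shD -Ei -shD subnKC ?(ltnW ir)//.
    by rewrite Ei -Er.
  have := sfree irr.1 qn Pq (_ : 0 < r - i)%N; rewrite subn_gt0 => /(_ ir).
  rewrite e2 => H; suff : false by []; apply: H.
  rewrite mulnC (leq_trans _ (sm_le_n S))// (leq_trans _ hd)//.
  by rewrite leq_mul2l leq_subr orbT.
have hne' i j : (i < r.+1)%N -> (j < r.+1)%N -> i != j -> ~~ (f i %= f j).
  rewrite !ltnS leq_eqVlt => /orP[/eqP->|ir]; rewrite leq_eqVlt => /orP[/eqP->|jr].
  - by rewrite eqxx.
  - by move=> _; rewrite eqp_sym new.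
  - by move=> _; exact: new.
  - exact: hne.
split=> //.
have : (\sum_(i <- iota 0 r.+1) (size (f i)).-1 < size L)%N.
  apply: coprime_factors_size => //; first exact: iota_uniq.
    move=> i; rewrite mem_iota => /andP[_]; rewrite add0n => ir.
    have it : (i <= t)%N by rewrite -ltnS (leq_trans ir).
    by split; [exact: irrf|exact: (hf i it).2].
  by move=> i j; rewrite !mem_iota !add0n => /andP[_ ir] /andP[_ jr]; exact: hne'.
rewrite (eq_big_seq (fun=> (size P).-1)); last first.
  move=> i; rewrite mem_iota add0n => /andP[_ ir]; rewrite sf//.
  by rewrite -ltnS (leq_trans ir).
rewrite big_const_seq count_predT size_iota iter_addn_0 => h.
by rewrite -ltnS (leq_trans h).
Qed.

Lemma small_degree : (exists Z, forall Y, Z <= Y -> exists Q, sys S Y Q) ->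
  exists (P : {poly K}) q, [/\ irreducible_poly P, (q <= n)%N, ev P q = 0 &
    ((size P).-1 * t.+1 <= m)%N].
Proof.
move=> /family_exists[L [Y0 gL]].
have [Y [P [q [hY [irr PL] qt Pq]]]] := vanishing_factor gL.
have qn : (q <= n)%N by rewrite (leq_trans (ltnW qt))//; have := sn_ge S; lia.
exists P, q; split=> //.
have [L0 sL] := gf_size gL hY; have [k kt hk] := gf_div gL hY irr PL.
have /choice[f hf] : forall j, exists f, (j <= t)%N -> sh j f = sh k P /\ f %| L Y.
  move=> j; have [f fE] := sh_surj (sc S) (sa_neq0 S) j (sh k P); exists f => jt; split=> //.
  by rewrite -(sh_dvdp (sc S) (sa_neq0 S) j) fE hk.
exact: (shifts_degree L0 sL irr qn Pq hf).
Qed.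

Lemma all_algebraic : (exists Z, forall Y, Z <= Y -> exists Q, sys S Y Q) ->
  forall p, exists2 d : nat, algebraic_of_degree (emb w) (sx S p) d & (d * t < n)%N.
Proof.
move=> /small_degree[P [q [irr qn Pq dP]]] p; have a0 := sa_neq0 S.
(* The root is carried from index [q] to [p] by an inverse shift if [q <= p], and by a shift
   otherwise. *)
have [G [irrG sG Gp]] : exists G : {poly K}, [/\ irreducible_poly G, size G = size P & ev G p = 0].
  have [qp|pq] := leqP q p.
    have [G GE] := sh_surj (sc S) a0 (p - q) P; exists G; split.
    - by apply: (@sh_irrE _ _ (sc S) (p - q) _ a0); rewrite GE.
    - by rewrite -GE size_sh.
    - by rewrite -(subnKC qp) -ev_sh GE.
  exists (sh (q - p) P); split; [exact: sh_irr|exact: size_sh|].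
  by rewrite ev_sh subnKC// ltnW.
have [s1 hG] := irrG.
have G0 : G != 0 by exact: irredp_neq0.
have lG : (lead_coef G)^-1 != 0 by rewrite invr_eq0 lead_coef_eq0.
have d1 : (0 < (size P).-1)%N by rewrite -subn1 subn_gt0 -sG.
(* A degree d >= 1 with d(t + 1) at most half of n + 1 satisfies d t < n. *)
exists (size P).-1; last first.
  move: dP; rewrite mulnS /sm; move: ((size P).-1 * t)%N => z; lia.
exists ((lead_coef G)^-1 *: G); split.
- by rewrite monicE lead_coefZ mulVf// lead_coef_eq0.
- split=> [|u su]; first by rewrite size_scale.
  by rewrite dvdpZr// => /(hG _ su) h; rewrite (eqp_trans h)// eqp_sym eqp_scale.
- by rewrite rootE map_polyZ hornerZ Gp mulr0.
- by rewrite size_scale// sG prednK//; move: d1; case: (size P).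
Qed.

End Degree.

(** * From the additive and multiplicative sequences to the elimination system *)

Section Orbits.
Context {F L : fieldType} (i : {rmorphism F -> L}) (x : nat -> L).

Lemma orbit_add (gam : F) p : (forall q, x q.+1 = i 1 * x q + i gam) -> x p = x 0%N + i gam *+ p.
Proof.
move=> hx; elim: p => [|p IH]; first by rewrite mulr0n addr0.
by rewrite hx IH rmorph1 mul1r mulrSr addrA.
Qed.

Lemma orbit_mul (gam : F) p : (forall q, x q.+1 = i gam * x q + i 0) -> x p = i gam ^+ p * x 0%N.
Proof.
move=> hx; elim: p => [|p IH]; first by rewrite expr0 mul1r.
by rewrite hx IH rmorph0 addr0 exprS mulrA.
Qed.

(** A translate has the same leading coefficient, so being associate means being equal; a periodic
    polynomial is constant in characteristic zero. *)
Lemma translate_not_eqp (gam : F) (P : {poly F}) k : (forall k : nat, (k.+1)%:R != 0 :> F) ->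
  gam != 0 -> (1 < size P)%N -> (0 < k)%N -> ~~ (sh 1 gam k P %= P).
Proof.
move=> ch g0 sP k0; apply/negP => /eqpP[[y z] /= /andP[y0 z0] E].
have P0 : P != 0 by rewrite -size_poly_gt0 ltnW.
have gk0 : gam *+ k != 0 by rewrite -mulr_natr mulf_neq0// -(prednK k0).
have shk : sh 1 gam k P = sh 1 (gam *+ k) 1 P by rewrite /sh !aff_add mulr1n.
have hP : sh 1 (gam *+ k) 1 P = P.
  have E' : sh 1 (gam *+ k) 1 P = (y^-1 * z) *: P.
    by rewrite -shk -scalerA -E scalerA mulVf// scale1r.
  have := @size_sh_sub _ (gam *+ k) P (size P).-1; rewrite prednK ?size_poly_gt0// leqnn => /(_ isT).
  rewrite E' -{2}[P]scale1r -scalerBl => h.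
  have [e|ne] := eqVneq (y^-1 * z - 1) 0.
    by have /eqP := e; rewrite subr_eq0 => /eqP ->; rewrite scale1r.
  by move: h; rewrite size_scale// -ltnS prednK ?size_poly_gt0// ltnn.
have [e Pe] := translation_invariant_const ch gk0 hP.
by move: sP; rewrite Pe ltnNge size_polyC_leq1.
Qed.

(** A second nonzero coefficient, at b below the degree f, would force gam^(k(f-b)) = 1 with
    exponent at most [n]. So [P] would be a monomial, whose only root 0 does not lie on the
    orbit. *)
Lemma dilate_not_eqp (gam : F) (P : {poly F}) k n p : x p != 0 ->
  (forall j, (1 <= j <= n)%N -> gam ^+ j != 1) -> gam != 0 ->
  (map_poly i P).[x p] = 0 -> (1 < size P)%N -> (0 < k)%N -> (k * (size P).-1 <= n)%N ->
  ~~ (sh gam 0 k P %= P).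
Proof.
move=> x0 hg g0 Px sP k0 kn; apply/negP => /eqpP[[y z] /= /andP[y0 z0] E].
have P0 : P != 0 by rewrite -size_poly_gt0 ltnW.
set f := (size P).-1 in kn.
have Pf : P`_f != 0 by rewrite -lead_coefE lead_coef_eq0.
have hc b : y * gam ^+ (k * b) * P`_b = z * P`_b.
  by have := congr1 (fun T : {poly F} => T`_b) E; rewrite !coefZ coef_sh_mul mulrA.
have zE : z = y * gam ^+ (k * f) by apply: (mulIf Pf); rewrite hc.
have low b : (b < f)%N -> P`_b = 0.
  move=> bf; apply/eqP/negPn/negP => Pb.
  have : y * gam ^+ (k * b) = y * gam ^+ (k * f) by rewrite -zE; apply: (mulIf Pb).
  move=> /(mulfI y0) e.
  have kb : (k * f = k * (f - b) + k * b)%N by rewrite -mulnDr subnK// ltnW.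
  have gb : gam ^+ (k * b) != 0 by rewrite expf_neq0.
  have : gam ^+ (k * (f - b)) = 1 by apply: (mulIf gb); rewrite -exprD -kb mul1r e.
  apply/eqP; apply: hg; rewrite muln_gt0 k0 subn_gt0 bf/=.
  by rewrite (leq_trans _ kn)// leq_mul2l leq_subr orbT.
have PE : P = P`_f *: 'X^f.
  apply/polyP => b; rewrite coefZ coefXn; case: (ltngtP b f) => [bf|fb|->].
  - by rewrite low// mulr0.
  - by rewrite nth_default ?mulr0// -[size P]prednK// ltnW.
  - by rewrite mulr1.
move: Px; rewrite PE map_polyZ/= hornerZ map_polyXn hornerXn => /eqP.
by rewrite mulf_eq0 fmorph_eq0 (negbTE Pf)/= expf_eq0 (negbTE x0) andbF.
Qed.

End Orbits.

Section Cases.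
Context {R : realType} {K : fieldExtType rat} (w : place R K) (n t : nat).
Hypothesis (t0 : (0 < t)%N) (nt : (4 * t <= n)%N).

Lemma setup_exists (xi : nat -> completion w) :
  (exists2 gamma : K, gamma != 0 &
    (forall i : nat, (1 <= i <= n)%N -> xi i.+1 = emb w gamma + xi i) \/
    ((forall i : nat, (1 <= i <= n)%N -> xi i.+1 = emb w gamma * xi i) /\
     (forall i : nat, (1 <= i <= 2 * n)%N -> gamma ^+ i != 1))) ->
  (forall i : nat, (1 <= i <= n.+1)%N -> xi i = 0) \/
  exists S : setup w, [/\ sn S = n, st S = t & forall p, (p <= n)%N -> xi p.+1 = sx S p].
Proof.
move=> [gam g0 H].
have ch (k : nat) : (k.+1)%:R != 0 :> K by rewrite natK0.
(* The sequence [xi] is constrained only up to index n + 1; the orbit continues the recursion to all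
   indices. *)
pose orb a c q : completion w := iter q (fun z => emb w a * z + emb w c) (xi 1%N).
have orbS a c q : orb a c q.+1 = emb w a * orb a c q + emb w c by [].
case: H => [H|[H Hg]].
  right; have [g [u tri]] := additive_pairing n ch g0 (orbS 1 gam).
  have inj i j : (i < j <= n)%N -> orb 1 gam i != orb 1 gam j.
    move=> /andP[ij _]; rewrite (orbit_add i (orbS 1 gam)) (orbit_add j (orbS 1 gam)).
    rewrite (inj_eq (addrI _)) eq_sym -subr_eq0 -mulrnBr ?(ltnW ij)// -rmorphMn fmorph_eq0.
    by rewrite -mulr_natr mulf_neq0// -(prednK (_ : 0 < j - i)%N) ?subn_gt0.
  have free (P : {poly K}) k p : (1 < size P)%N -> (p <= n)%N ->
    (map_poly (emb w) P).[orb 1 gam p] = 0 -> (0 < k)%N -> (k * (size P).-1 <= n)%N ->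
    ~~ (sh 1 gam k P %= P) by move=> sP _ _ k0 _; exact: translate_not_eqp.
  exists (Setup t0 nt (oner_neq0 K) (orbS 1 gam) tri inj free); split=> //= p pn.
  elim: p pn => [//|p IH] pn.
  by rewrite H ?pn// IH ?(ltnW pn)// orbS rmorph1 mul1r addrC.
(* A zero start makes all terms zero; the pairing of the multiplicative case divides by a power of
   the start. *)
have [x0|x0] := eqVneq (xi 1%N) 0.
  left=> i; case: i => // i; rewrite ltnS => /= h.
  elim: i h => [//|i IH] h.
  by rewrite H ?h// IH ?mulr0// ltnW.
right; have Hn k : (1 <= k <= n)%N -> gam ^+ k != 1.
  by move=> /andP[k1 kn]; apply: Hg; rewrite k1 (leq_trans kn)// leq_pmull.
have [g [u tri]] := multiplicative_pairing g0 Hn x0 (orbS gam 0).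
have e0 : emb w gam != 0 by rewrite fmorph_eq0.
have orb0 p : orb gam 0 p != 0.
  by rewrite (orbit_mul p (orbS gam 0)) mulf_neq0// expf_neq0.
have inj i j : (i < j <= n)%N -> orb gam 0 i != orb gam 0 j.
  move=> /andP[ij jn]; rewrite (orbit_mul i (orbS gam 0)) (orbit_mul j (orbS gam 0)).
  rewrite (inj_eq (mulIf x0)) -!rmorphXn (inj_eq (fmorph_inj _)).
  rewrite -(subnK (ltnW ij)) exprD -[X in X == _]mul1r.
  rewrite (inj_eq (mulIf (expf_neq0 i g0))) eq_sym Hn// subn_gt0 ij.
  by rewrite (leq_trans (leq_subr _ _)).
have free (P : {poly K}) k p : (1 < size P)%N -> (p <= n)%N ->
  (map_poly (emb w) P).[orb gam 0 p] = 0 -> (0 < k)%N -> (k * (size P).-1 <= n)%N ->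
  ~~ (sh gam 0 k P %= P).
  by move=> sP _ Pp k0 kn; exact: (dilate_not_eqp (orb0 p) Hn g0 Pp sP k0 kn).
exists (Setup t0 nt g0 (orbS gam 0) tri inj free); split=> //= p pn.
elim: p pn => [//|p IH] pn.
by rewrite H ?pn// IH ?(ltnW pn)// orbS rmorph0 addr0.
Qed.

End Cases.

Theorem theorem2p3 (R : realType) (K : fieldExtType rat) (w : place R K)
    (n t : nat) (xi : nat -> completion w) :
  (0 < n)%N -> (0 < t)%N -> (4 * t <= n)%N ->
  (exists2 gamma : K, gamma != 0 &
    (forall i : nat, (1 <= i <= n)%N -> xi i.+1 = emb w gamma + xi i) \/
    ((forall i : nat, (1 <= i <= n)%N -> xi i.+1 = emb w gamma * xi i) /\
     (forall i : nat, (1 <= i <= 2 * n)%N -> gamma ^+ i != 1))) ->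
  (\forall Y \near +oo%R, exists Q : {poly K},
     [/\ Q != 0, (size Q <= n.+1)%N,
         forall v : place R K, ~ same_place v w ->
           pnorm (cabs v) (map_poly (emb v) Q) <= 1,
         pnorm (cabs w) (map_poly (emb w) Q) <= Y
       & \big[Num.max/0]_(t.+1 <= i < n.+2) cabs w (map_poly (emb w) Q).[xi i]
           <= Y `^ (- ((4 * t)%:R / (n%:R + 1 - (4 * t)%:R)))]) ->
  forall i : nat, (1 <= i <= n.+1)%N ->
    exists2 m : nat, algebraic_of_degree (emb w) (xi i) m
                   & m%:R < n%:R / t%:R :> rat.
Proof.
move=> n0 t0 nt hgam [M [_ hM]] i hi.
have lt_ratio d : (d * t < n)%N -> d%:R < n%:R / t%:R :> rat.
  by move=> h; rewrite ltr_pdivlMr ?ltr0n// -natrM ltr_nat.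
case: (setup_exists t0 nt hgam) => [xi0|[S [nE tE xE]]].
  exists 1%N; last by apply: lt_ratio; rewrite mul1n; lia.
  exists 'X; split; [exact: monicX| |by rewrite map_polyX rootX xi0|exact: size_polyX].
  by have := @irredp_XsubC K 0; rewrite subr0.
have [d hd dt] : exists2 d, algebraic_of_degree (emb w) (sx S i.-1) d & (d * st S < sn S)%N.
  (* The filter at infinity provides a strict inequality M < Y, whereas the system is stated for all
     Y from a threshold on. *)
  apply: all_algebraic; exists (M + 1) => Y hY.
  have [|Q [Q0 sQ nQ wQ smQ]] := hM Y; first by lra.
  exists Q; split=> //; first by rewrite nE.
  - by move=> v vw; have := nQ v vw; rewrite map_emb_pnorm.
  - by move: wQ; rewrite map_emb_pnorm.
  - move=> l /andP[tl ln]; rewrite /kap nE tE; apply: le_trans smQ.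
    rewrite nE in ln; rewrite tE in tl; rewrite -xE//.
    apply: (le_bigmax_seq 0 l.+1 xpredT (fun i => cabs w (map_poly (emb w) Q).[xi i])) => //.
    by rewrite mem_index_iota !ltnS tl.
case: i hi hd => [//|i] /andP[_ hi] hd; rewrite ltnS in hi.
exists d; first by rewrite (xE i hi).
by apply: lt_ratio; rewrite -nE -tE.
Qed.
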